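(* For all $t\in[0,\infty)$ and all $\psi\in\overline{\mathrm{Ker}(B)\cap H^1}$, $T^{(c)}_t\psi$ converges to $T^\ast_t\psi$ in $H$ as $|c|\to\infty$.
   Context: Setting. $(M,g)$ is a compact oriented $d$-dimensional Riemannian manifold without boundary, $U\in C^1(M)$ is such that $\pi(dx)=e^{-U(x)}\mathrm{vol}(dx)$ is a probability measure, $\langle f,h\rangle=\int_M fh\,d\pi$, and $v\cdot w$ denotes the Riemannian inner product of tangent vectors. $A$ is the Friedrichs extension in $L^2(M,\pi)$ of $f\mapsto\Delta f-\nabla U\cdot\nabla f$ on $C^\infty(M)$ ($\Delta$ has spectrum in $(-\infty,0]$). It is assumed that $A$ has discrete spectrum $0=\lambda_0>-\lambda_1\ge-\lambda_2\ge\dots$ with $\lambda_n\to\infty$ and a complete orthonormal basis of eigenvectors $\phi_0,\phi_1,\dots$ of $L^2(M,\pi)$, with $\phi_0$ spanning the constants. $H=L^2(M,\pi)$, $H^m=\{\varphi=\sum_{k\ge0}a_k\phi_k\in L^2(M,\pi):\ \sum_{k\ge0}|a_k|^2\lambda_k^m<\infty\}$, and $\langle f,h\rangle_{H^1}=\int_M\nabla f\cdot\nabla h\,d\pi$ on $H^1$; $\mathrm{Dom}(A)=H^2$. $b$ is a $C^1$ vector field on $M$ with $\mathrm{div}(e^{-U}b)=0$ and $H^1\subset\mathrm{Dom}(b\cdot\nabla)$. $B:H^1\to H$ is the continuous extension of $f\mapsto b\cdot\nabla f$ from smooth functions; it is antisymmetric. $\mathrm{Ker}(B)\cap H^1=\{\varphi\in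 H^1:B\varphi=0\}$, and the bar denotes closure in $H$. For $c\in\mathbb{R}$, $A_c:=A+cB$ with domain $H^2$, and $(T^{(c)}_t)_{t\ge0}$ is the strongly continuous contraction semigroup on $H$ generated by $A_c$. For $\lambda>0$, $g\in H$: $R^\ast_\lambda g:=-P_{1,\lambda}(A-\lambda)^{-1}g$, where $P_{1,\lambda}$ is the orthogonal projection of $H^1$ onto $\mathrm{Ker}(B)\cap H^1$ with respect to $\langle\psi,\varphi\rangle_{1,\lambda}=\langle\psi,\varphi\rangle_{H^1}+\lambda\langle\psi,\varphi\rangle$. $(T^\ast_t)_{t\ge0}$ is the strongly continuous contraction semigroup of symmetric operators on $\overline{\mathrm{Ker}(B)\cap H^1}$ associated to the closed form $(u,v)\mapsto\langle u,v\rangle_{H^1}$ with domain $\mathrm{Ker}(B)\cap H^1$; it is related to $R^\ast_\lambda$ by $R^\ast_\lambda g=\int_0^\infty e^{-\lambda t}T^\ast_t g\,dt$ for $g\in\overline{\mathrm{Ker}(B)\cap H^1}$. *)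

(* Defs.v *)
From mathcomp Require Import all_boot all_order all_algebra.
From mathcomp Require Import all_classical all_reals all_analysis.

Set Implicit Arguments.
Unset Strict Implicit.
Unset Printing Implicit Defensive.
Import Order.TTheory GRing.Theory Num.Theory.
Import numFieldNormedType.Exports.

Local Open Scope classical_set_scope.
Local Open Scope ring_scope.

Section euclidean.
Context {R : realType}.

Definition partial {d} (a : 'I_d) (f : 'rV[R]_d -> R) : 'rV[R]_d -> R :=
  fun y => 'D_(delta_mx 0 a) f y.

(* [f] is of class C^k on the open set [W]; the values of [f] outside [W] are
   irrelevant. *)
Fixpoint Ck {d} (k : nat) (W : set 'rV[R]_d) (f : 'rV[R]_d -> R) : Prop :=
  (forall y, W y -> {for y, continuous f}) /\
  match k with
  | 0%N => True
  | k'.+1 => forall a : 'I_d,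
      (forall y, W y -> derivable f y (delta_mx 0 a)) /\ Ck k' W (partial a f)
  end.

(* Row-vector convention, as for the library's ['J]: a tangent vector [v] is
   pushed forward by [F] to [v *m jac F y]. *)
Definition jac {d} (F : 'rV[R]_d -> 'rV[R]_d) (y : 'rV[R]_d) : 'M[R]_d :=
  \matrix_(a < d, c < d) partial a (fun z => F z 0 c) y.

(* Integral of a nonnegative Borel function on R^d against d-dimensional
   Lebesgue measure, as an iterated integral (Tonelli). *)
Fixpoint lebesgue_int (d : nat) : ('rV[R]_d -> \bar R) -> \bar R :=
  match d with
  | 0%N => fun F => F 0
  | d'.+1 => fun F =>
      (\int[@lebesgue_measure R]_t
         @lebesgue_int d' (fun y => F (row_mx (t%:M : 'rV[R]_1) y)))%E
  end.

End euclidean.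

(* Compact oriented smooth Riemannian manifold without boundary.
   [param i] inverts the chart [chart i] on its image; [chart_at] names, for
   each point, one chart around it; the atlas is oriented; [metric i y] is the
   Gram matrix of the coordinate vector fields of chart [i] at the point of
   coordinates [y].  Second countability follows from compactness. *)
Record riemannian_manifold (R : realType) (d : nat) := RiemannianManifold {
  manifold_sort :> ptopologicalType;
  manifold_compact : compact [set: manifold_sort];
  manifold_hausdorff : hausdorff_space manifold_sort;
  chart_idx : Type;
  chart_dom : chart_idx -> set manifold_sort;
  chart : chart_idx -> manifold_sort -> 'rV[R]_d;
  param : chart_idx -> 'rV[R]_d -> manifold_sort;
  chart_at : manifold_sort -> chart_idx;
  chart_at_dom : forall x, chart_dom (chart_at x) x;
  chart_dom_open : forall i, open (chart_dom i);
  chart_img_open : forall i, open (chart i @` chart_dom i);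
  chartK : forall i x, chart_dom i x -> param i (chart i x) = x;
  chart_continuous : forall i x, chart_dom i x -> {for x, continuous (chart i)};
  param_continuous : forall i y,
    (chart i @` chart_dom i) y -> {for y, continuous (param i)};
  transition_smooth : forall i j k a,
    Ck k (chart i @` (chart_dom i `&` chart_dom j))
         (fun y => chart j (param i y) 0 a);
  transition_oriented : forall i j x, chart_dom i x -> chart_dom j x ->
    0 < \det (jac (fun y => chart j (param i y)) (chart i x));
  metric : chart_idx -> 'rV[R]_d -> 'M[R]_d;
  metric_smooth : forall i k a c,
    Ck k (chart i @` chart_dom i) (fun y => metric i y a c);
  metric_sym : forall i x, chart_dom i x ->
    (metric i (chart i x))^T = metric i (chart i x);
  metric_pos : forall i x (v : 'rV[R]_d), chart_dom i x -> v != 0 ->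
    0 < (v *m metric i (chart i x) *m v^T) 0 0;
  metric_tensor : forall i j x, chart_dom i x -> chart_dom j x ->
    metric i (chart i x) =
      jac (fun y => chart j (param i y)) (chart i x)
      *m metric j (chart j x)
      *m (jac (fun y => chart j (param i y)) (chart i x))^T
}.

Notation borel M := (g_sigma_algebraType (@open M)).

Section manifold.
Context {R : realType} {d : nat} {M : riemannian_manifold R d}.

Definition chart_img (i : chart_idx M) : set 'rV[R]_d :=
  chart i @` chart_dom i.

Definition Ck_fun (k : nat) (f : M -> R) : Prop :=
  forall i, Ck k (chart_img i) (fun y => f (param i y)).

Definition smooth (f : M -> R) : Prop := forall k, Ck_fun k f.

(* [X i x] is the row of coordinates in chart [i] of the tangent vector of [X]
   at [x]; it is meaningful only for [x] in the domain of chart [i]. *)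
Definition vfield : Type := chart_idx M -> M -> 'rV[R]_d.

Definition is_vfield (X : vfield) : Prop :=
  forall i j x, chart_dom i x -> chart_dom j x ->
    X j x = X i x *m jac (fun y => chart j (param i y)) (chart i x).

Definition C1_vfield (X : vfield) : Prop :=
  is_vfield X /\
  forall i a, Ck 1 (chart_img i) (fun y => X i (param i y) 0 a).

Definition measurable_vfield (X : vfield) : Prop :=
  is_vfield X /\
  forall i a, measurable_fun (chart_dom i : set (borel M))
                (fun x : borel M => X i x 0 a).

Definition dotv (X Y : vfield) (x : M) : R :=
  let i := chart_at x in
  (X i x *m metric i (chart i x) *m (Y i x)^T) 0 0.

Definition grad (f : M -> R) : vfield := fun i x =>
  (\row_a partial a (fun y => f (param i y)) (chart i x))
  *m invmx (metric i (chart i x)).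

Definition divv (X : vfield) (x : M) : R :=
  let i := chart_at x in
  let vdens y := Num.sqrt (\det (metric i y)) in
  (vdens (chart i x))^-1 *
  \sum_(a < d) partial a (fun y => vdens y * X i (param i y) 0 a) (chart i x).

Definition laplace (f : M -> R) : M -> R := divv (grad f).

Definition riemannian_volume (vol : {measure set (borel M) -> \bar R}) : Prop :=
  forall i (E : set (borel M)), measurable E -> E `<=` chart_dom i ->
    vol E = lebesgue_int (fun y =>
      (\1_(chart i @` E) y * Num.sqrt (\det (metric i y)))%:E).

(* The generator on smooth functions. *)
Definition A0 (U : M -> R) (f : M -> R) : M -> R :=
  fun x => laplace f x - dotv (grad U) (grad f) x.

End manifold.

Arguments vfield {R d} M.

(* Elements of H = L^2(M, P) are represented by square-integrable functions,
   and equality in H by almost everywhere equality.  An unbounded operator is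
   given by its graph, a relation on functions. *)
Section Hilbert.
Context {R : realType} {d : nat} {M : riemannian_manifold R d}.
Variable P : probability (borel M) R.

Definition L2 : set (M -> R) :=
  [set f | (f : borel M -> R) \in Lfun P 2%:E].

Definition aeeq (f h : M -> R) : Prop :=
  {ae P, forall x : borel M, f x = h x}.

Definition ip (f h : M -> R) : R := \int[P]_(x in setT) (f x * h x).

Definition normH (f : M -> R) : \bar R :=
  'N[P]_2%:E[EFin \o (f : borel M -> R)].

Definition cvgH (f_ : nat -> M -> R) (f : M -> R) : Prop :=
  (normH (f_ n \- f) @[n --> \oo] --> 0%E).

Definition closureH (K : set (M -> R)) : set (M -> R) :=
  [set f | L2 f /\ exists f_ : nat -> M -> R, (forall n, K (f_ n)) /\ cvgH f_ f].

(* Friedrichs extension of a symmetric nonpositive operator [L] with domain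
   [D]: the restriction of the adjoint of [L] to the domain of the closure of
   the form (f, h) |-> - <L f, h> on [D]. *)
Definition friedrichs_form_dom (D : set (M -> R)) (L : (M -> R) -> M -> R)
    (u : M -> R) : Prop :=
  L2 u /\ exists f_ : nat -> M -> R,
    [/\ forall n, D (f_ n), cvgH f_ u &
     forall e : R, 0 < e -> exists N, forall m n, (N <= m)%N -> (N <= n)%N ->
       - ip (L (f_ m \- f_ n)) (f_ m \- f_ n) < e].

Definition friedrichs (D : set (M -> R)) (L : (M -> R) -> M -> R)
    (u w : M -> R) : Prop :=
  [/\ friedrichs_form_dom D L u, L2 w &
   forall h, D h -> ip u (L h) = ip w h].

Definition Aop (U : M -> R) : (M -> R) -> (M -> R) -> Prop :=
  friedrichs smooth (A0 U).

Definition eigenbasis (A : (M -> R) -> (M -> R) -> Prop)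
    (lam : nat -> R) (phi : nat -> M -> R) : Prop :=
  [/\ forall k, A (phi k) (fun x => - lam k * phi k x),
   forall k l, ip (phi k) (phi l) = (k == l)%:R &
   forall f, L2 f ->
     cvgH (fun n x => \sum_(0 <= k < n) ip f (phi k) * phi k x) f].

Definition discrete_spectrum (A : (M -> R) -> (M -> R) -> Prop)
    (lam : nat -> R) (phi : nat -> M -> R) : Prop :=
  [/\ lam 0%N = 0 /\ 0 < lam 1%N,
   forall n, lam n <= lam n.+1,
   lam n @[n --> \oo] --> +oo,
   eigenbasis A lam phi &
   exists a : R, aeeq (phi 0%N) (fun=> a)].

Definition Hm (lam : nat -> R) (phi : nat -> M -> R) (m : nat) : set (M -> R) :=
  [set u | L2 u /\ cvgn (series (fun k => ip u (phi k) ^+ 2 * lam k ^+ m))].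

(* Gradient of an element of H^1: the limit in L^2 of the gradients of smooth
   functions converging to it in H. *)
Definition is_weak_grad (u : M -> R) (G : vfield M) : Prop :=
  measurable_vfield G /\
  exists f_ : nat -> M -> R,
    [/\ forall n, smooth (f_ n), cvgH f_ u &
     (\int[P]_(x in [set: borel M])
        (dotv (fun i z => grad (f_ n) i z - G i z)
              (fun i z => grad (f_ n) i z - G i z) x)%:E)%E
       @[n --> \oo] --> 0%E].

Definition weak_grad (u : M -> R) : vfield M :=
  xget (fun _ _ => 0) [set G | is_weak_grad u G].

Definition ip1 (u v : M -> R) : R :=
  \int[P]_(x in [set: borel M]) dotv (weak_grad u) (weak_grad v) x.

Definition cvgH1 (u_ : nat -> M -> R) (u : M -> R) : Prop :=
  (ip1 (u_ n \- u) (u_ n \- u) + ip (u_ n \- u) (u_ n \- u)) @[n --> \oo]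
    --> (0 : R).

(* Domain of the closure in H of f |-> b . grad f on smooth functions. *)
Definition dom_transport (b : vfield M) : set (M -> R) :=
  [set u | L2 u /\ exists w, L2 w /\ exists f_ : nat -> M -> R,
    [/\ forall n, smooth (f_ n), cvgH f_ u &
     cvgH (fun n => dotv b (grad (f_ n))) w]].

(* [B] is the continuous extension to [H1] of f |-> b . grad f. *)
Definition transport_extension (b : vfield M) (H1 : set (M -> R))
    (B : (M -> R) -> M -> R) : Prop :=
  [/\ forall u, H1 u -> L2 (B u),
   forall f, smooth f -> aeeq (B f) (dotv b (grad f)) &
   forall u_ u, (forall n, H1 (u_ n)) -> H1 u -> cvgH1 u_ u ->
     cvgH (fun n => B (u_ n)) (B u)].

Definition ker_in (H1 : set (M -> R)) (B : (M -> R) -> M -> R) : set (M -> R) :=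
  [set u | H1 u /\ aeeq (B u) (fun=> 0)].

(* A + c B with domain [H2]. *)
Definition perturbed (H2 : set (M -> R)) (A : (M -> R) -> (M -> R) -> Prop)
    (B : (M -> R) -> M -> R) (c : R) (u w : M -> R) : Prop :=
  H2 u /\ exists a, A u a /\ aeeq w (fun x => a x + c * B u x).

(* The nonpositive operator, on the closed subspace [K], associated to the
   form [q] with domain [D]: L u = w iff q(u, v) = - <w, v> for all v in D. *)
Definition form_operator (K D : set (M -> R)) (q : (M -> R) -> (M -> R) -> R)
    (u w : M -> R) : Prop :=
  [/\ D u, K w & forall v, D v -> q u v = - ip w v].

Definition contraction_semigroup (K : set (M -> R))
    (T : R -> (M -> R) -> M -> R) : Prop :=
  (forall (t : R) f, 0 <= t -> K f -> K (T t f)) /\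
  (forall (t a : R) f h, 0 <= t -> K f -> K h ->
     aeeq (T t (fun x => a * f x + h x)) (fun x => a * T t f x + T t h x)) /\
  (forall (t : R) f, 0 <= t -> K f -> (normH (T t f) <= normH f)%E) /\
  (forall f, K f -> aeeq (T 0 f) f) /\
  (forall (s t : R) f, 0 <= s -> 0 <= t -> K f ->
     aeeq (T (s + t) f) (T s (T t f))) /\
  (forall f, K f -> normH (T t f \- f) @[t --> 0^'+] --> 0%E).

(* The generator of [T], as a semigroup on [K], is [L], with its domain. *)
Definition generated_by (K : set (M -> R)) (T : R -> (M -> R) -> M -> R)
    (L : (M -> R) -> (M -> R) -> Prop) : Prop :=
  forall u w, K u -> K w ->
    L u w <->
    normH (fun x => t^-1 * (T t u x - u x) - w x) @[t --> 0^'+] --> 0%E.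

Definition symmetric_semigroup (K : set (M -> R))
    (T : R -> (M -> R) -> M -> R) : Prop :=
  forall (t : R) f h, 0 <= t -> K f -> K h -> ip (T t f) h = ip f (T t h).

End Hilbert.

(* Main.v *)
Require Import Defs.
From HB Require Import structures.
From mathcomp Require Import all_boot all_order all_algebra.
From mathcomp Require Import all_classical all_reals all_analysis.
From mathcomp Require Import ring lra perm measurable_realfun.

Set Implicit Arguments.
Unset Strict Implicit.
Unset Printing Implicit Defensive.
Import Order.TTheory GRing.Theory Num.Theory.
Import numFieldNormedType.Exports.

Local Open Scope classical_set_scope.
Local Open Scope ring_scope.

(** The eigenbasis identifies H with l2.  Put J = (1 - A)^(-1/2), so that
  H^1 = J H and H^2 = J^2 H, and C = J B J.  Since every A + c B generates a
  contraction semigroup, <(A + c B) u, u> <= 0 for all real c, which forces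
  <B u, u> = 0 on H^2; with the continuity of B from H^1 to H, this makes C
  bounded and antisymmetric.  The resolvent of A + c B at 1 is J (1 - c C)^-1 J, and (1 - c C)^-1 converges
  strongly, as |c| goes to infinity, to the orthogonal projection Q onto Ker C:
  it fixes Ker C and is O(1/|c|) on the range of C, whose closure is the
  orthogonal complement of Ker C.  As J Q J is the resolvent at 1 of the limit
  semigroup on the closure of J (Ker C), a Duhamel estimate of Trotter-Kato type
  turns the convergence of resolvents into that of semigroups.

  Identifying the form int grad u . grad v dP with sum lam_k u_k v_k on H^1
  needs no divergence theorem: testing the equation of the constant eigenvector
  phi_0 gives int (A f) dP = 0 for smooth f, and this applied to
  A (f h) = f A h + h A f + 2 grad f . grad h yields the integration by parts. *)

(** * Resolvents and semigroups in a Hilbert space *)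

(** Elements of [H] are functions, [B] and the semigroups act on functions, and every law holds only
    up to almost everywhere equality. Coordinates in the eigenbasis lead to a space where equality
    is literal. That the operators respect almost everywhere equality must be proved: it comes from
    contractivity for the semigroups and from continuity on H^1 for [B]. Linearity of [B] is read
    off from the generators, which are linear and single-valued, and then extended by density.

    An element of H^1 is written [J a], where [a] is the list of its H^1 coordinates: the H^1 norm
    becomes the l2 norm of [a]. The link with actual gradients requires smooth functions to be dense
    for this norm; they are, because every eigenvector lies in the Friedrichs form domain and so is
    a limit of smooth functions in energy.

    In the semigroup estimate the initial vector has the form R R g with R = J Q J. One factor makes
    the orbit of the limit semigroup differentiable; the other is traded for the resolvent of A + c
    B, whose range lies in the domain of that operator. *)

Record hilbert {R : realType} {V : lmodType R} (ip : V -> V -> R) : Prop := {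
  ipC : forall x y, ip x y = ip y x;
  ipDl : forall x y z, ip (x + y) z = ip x z + ip y z;
  ipZl : forall a x z, ip (a *: x) z = a * ip x z;
  ip_ge0 : forall x, 0 <= ip x x;
  ip_eq0 : forall x, ip x x = 0 -> x = 0;
  ip_complete : forall u : nat -> V,
    (forall e, 0 < e -> exists N, forall m n, (N <= m)%N -> (N <= n)%N ->
       ip (u m - u n) (u m - u n) < e) ->
    exists l, forall e, 0 < e -> exists N, forall n, (N <= n)%N ->
       ip (u n - l) (u n - l) < e }.

Section Hilbert.
Context {R : realType} {V : lmodType R} {ip : V -> V -> R}.
Hypothesis Hip : hilbert ip.
Implicit Types (x y z : V) (a c : R).

Definition nrm x : R := Num.sqrt (ip x x).

Definition in_closure (S : set V) x : Prop :=
  forall e, 0 < e -> exists2 s, S s & nrm (x - s) < e.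

Definition lin_subspace (S : set V) : Prop :=
  S 0 /\ forall a x y, S x -> S y -> S (a *: x + y).

Lemma ipDr x y z : ip z (x + y) = ip z x + ip z y.
Proof. by rewrite ipC// ipDl// !(ipC Hip z). Qed.
Lemma ipZr a x z : ip z (a *: x) = a * ip z x.
Proof. by rewrite ipC// ipZl// (ipC Hip z). Qed.
Lemma ipNl x z : ip (- x) z = - ip x z.
Proof. by rewrite -scaleN1r ipZl// mulN1r. Qed.
Lemma ipNr x z : ip z (- x) = - ip z x.
Proof. by rewrite -scaleN1r ipZr mulN1r. Qed.
Lemma ipBl x y z : ip (x - y) z = ip x z - ip y z.
Proof. by rewrite ipDl// ipNl. Qed.
Lemma ipBr x y z : ip z (x - y) = ip z x - ip z y.
Proof. by rewrite ipDr ipNr. Qed.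
Lemma ip0l z : ip 0 z = 0.
Proof. by rewrite -(scale0r 0) ipZl// mul0r. Qed.
Lemma ip0r z : ip z 0 = 0.
Proof. by rewrite ipC// ip0l. Qed.

Lemma nrm_ge0 x : 0 <= nrm x. Proof. exact: sqrtr_ge0. Qed.
Lemma nrm_sqr x : nrm x ^+ 2 = ip x x.
Proof. by rewrite sqr_sqrtr// ip_ge0. Qed.
Lemma nrm0 : nrm 0 = 0. Proof. by rewrite /nrm ip0l sqrtr0. Qed.
Lemma nrm_eq0 x : nrm x = 0 -> x = 0.
Proof. by move=> h; apply: (ip_eq0 Hip); rewrite -nrm_sqr h expr0n. Qed.
Lemma nrmZ a x : nrm (a *: x) = `|a| * nrm x.
Proof. by rewrite /nrm ipZl// ipZr mulrA -expr2 sqrtrM ?sqr_ge0// sqrtr_sqr. Qed.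
Lemma nrmN x : nrm (- x) = nrm x.
Proof. by rewrite /nrm ipNl ipNr opprK. Qed.
Lemma nrmBC x y : nrm (x - y) = nrm (y - x).
Proof. by rewrite -nrmN opprB. Qed.
Lemma nrm_lt x e : 0 < e -> (nrm x < e) = (ip x x < e ^+ 2).
Proof. by move=> e0; rewrite -nrm_sqr ltr_pXn2r// ?nnegrE ?nrm_ge0// ltW. Qed.

Lemma ip_le x y : ip x y <= nrm x * nrm y.
Proof.
have [x0|x0] := eqVneq (nrm x) 0; first by rewrite (nrm_eq0 x0) ip0l nrm0 mul0r.
have xp : 0 < nrm x by rewrite lt_neqAle eq_sym x0 nrm_ge0.
have [y0|y0] := eqVneq (nrm y) 0; first by rewrite (nrm_eq0 y0) ip0r nrm0 mulr0.
have yp : 0 < nrm y by rewrite lt_neqAle eq_sym y0 nrm_ge0.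
(* With a = nrm x and b = nrm y, this square equals 2 a b (a b - <x, y>). *)
have := ip_ge0 Hip (nrm y *: x - nrm x *: y).
rewrite ipBl !ipBr !(ipZl Hip) !ipZr -!nrm_sqr (ipC Hip y x) => h.
have : 0 <= 2 * (nrm x * nrm y) * (nrm x * nrm y - ip x y) by nra.
by rewrite pmulr_rge0 ?subr_ge0// !mulr_gt0.
Qed.

Lemma normr_ip_le x y : `|ip x y| <= nrm x * nrm y.
Proof.
by rewrite ler_norml ip_le andbT -[leLHS]/(- _) lerNl -ipNl (le_trans (ip_le _ _))// nrmN.
Qed.

Lemma nrmD x y : nrm (x + y) <= nrm x + nrm y.
Proof.
have := ip_le x y => h.
rewrite -(ler_pXn2r (n:=2)) ?nnegrE ?nrm_ge0 ?addr_ge0 ?nrm_ge0//.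
rewrite nrm_sqr (ipDl Hip) !ipDr sqrrD !nrm_sqr (ipC Hip y x); lra.
Qed.

Lemma nrm_tri y x z : nrm (x - z) <= nrm (x - y) + nrm (y - z).
Proof. by rewrite -[x - z](subrKA y) nrmD. Qed.

Lemma nrm_lt0 x : (forall e, 0 < e -> nrm x < e) -> x = 0.
Proof.
move=> h; apply: nrm_eq0; apply/eqP; rewrite eq_le nrm_ge0 andbT.
by apply/ler_addgt0Pr => e e0; rewrite add0r ltW// h.
Qed.

Lemma closure_orth S x p : in_closure S p -> (forall s, S s -> ip x s = 0) ->
  ip x p = 0.
Proof.
move=> Sp xS; apply/eqP; rewrite -normr_eq0 eq_le normr_ge0 andbT.
apply/ler_addgt0Pr => e e0; rewrite add0r.
have k0 : 0 < nrm x + 1 by rewrite ltr_wpDl// nrm_ge0.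
have [s Ss ds] := Sp (e / (nrm x + 1)) (divr_gt0 e0 k0).
have -> : ip x p = ip x (p - s) by rewrite ipBr (xS s)// subr0.
rewrite (le_trans (normr_ip_le _ _))//.
have := nrm_ge0 x; have := nrm_ge0 (p - s); move: ds.
rewrite ltr_pdivlMr//; nra.
Qed.

Lemma in_closureS S x : S x -> in_closure S x.
Proof. by move=> Sx e e0; exists x => //; rewrite subrr nrm0. Qed.

Lemma subspace_closure S : lin_subspace S -> lin_subspace (in_closure S).
Proof.
move=> [S0 SD]; split; first exact: in_closureS.
move=> a x y Sx Sy e e0.
have a0 : 0 < `|a| + 1 by rewrite ltr_wpDl.
have [s Ss ds] := Sx (e / 2 / (`|a| + 1)) (divr_gt0 (divr_gt0 e0 (ltr0Sn _ _)) a0).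
have [r Sr dr] := Sy (e / 2) (divr_gt0 e0 (ltr0Sn _ _)).
exists (a *: s + r); first exact: SD.
rewrite opprD addrACA -scalerBr (le_lt_trans (nrmD _ _))// nrmZ.
move: ds; rewrite ltr_pdivlMr// => ds.
have := nrm_ge0 (x - s); have := normr_ge0 a; nra.
Qed.

Lemma projection S x : lin_subspace S ->
  exists2 p, in_closure S p & forall s, S s -> ip (x - p) s = 0.
Proof.
move=> [S0 SD].
pose E := [set ip (x - s) (x - s) | s in S].
have Ei : has_inf E.
  by split; [exists (ip (x - 0) (x - 0)), 0 | exists 0 => _ [s _ <-]; exact: ip_ge0].
have m_le s : S s -> inf E <= ip (x - s) (x - s).
  by move=> Ss; apply: ge_inf => //; [exact: Ei.2 | exists s].
set m := inf E in m_le *.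
have near n : exists s, S s /\ ip (x - s) (x - s) < m + n.+1%:R^-1.
  have [|_ [s Ss <-] h] := @inf_adherent _ E n.+1%:R^-1 _ Ei; first by rewrite invr_gt0.
  by exists s.
have [u uP] := choice near.
(* A minimizing sequence is Cauchy by the parallelogram identity. *)
have par s r : S s -> S r -> ip (s - r) (s - r) <=
    2 * (ip (x - s) (x - s) - m) + 2 * (ip (x - r) (x - r) - m).
  move=> Ss Sr.
  have Sm : S (2^-1 *: (s + r)).
    rewrite -[2^-1 *: _]addr0; apply: (SD) => //.
    by rewrite -[s]scale1r; apply: (SD).
  have := m_le _ Sm.
  have -> : x - 2^-1 *: (s + r) = 2^-1 *: ((x - s) + (x - r)).
    by rewrite addrACA -opprD scalerBr -mulr2n -(scaler_nat 2 x) scalerA mulVf ?scale1r ?pnatr_eq0.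
  have -> : s - r = (x - r) - (x - s) by rewrite [RHS]addrC opprB addrA subrK.
  move: (x - s) (x - r) => y z.
  rewrite (ipZl Hip) ipZr !ipBl !ipBr !(ipDl Hip) !ipDr (ipC Hip z y); lra.
have [|p pP] := ip_complete Hip (u:=u).
  move=> e e0; have [N NP] : exists N : nat, N.+1%:R^-1 < e / 4.
    have := @near_infty_natSinv_lt R (PosNum (divr_gt0 e0 (ltr0n R 4))).
    by move=> [N _ /(_ N (leqnn _))]; exists N.
  exists N => i j Ni Nj; apply: le_lt_trans (par _ _ (uP i).1 (uP j).1) _.
  have h k : (N <= k)%N -> ip (x - u k) (x - u k) - m < e / 4.
    move=> Nk; rewrite ltrBlDl (lt_le_trans (uP k).2)// lerD2l (le_trans _ (ltW NP))//.
    by rewrite lef_pV2 ?posrE// ler_nat.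
  by have := h _ Ni; have := h _ Nj; lra.
have pS : in_closure S p.
  move=> e e0; have [N /(_ N (leqnn _)) h] := pP (e ^+ 2) (exprn_gt0 _ e0).
  by exists (u N); [exact: (uP N).1 | rewrite nrmBC nrm_lt].
exists p => // s Ss.
have pm : ip (x - p) (x - p) <= m.
  apply/ler_addgt0Pr => e e0.
  have [N NP] : exists N : nat, N.+1%:R^-1 < e / 4.
    have := @near_infty_natSinv_lt R (PosNum (divr_gt0 e0 (ltr0n R 4))).
    by move=> [N _ /(_ N (leqnn _))]; exists N.
  pose k := nrm (x - p) + 1.
  have k0 : 0 < k by rewrite ltr_wpDl// nrm_ge0.
  have d0 : 0 < Num.min 1 (e / 4 / k) by rewrite lt_min ltr01 !divr_gt0.
  have [N' N'P] := pP _ (exprn_gt0 2 d0).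
  have := N'P (maxn N N') (leq_maxr _ _).
  rewrite -nrm_lt// lt_min ltr_pdivlMr// => /andP[h1 h2].
  have := (uP (maxn N N')).2; set s' := u _ in h1 h2 *.
  have : (maxn N N').+1%:R^-1 <= N.+1%:R^-1 :> R.
    by rewrite lef_pV2 ?posrE// ler_nat ltnS leq_maxl.
  move=> h3.
  have -> : ip (x - s') (x - s') = ip (x - p) (x - p) - 2 * ip (x - p) (s' - p)
      + ip (s' - p) (s' - p).
    have -> : x - s' = (x - p) - (s' - p) by rewrite opprB addrA subrK.
    move: (x - p) (s' - p) => y z; rewrite !ipBl !ipBr (ipC Hip z y); lra.
  have := ip_ge0 Hip (s' - p).
  have := ip_le (x - p) (s' - p); have := nrm_ge0 (x - p); have := nrm_ge0 (s' - p).
  move: h2 (le_lt_trans h3 NP); rewrite /k mulrDr mulr1 mulrC.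
  move: (maxn N N').+1%:R^-1 => a1; lra.
(* Minimality of [p] against p + t s. The value t = <x - p, s> / <s, s> chosen below turns it into -
   <x - p, s>^2 / <s, s> >= 0. *)
have tP t : 0 <= - 2 * t * ip (x - p) s + t ^+ 2 * ip s s.
  have [r Sr] : exists2 r, in_closure S r & r = p + t *: s.
    exists (t *: s + p); last by rewrite addrC.
    by apply: (subspace_closure (conj S0 SD)).2 => //; exact: in_closureS.
  (* [m] is an infimum over [S], while [r] is only in the closure: hence the passage to square
     roots, where the triangle inequality applies. *)
  have mr : m <= ip (x - r) (x - r).
    rewrite -nrm_sqr; have mge0 : 0 <= m by apply: lb_le_inf; [exact: Ei.1 | move=> _ [? _ <-]; exact: ip_ge0].
    rewrite -(sqr_sqrtr mge0) ler_pXn2r ?nnegrE ?sqrtr_ge0 ?nrm_ge0//.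
    apply/ler_addgt0Pr => e e0; have [s' Ss' ds'] := Sr _ e0.
    apply: le_trans (ler_wsqrtr (m_le _ Ss')) _; rewrite -/(nrm _).
    by rewrite (le_trans (nrm_tri r _ _))// lerD2l ltW.
  move=> rE; move: mr; rewrite rE opprD addrA.
  move: pm; move: (x - p) => y ym; rewrite !ipBl !ipBr !(ipZl Hip) !ipZr (ipC Hip s y); nra.
have [s0|s0] := eqVneq (ip s s) 0; first by rewrite (ip_eq0 Hip s0) ip0r.
have := tP (ip (x - p) s / ip s s).
have sp : 0 < ip s s by rewrite lt_neqAle eq_sym s0 ip_ge0.
have -> : - 2 * (ip (x - p) s / ip s s) * ip (x - p) s +
   (ip (x - p) s / ip s s) ^+ 2 * ip s s = - (ip (x - p) s ^+ 2 / ip s s) by field.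
rewrite oppr_ge0 pmulr_lle0 ?invr_gt0// => h.
by apply/eqP; rewrite -sqrf_eq0 eq_le h sqr_ge0.
Qed.

(** A mean value inequality by continuous induction: the supremum of the times at which the bound
    holds is attained by left continuity, and the control of right increments pushes it up to [t].
    Only right increments are estimated, since a generator is a right derivative. *)
Lemma le_bound_itv (F : R -> V) (t M : R) : (0 : R) <= t -> 0 <= M ->
  (forall s, 0 <= s -> s < t -> exists2 d, 0 < d & forall h, 0 < h -> h < d ->
     s + h <= t -> nrm (F (s + h) - F s) <= M * h) ->
  (forall s, 0 < s -> s <= t -> forall e, 0 < e -> exists2 d, 0 < d &
     forall h, 0 < h -> h < d -> h <= s -> nrm (F s - F (s - h)) < e) ->
  nrm (F t - F 0) <= M * t.
Proof.
move=> t0 M0 Fr Fl.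
pose E := [set s | 0 <= s /\ s <= t /\ nrm (F s - F 0) <= M * s].
have E0 : E 0 by rewrite /E /= subrr nrm0 mulr0 !lexx.
have Es : has_sup E by split; [exists 0 | exists t => s [_ []]].
pose w := sup E.
have w0 : 0 <= w by apply: sup_upper_bound.
have wt : w <= t by apply: ge_sup; [exists 0 | move=> s [_ []]].
have Ew : E w.
  have [wz|wz] := eqVneq w 0; first by rewrite wz.
  have wp : 0 < w by rewrite lt_neqAle eq_sym wz.
  split=> //; split=> //; apply/ler_addgt0Pr => e e0.
  have [d d0 dP] := Fl w wp wt e e0.
  have [s [s0 [st sM]] ws] := sup_adherent d0 Es.
  have [sE|sw] := eqVneq s w; first by rewrite -sE (le_trans sM)// lerDl ltW.
  have sltw : s < w by rewrite lt_neqAle sw/= sup_upper_bound.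
  have h1 : 0 < w - s by rewrite subr_gt0.
  have h2 : w - s < d by rewrite -/w in ws; lra.
  have h3 : w - s <= w by lra.
  have := dP _ h1 h2 h3; rewrite subKr => h.
  rewrite (le_trans (nrm_tri (F s) _ _))//.
  have : M * s <= M * w by rewrite ler_wpM2l// ltW.
  by move: sM h; lra.
have [wE|wE] := eqVneq w t; first by rewrite -wE; exact: Ew.2.2.
have wlt : w < t by rewrite lt_neqAle wE.
have [d d0 dP] := Fr w w0 wlt.
pose h := Num.min (d / 2) (t - w).
have h0 : 0 < h by rewrite lt_min divr_gt0//= subr_gt0.
have hd : h < d by rewrite gt_min; apply/orP; left; lra.
have ht : w + h <= t.
  by rewrite -lerBrDl ge_min lexx orbT.
have : E (w + h).
  split; [lra|split=> //]; rewrite (le_trans (nrm_tri (F w) _ _))// mulrDr addrC lerD//.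
    exact: Ew.2.2.
  exact: dP.
by move=> /(sup_upper_bound Es); rewrite -/w => ?; lra.
Qed.

(** * Contraction semigroups on a subspace and their generators *)

Definition semigroup (K : set V) (T : R -> V -> V) : Prop :=
  [/\ forall t x, 0 <= t -> K x -> K (T t x),
      forall t a x y, 0 <= t -> K x -> K y ->
        T t (a *: x + y) = a *: T t x + T t y,
      forall t x, 0 <= t -> K x -> nrm (T t x) <= nrm x,
      forall s t x, 0 <= s -> 0 <= t -> K x -> T (s + t) x = T s (T t x) &
      (forall x, K x -> T 0 x = x) /\
      forall x, K x -> forall e, 0 < e -> exists2 d, 0 < d & forall h, 0 < h ->
        h < d -> nrm (T h x - x) < e].

Definition gen (T : R -> V -> V) (u w : V) : Prop :=
  forall e, 0 < e -> exists2 d, 0 < d & forall h, 0 < h -> h < d ->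
    nrm (h^-1 *: (T h u - u) - w) < e.

Section Semigroup.
Context {K : set V} {T : R -> V -> V}.
Hypotheses (KS : lin_subspace K) (TS : semigroup K T).

Lemma subspaceB x y : K x -> K y -> K (x - y).
Proof. by move=> Kx Ky; rewrite addrC -scaleN1r; apply: KS.2. Qed.
Lemma subspaceZ a x : K x -> K (a *: x).
Proof. by move=> Kx; rewrite -[a *: x]addr0; apply: KS.2 => //; exact: KS.1. Qed.

Lemma sgK t x : 0 <= t -> K x -> K (T t x). Proof. by case: TS => h *; exact: h. Qed.
Lemma sg_le t x : 0 <= t -> K x -> nrm (T t x) <= nrm x.
Proof. by case: TS => _ _ h *; exact: h. Qed.
Lemma sgD s t x : 0 <= s -> 0 <= t -> K x -> T (s + t) x = T s (T t x).
Proof. by case: TS => _ _ _ h *; exact: h. Qed.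
Lemma sg0 x : K x -> T 0 x = x.
Proof. by case: TS => _ _ _ _ [h _] *; exact: h. Qed.
Lemma sgB t x y : 0 <= t -> K x -> K y -> T t (x - y) = T t x - T t y.
Proof.
move=> t0 Kx Ky; rewrite addrC -scaleN1r; case: TS => _ -> // _ _ _.
by rewrite scaleN1r addrC.
Qed.
Lemma sgZ t a x : 0 <= t -> K x -> T t (a *: x) = a *: T t x.
Proof.
move=> t0 Kx; have K0 := KS.1; have T0 : T t 0 = 0.
  by have := sgB t0 K0 K0; rewrite subr0 subrr.
by case: TS => _ /(_ t a x 0 t0 Kx K0) h _ _ _; rewrite -[a *: x]addr0 h T0 addr0.
Qed.
Lemma sg_cont x : K x -> forall e, 0 < e -> exists2 d, 0 < d & forall h, 0 < h ->
   h < d -> nrm (T h x - x) < e.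
Proof. by case: TS => _ _ _ _ [_ h]; exact: h. Qed.

(** Strong continuity at time 0 thereby becomes continuity uniform in [s]. *)
Lemma sg_incr s h x : 0 <= s -> 0 <= h -> K x ->
  nrm (T (s + h) x - T s x) <= nrm (T h x - x).
Proof.
move=> s0 h0 Kx; rewrite sgD// -sgB//; last exact: sgK.
by apply: sg_le => //; apply: subspaceB => //; exact: sgK.
Qed.

(** [T h] and [T t] commute, so the difference quotient at [T t u] is the image under [T t] of the
    one at [u]. *)
Lemma gen_sg t u w : 0 <= t -> K u -> K w -> gen T u w -> gen T (T t u) (T t w).
Proof.
move=> t0 Ku Kw g e e0; have [d d0 dP] := g e e0; exists d => // h h0 hd.
have h0' := ltW h0.
have KB : K (T h u - u) by apply: subspaceB => //; exact: sgK.
have -> : T h (T t u) = T t (T h u) by rewrite -!sgD// addrC.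
rewrite -(sgB t0 (sgK h0' Ku) Ku) -(sgZ _ t0 KB).
rewrite -(sgB t0 (subspaceZ _ KB) Kw).
apply: le_lt_trans (dP _ h0 hd); apply: sg_le => //.
by apply: subspaceB => //; exact: subspaceZ.
Qed.

End Semigroup.

(** * Resolvents of a bounded antisymmetric operator and their strong limit *)

Section Core.
Context {J C : {linear V -> V}} {b : R}.
Hypotheses (Jsym : forall x y, ip (J x) y = ip x (J y))
  (Jle : forall x, nrm (J x) <= nrm x) (Jinj : forall x, J x = 0 -> x = 0)
  (Cbd : forall x, nrm (C x) <= b * nrm x)
  (Canti : forall x y, ip (C x) y = - ip x (C y)).

Lemma ipCxx x : ip (C x) x = 0.
Proof. by have := Canti x x; rewrite (ipC Hip x) => h; lra. Qed.

(** Pairing with [x] kills the antisymmetric term. The bound is uniform in [c]; it yields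
    injectivity, closedness of the range and the contraction property of [resolvent]. *)
Lemma nrm_le_shift c x y : x - c *: C x = y -> nrm x <= nrm y.
Proof.
move=> xy; have : nrm x ^+ 2 <= nrm y * nrm x.
  rewrite nrm_sqr; apply: le_trans (ip_le y x).
  by rewrite -xy ipBl (ipZl Hip) ipCxx mulr0 subr0.
have := nrm_ge0 x; have := nrm_ge0 y; nra.
Qed.

Lemma shift_lin c a x y : (a *: x + y) - c *: C (a *: x + y) =
  a *: (x - c *: C x) + (y - c *: C y).
Proof. by rewrite linearP scalerDr opprD addrACA scalerBr !scalerA (mulrC c). Qed.

Lemma shiftB c x y : (x - y) - c *: C (x - y) = (x - c *: C x) - (y - c *: C y).
Proof. by rewrite linearB/= scalerBr !opprD !opprK addrACA. Qed.

(** The range is dense: a vector orthogonal to it is orthogonal to its own shift, and that product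
    is its squared norm. It is closed because [nrm_le_shift] makes preimages of a Cauchy sequence
    Cauchy. *)
Lemma shift_surj c x : exists y, y - c *: C y = x.
Proof.
pose S := range (fun y => y - c *: C y).
have S_sub : lin_subspace S.
  split; first by exists 0 => //; rewrite linear0 scaler0 subrr.
  by move=> a _ _ [u _ <-] [v _ <-]; exists (a *: u + v) => //; rewrite shift_lin.
have [p pS pO] := projection x S_sub.
have xp : x = p.
  have : ip (x - p) ((x - p) - c *: C (x - p)) = 0 by apply: pO; exists (x - p).
  rewrite ipBr ipZr (ipC Hip _ (C _)) ipCxx mulr0 subr0 => /(ip_eq0 Hip)/eqP.
  by rewrite subr_eq0 => /eqP.
rewrite -xp in pS => {pO}.
have near n : exists y, nrm (x - (y - c *: C y)) < n.+1%:R^-1.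
  by have [|_ [y _ <-] h] := pS n.+1%:R^-1; [rewrite invr_gt0|exists y].
have [y yP] := choice near.
have small e : 0 < e -> exists N, forall n, (N <= n)%N -> nrm (x - (y n - c *: C (y n))) < e.
  move=> e0; have [N _ NP] := @near_infty_natSinv_lt R (PosNum e0).
  by exists N => n Nn; apply: lt_trans (yP n) (NP _ Nn).
have [|l lP] := ip_complete Hip (u:=y).
  move=> e e0; have se : 0 < Num.sqrt e by rewrite sqrtr_gt0.
  have [N NP] := small (Num.sqrt e / 2) (divr_gt0 se (ltr0Sn _ _)).
  exists N => m n Nm Nn; rewrite -(sqr_sqrtr (ltW e0)) -nrm_lt//.
  apply: le_lt_trans (nrm_le_shift (c:=c) erefl) _; rewrite shiftB.
  apply: le_lt_trans (nrm_tri x _ _) _; rewrite nrmBC.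
  by have := NP _ Nm; have := NP _ Nn; lra.
exists l; apply/eqP; rewrite eq_sym -subr_eq0; apply/eqP/nrm_lt0 => e e0.
(* The bound [b] comes without a sign, hence its absolute value. *)
have k0 : 0 < 1 + `|c| * `|b| by rewrite ltr_pwDl// mulr_ge0.
have [N NP] := small (e / 2) (divr_gt0 e0 (ltr0Sn _ _)).
have d0 : 0 < e / 2 / (1 + `|c| * `|b|) by rewrite !divr_gt0.
have [N' N'P] := lP _ (exprn_gt0 2 d0).
have := NP (maxn N N') (leq_maxl _ _); have := N'P (maxn N N') (leq_maxr _ _).
set z := y _; rewrite -nrm_lt// ltr_pdivlMr// => h1 h2.
apply: le_lt_trans (nrm_tri (z - c *: C z) _ _) _.
rewrite -shiftB.
suff : nrm ((z - l) - c *: C (z - l)) <= nrm (z - l) * (1 + `|c| * `|b|) by move: h1 h2; lra.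
rewrite (le_trans (nrmD _ _))// nrmN nrmZ mulrDr mulr1 lerD2l mulrCA ler_wpM2l//.
rewrite (le_trans (Cbd _))// mulrC ler_wpM2l ?nrm_ge0 ?ler_norm//.
Qed.

Definition resolvent c x : V := sval (cid (shift_surj c x)).

Lemma resolventE c x : resolvent c x - c *: C (resolvent c x) = x.
Proof. by rewrite /resolvent; case: cid. Qed.

Lemma resolvent_uniq c x y : y - c *: C y = x -> resolvent c x = y.
Proof.
move=> yx; apply/eqP; rewrite -subr_eq0; apply/eqP/nrm_eq0/eqP.
rewrite eq_le nrm_ge0 andbT -nrm0; apply: (nrm_le_shift (c:=c)).
by rewrite shiftB yx resolventE subrr.
Qed.

Lemma resolventP c a x y : resolvent c (a *: x + y) = a *: resolvent c x + resolvent c y.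
Proof. by apply: resolvent_uniq; rewrite shift_lin !resolventE. Qed.

Lemma resolvent_le c x : nrm (resolvent c x) <= nrm x.
Proof. exact: nrm_le_shift (resolventE c x). Qed.

(** The orthogonal complement of the range of an antisymmetric operator is its kernel: for [d]
    orthogonal to the range, <C d, C d> = - <d, C (C d)> = 0. *)
Lemma ker_decomp x : exists d, C d = 0 /\ in_closure (range C) (x - d).
Proof.
have [|p pS pO] := @projection (range C) x.
  split; first by exists 0 => //; rewrite linear0.
  by move=> a _ _ [u _ <-] [v _ <-]; exists (a *: u + v) => //; rewrite linearP.
exists (x - p); split; last by rewrite subKr.
apply: (ip_eq0 Hip); rewrite Canti pO ?oppr0//; by exists (C (x - p)).
Qed.

Definition kerproj x : V := sval (cid (ker_decomp x)).

Lemma kerproj_ker x : C (kerproj x) = 0.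
Proof. by rewrite /kerproj; case: cid => ? []. Qed.

Lemma kerproj_ran x : in_closure (range C) (x - kerproj x).
Proof. by rewrite /kerproj; case: cid => ? []. Qed.

Lemma kerproj_orth x k : C k = 0 -> ip (x - kerproj x) k = 0.
Proof.
move=> Ck; rewrite (ipC Hip); apply: closure_orth (kerproj_ran x) _ => _ [y _ <-].
by apply/eqP; rewrite -oppr_eq0 -Canti Ck ip0l.
Qed.

Lemma ip_kerproj x k : C k = 0 -> ip (kerproj x) k = ip x k.
Proof. by move=> /(kerproj_orth x)/eqP; rewrite ipBl subr_eq0 => /eqP. Qed.

(** This variational characterization reduces every identity about [kerproj] to products with kernel
    vectors, linearity included. *)
Lemma kerproj_uniq x d : C d = 0 -> (forall k, C k = 0 -> ip d k = ip x k) ->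
  kerproj x = d.
Proof.
move=> Cd dP; apply/eqP; rewrite -subr_eq0; apply/eqP/(ip_eq0 Hip).
have Ck : C (kerproj x - d) = 0 by rewrite linearB/= kerproj_ker Cd subrr.
by rewrite ipBl (ip_kerproj _ Ck) dP// subrr.
Qed.

Lemma kerprojP a x y : kerproj (a *: x + y) = a *: kerproj x + kerproj y.
Proof.
apply: kerproj_uniq => [|k Ck]; first by rewrite linearP/= !kerproj_ker scaler0 addr0.
by rewrite !(ipDl Hip) !(ipZl Hip) !ip_kerproj.
Qed.

Lemma kerproj_le x : nrm (kerproj x) <= nrm x.
Proof.
have := ip_le x (kerproj x); rewrite -(ip_kerproj x (kerproj_ker x)) -nrm_sqr.
have := nrm_ge0 x; have := nrm_ge0 (kerproj x); nra.
Qed.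

(** With y the resolvent of C h, one has C y = c^-1 (y - C h) and |y|^2 = <C h, y> = - <h, C y>. As
    <h, C h> = 0, this is - c^-1 <h, y>, which gains the factor 1/|c|. *)
Lemma resolvent_ran c h : c != 0 -> nrm (resolvent c (C h)) <= nrm h / `|c|.
Proof.
move=> c0; have := resolventE c (C h); set y := resolvent _ _ => yE.
have Cy : C y = c^-1 *: (y - C h) by rewrite -{1}yE subKr scalerA mulVf// scale1r.
have : nrm y ^+ 2 <= nrm h / `|c| * nrm y.
  have -> : nrm y ^+ 2 = ip (C h) y.
    by rewrite nrm_sqr -yE ipBl (ipZl Hip) ipCxx mulr0 subr0.
  rewrite Canti Cy ipZr ipBr (ipC Hip h (C h)) ipCxx subr0.
  rewrite (le_trans (ler_norm _))// normrN normrM normfV mulrAC mulrC.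
  by rewrite ler_wpM2r ?invr_ge0// normr_ip_le.
have : 0 <= nrm h / `|c| by rewrite divr_ge0 ?nrm_ge0.
have := nrm_ge0 y; nra.
Qed.

Lemma resolvent_cvg x e : 0 < e -> exists N, forall c, N < `|c| ->
  nrm (resolvent c x - kerproj x) < e.
Proof.
move=> e0; have e2 : 0 < e / 2 by rewrite divr_gt0.
have [_ [h _ <-] hP] := kerproj_ran x e2.
(* Beyond this threshold [resolvent_ran] brings the contribution of [C h] down to [e / 2]; the other
   half pays for replacing x - Q x by [C h], and Q x itself is fixed by the resolvent. *)
exists (nrm h / (e / 2)) => c cP.
have cp : 0 < `|c| by apply: le_lt_trans cP; rewrite divr_ge0 ?nrm_ge0 ?ltW.
have c0 : c != 0 by rewrite -normr_gt0.
have xE : x = 1 *: (x - kerproj x - C h) + (1 *: C h + kerproj x).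
  by rewrite !scale1r addrA subrK subrK.
rewrite [X in resolvent c X]xE !resolventP !scale1r.
have -> : resolvent c (kerproj x) = kerproj x.
  by apply: resolvent_uniq; rewrite kerproj_ker scaler0 subr0.
rewrite addrA addrK (le_lt_trans (nrmD _ _))// [ltRHS](splitr e).
rewrite ltr_leD// ?(le_lt_trans (resolvent_le _ _))//.
rewrite (le_trans (resolvent_ran _ c0))// ler_pdivrMr// mulrC -ler_pdivrMr// ltW//.
Qed.

Definition resolvent_c c x : V := J (resolvent c (J x)).
Definition resolvent_lim x : V := J (kerproj (J x)).
Definition kerdom : set V := [set x | exists2 d, C d = 0 & x = J d].

Lemma resolvent_cB c x y : resolvent_c c (x - y) = resolvent_c c x - resolvent_c c y.
Proof.
rewrite /resolvent_c -linearB/=; congr (J _); rewrite linearB/= [J x - _]addrC.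
by rewrite -scaleN1r resolventP scaleN1r addrC.
Qed.

Lemma resolvent_cZ c a x : resolvent_c c (a *: x) = a *: resolvent_c c x.
Proof.
have R0 : resolvent c 0 = 0 by apply: resolvent_uniq; rewrite linear0 scaler0 subrr.
by rewrite /resolvent_c linearZ/= -[a *: J x]addr0 resolventP R0 addr0 linearZ.
Qed.

Lemma resolvent_limB x y : resolvent_lim (x - y) = resolvent_lim x - resolvent_lim y.
Proof.
rewrite /resolvent_lim -linearB/=; congr (J _); rewrite linearB/= [J x - _]addrC.
by rewrite -scaleN1r kerprojP scaleN1r addrC.
Qed.

Lemma resolvent_c_le c x : nrm (resolvent_c c x) <= nrm x.
Proof. by rewrite (le_trans (Jle _))// (le_trans (resolvent_le _ _)). Qed.

Lemma resolvent_lim_le x : nrm (resolvent_lim x) <= nrm x.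
Proof. by rewrite (le_trans (Jle _))// (le_trans (kerproj_le _)). Qed.

Lemma resolvent_c_cvg x e : 0 < e -> exists N, forall c, N < `|c| ->
  nrm (resolvent_c c x - resolvent_lim x) < e.
Proof.
move=> /(resolvent_cvg (J x))[N NP]; exists N => c /NP; apply: le_lt_trans.
by rewrite -linearB/=.
Qed.

Lemma resolvent_lim_kerdom x : kerdom (resolvent_lim x).
Proof. by exists (kerproj (J x)) => //; exact: kerproj_ker. Qed.

Lemma kerdom_subspace : lin_subspace kerdom.
Proof.
split; first by exists 0; rewrite linear0.
move=> a _ _ [d Cd ->] [h Ch ->]; exists (a *: d + h); last by rewrite linearP.
by rewrite linearP/= Cd Ch scaler0 addr0.
Qed.

(** R = [resolvent_lim] is symmetric. If [z] in the closure is orthogonal to all R R y, then taking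
    y = z gives |R z|^2 = 0; injectivity of [J] yields Q J z = 0, so [z] is orthogonal to [kerdom]
    and therefore to itself. The square of R appears because the semigroup estimate consumes two
    resolvents. *)
Lemma resolvent_lim_dense x : in_closure kerdom x ->
  in_closure ((fun y => resolvent_lim (resolvent_lim y)) @` in_closure kerdom) x.
Proof.
move=> Kx; have KS := subspace_closure kerdom_subspace.
have resP a y z : resolvent_lim (a *: y + z) = a *: resolvent_lim y + resolvent_lim z.
  by rewrite /resolvent_lim linearP/= kerprojP linearP.
have [|p pS pO] := @projection ((fun y => resolvent_lim (resolvent_lim y)) @` in_closure kerdom) x.
  split; last first.
    move=> a _ _ [u Ku <-] [v Kv <-]; exists (a *: u + v); last by rewrite !resP.
    exact: KS.2.
  exists 0; first exact: KS.1.
  have R0 : resolvent_lim 0 = 0.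
    by have := resolvent_limB 0 0; rewrite !subrr.
  by rewrite !R0.
have Kp : in_closure kerdom p.
  move=> e /pS[_ [y _ <-] h]; exists (resolvent_lim (resolvent_lim y)) => //.
  exact: resolvent_lim_kerdom.
suff -> : x = p by [].
apply/eqP; rewrite -subr_eq0; apply/eqP/(ip_eq0 Hip).
set z := x - p in pO *; have Kz : in_closure kerdom z by exact: subspaceB KS _ _ _ _.
have z0 : resolvent_lim z = 0.
  have := pO (resolvent_lim (resolvent_lim z)).
  have -> : ip z (resolvent_lim (resolvent_lim z)) = ip (resolvent_lim z) (resolvent_lim z).
    rewrite {1}/resolvent_lim -Jsym -(ip_kerproj _ (kerproj_ker _)) (ipC Hip).
    by rewrite (ip_kerproj _ (kerproj_ker _)) Jsym.
  by move=> h; apply: (ip_eq0 Hip); apply: h; exists z.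
have P0 := Jinj z0.
apply: closure_orth Kz _ => _ [d Cd ->].
by rewrite -Jsym -(ip_kerproj _ Cd) P0 ip0l.
Qed.

(** * From convergence of resolvents to convergence of semigroups *)

Section Trotter_Kato.
Context {T : R -> R -> V -> V} {S : R -> V -> V}.
(** [Tgen] says that [J y] is the resolvent at 1 of [x] for the generator of [T c]. In [Sgen], <d,
    k> - <J d, J k> is the energy form of [J d] and [J k], so that the right-hand side is the form
    equation of the limit operator. *)
Hypotheses (TS : forall c, semigroup setT (T c))
  (Tgen : forall c y x, y - c *: C y = J x -> gen (T c) (J y) (J y - x))
  (SS : semigroup (in_closure kerdom) S)
  (Sgen : forall u w, in_closure kerdom u -> in_closure kerdom w ->
     (gen S u w <-> exists2 d, C d = 0 & u = J d /\
        forall k, C k = 0 -> ip d k - ip (J d) (J k) = - ip w (J k))).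

Let KS := subspace_closure kerdom_subspace.
Let TSub : lin_subspace (@setT V). Proof. by []. Qed.

(** With R = [resolvent_lim]: [gen_sg] carries the generator relation of R x along the orbit, and
    [Sgen] then shows that S t (R x) solves the variational problem that characterizes R (S t x). *)
Lemma resolvent_lim_sg t x : 0 <= t -> in_closure kerdom x ->
  S t (resolvent_lim x) = resolvent_lim (S t x).
Proof.
move=> t0 Kx.
have Kr : in_closure kerdom (resolvent_lim x).
  by apply: in_closureS; exact: resolvent_lim_kerdom.
have Krx := subspaceB KS Kr Kx.
have : gen S (resolvent_lim x) (resolvent_lim x - x).
  apply/Sgen => //; exists (kerproj (J x)); [exact: kerproj_ker|split=> // k Ck].
  by rewrite ip_kerproj// ipBl opprB Jsym.
move=> /(gen_sg KS SS t0 Kr Krx)/(Sgen (sgK SS t0 Kr) (sgK SS t0 Krx)).1[d Cd [dE dP]].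
rewrite dE /resolvent_lim; congr (J _); apply/esym/kerproj_uniq => // k Ck.
have := dP k Ck; rewrite (sgB SS)// ipBl dE Jsym => h.
by rewrite Jsym; move: h; lra.
Qed.

(** Strong convergence of contractions is uniform on the compact orbit of [x]. The interval is
    covered by steps of length [d / 2], within which the orbit moves by less than [e / 3];
    contractivity transfers this to both resolvents, and the last third is convergence at the left
    end of the step. *)
Lemma resolvent_c_cvg_unif t x e : 0 <= t -> in_closure kerdom x -> 0 < e ->
  exists N, forall c, N < `|c| -> forall s, 0 <= s -> s <= t ->
    nrm (resolvent_c c (S s x) - resolvent_lim (S s x)) < e.
Proof.
move=> t0 Kx e0; have e3 : 0 < e / 3 by rewrite divr_gt0.
have [d d0 dP] := sg_cont SS Kx e3.
have [n nP] : exists n : nat, t <= n%:R * (d / 2).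
  exists (Num.bound (t / (d / 2))); rewrite -ler_pdivrMr ?divr_gt0//.
  by rewrite ltW// archi_boundP// !divr_ge0// ltW.
suff [N NP] : exists N, forall c, N < `|c| -> forall s, 0 <= s -> s <= n%:R * (d / 2) ->
    nrm (resolvent_c c (S s x) - resolvent_lim (S s x)) < e.
  by exists N => c /NP h s s0 st; apply: h => //; exact: le_trans nP.
elim: n {nP} => [|n [N IH]].
  have [N NP] := resolvent_c_cvg (S 0 x) e0; exists N => c /NP h s s0.
  by rewrite mul0r => s1; have -> : s = 0 by apply/eqP; rewrite eq_le s0 s1.
pose r := n%:R * (d / 2).
have r0 : 0 <= r by rewrite mulr_ge0// divr_ge0// ltW.
have [N' N'P] := resolvent_c_cvg (S r x) e3.
exists (Num.max N N') => c; rewrite gt_max => /andP[cN cN'] s s0 sn.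
have [sr|rs] := leP s r; first exact: IH.
have h0 : 0 < s - r by rewrite subr_gt0.
have hd : s - r < d by move: sn; rewrite -natr1 mulrDl mul1r -/r; lra.
have h1 : nrm (S s x - S r x) < e / 3.
  have -> : s = r + (s - r) by rewrite addrC subrK.
  by rewrite (le_lt_trans (sg_incr KS SS r0 (ltW h0) Kx))// dP.
have h2 := N'P c cN'.
have := resolvent_c_le c (S s x - S r x); rewrite resolvent_cB => h3.
have := resolvent_lim_le (S s x - S r x); rewrite resolvent_limB nrmBC => h4.
have := nrm_tri (resolvent_c c (S r x)) (resolvent_c c (S s x)) (resolvent_lim (S s x)).
have := nrm_tri (resolvent_lim (S r x)) (resolvent_c c (S r x)) (resolvent_lim (S s x)).
lra.
Qed.

(* Duhamel: [s |-> T c (t - s) (R_c (S s x))], [x = R g], has derivative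
   [T c (t - s) (R - R_c) (S s g)]. *)
Lemma duhamel_le c t e g : 0 <= t -> 0 < e -> in_closure kerdom g ->
  (forall s, 0 <= s -> s <= t ->
    nrm (resolvent_c c (S s g) - resolvent_lim (S s g)) < e) ->
  nrm (resolvent_c c (S t (resolvent_lim g)) - T c t (resolvent_c c (resolvent_lim g)))
  <= 2 * e * t.
Proof.
move=> t0 e0 Kg close; set x := resolvent_lim g.
have Kx : in_closure kerdom x by apply: in_closureS; exact: resolvent_lim_kerdom.
pose F s := T c (t - s) (resolvent_c c (S s x)).
have -> : resolvent_c c (S t x) = F t by rewrite /F subrr (sg0 (TS c)).
have -> : T c t (resolvent_c c x) = F 0 by rewrite /F subr0 (sg0 SS).
(* The contraction at time t - (s + h) factors out of both values of [F]; what remains compares one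
   short increment of each semigroup. *)
have step s h : 0 <= s -> 0 < h -> s + h <= t ->
    nrm (F (s + h) - F s) <= nrm (resolvent_c c (S h (S s x) - S s x) -
       (T c h (resolvent_c c (S s x)) - resolvent_c c (S s x))).
  move=> s0 h0 sh; rewrite /F.
  have -> : S (s + h) x = S h (S s x) by rewrite addrC (sgD SS (ltW h0) s0 Kx).
  have -> : t - s = (t - (s + h)) + h by rewrite opprD addrA subrK.
  have th : 0 <= t - (s + h) by rewrite subr_ge0.
  rewrite (sgD (TS c) th (ltW h0))// -(sgB (TS c) th)//.
  rewrite (le_trans (sg_le (TS c) th _))//.
  by rewrite resolvent_cB opprB addrA subrK.
apply: le_bound_itv => //; first by rewrite mulr_ge0// ltW.
(* Right increments. Since y = R (S s g), the generator of [S] maps y to y - S s g, and that of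
   [T c] maps R_c y to R_c y - y. The defect R_c (y - S s g) - (R_c y - y) is (R - R_c) (S s g),
   below [e]; the two difference quotients cost [e / 2] each, hence the factor 2. *)
- move=> s s0 st; pose y := S s x.
  have Ky : in_closure kerdom y by exact: (sgK SS s0 Kx).
  have Kgs : in_closure kerdom (S s g) by exact: (sgK SS s0 Kg).
  have yE : y = resolvent_lim (S s g) by exact: resolvent_lim_sg.
  have e2 : 0 < e / 2 by rewrite divr_gt0.
  have [d1 d1p d1P] : exists2 d, 0 < d & forall h, 0 < h -> h < d ->
      nrm (h^-1 *: (S h y - y) - (y - S s g)) < e / 2.
    suff : gen S y (y - S s g) by apply.
    apply/Sgen => //; first exact: subspaceB KS _ _ _ _.
    exists (kerproj (J (S s g))); first exact: kerproj_ker.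
    by split=> // k Ck; rewrite ip_kerproj// ipBl opprB yE Jsym.
  have [d2 d2p d2P] : exists2 d, 0 < d & forall h, 0 < h -> h < d ->
      nrm (h^-1 *: (T c h (resolvent_c c y) - resolvent_c c y) - (resolvent_c c y - y)) < e / 2.
    by apply: (Tgen (c:=c)) => //; exact: resolventE.
  exists (Num.min d1 d2); first by rewrite lt_min d1p.
  move=> h h0; rewrite lt_min => /andP[hd1 hd2] sh.
  apply: le_trans (step s h s0 h0 sh) _; rewrite -/y.
  rewrite -ler_pdivrMr// -[h^-1]gtr0_norm ?invr_gt0// mulrC -nrmZ scalerBr.
  rewrite -resolvent_cZ.
  set A := h^-1 *: _; set B := h^-1 *: _.
  have hA : nrm (resolvent_c c A - resolvent_c c (y - S s g)) < e / 2.
    by rewrite -resolvent_cB (le_lt_trans (resolvent_c_le _ _))// d1P.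
  have hB : nrm ((resolvent_c c y - y) - B) < e / 2 by rewrite nrmBC d2P.
  have hC := close s s0 (ltW st).
  have hD : nrm (resolvent_c c (y - S s g) - (resolvent_c c y - y)) < e.
    rewrite resolvent_cB opprB addrC addrA subrK yE -opprB nrmN; exact: hC.
  have := nrm_tri (resolvent_c c y - y) (resolvent_c c (y - S s g)) B.
  have := nrm_tri (resolvent_c c (y - S s g)) (resolvent_c c A) B; lra.
(* Left continuity. The vector [S (s - h) x] moves with [h], so strong continuity of [T c] is
   invoked only at the fixed vector [resolvent_c c y]; contractivity absorbs the discrepancy. *)
- move=> s s0 st eta eta0; pose y := S s x.
  have Ky : in_closure kerdom y by exact: (sgK SS (ltW s0) Kx).
  have e6 : 0 < eta / 6 by rewrite divr_gt0.
  have [d1 d1p d1P] := sg_cont SS Kx e6.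
  have [d2 d2p d2P] := sg_cont (TS c) (x := resolvent_c c y) I e6.
  exists (Num.min d1 d2); first by rewrite lt_min d1p.
  move=> h h0; rewrite lt_min => /andP[hd1 hd2] hs.
  have r0 : 0 <= s - h by rewrite subr_ge0.
  have Kr : in_closure kerdom (S (s - h) x) by exact: (sgK SS r0 Kx).
  have := step (s - h) h r0 h0; rewrite subrK => /(_ st) hh.
  apply: le_lt_trans hh _; rewrite (le_lt_trans (nrmD _ _))// nrmN.
  set z := S (s - h) x.
  have i1 : nrm (S h z - z) < eta / 6.
    rewrite -(sgD SS (ltW h0) r0 Kx) (addrC h).
    by rewrite (le_lt_trans (sg_incr KS SS r0 (ltW h0) Kx))// d1P.
  have i2 := le_lt_trans (resolvent_c_le c _) i1.
  have zy : S h z = y by rewrite -(sgD SS (ltW h0) r0 Kx) addrC subrK.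
  have i3 := d2P h h0 hd2.
  have i4 : nrm (T c h (resolvent_c c z) - T c h (resolvent_c c y)) < eta / 6.
    rewrite -(sgB (TS c) (ltW h0))// (le_lt_trans (sg_le (TS c) (ltW h0) _))//.
    by rewrite -resolvent_cB (le_lt_trans (resolvent_c_le _ _))// nrmBC -zy.
  have i5 : nrm (resolvent_c c y - resolvent_c c z) < eta / 6.
    by rewrite -resolvent_cB -zy.
  have := nrm_tri (T c h (resolvent_c c y)) (T c h (resolvent_c c z)) (resolvent_c c z).
  have := nrm_tri (resolvent_c c y) (T c h (resolvent_c c y)) (resolvent_c c z).
  lra.
Qed.

(** By contractivity of both semigroups [x] may be replaced by a nearby w = R R g. With y = R g, the
    chain T t w, T t (R_c y), R_c (S t y), R (S t y) = S t w has three gaps, closed by resolvent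
    convergence, by Duhamel, and by resolvent convergence again. This makes five errors in all. *)
Theorem trotter_kato t x : 0 <= t -> in_closure kerdom x ->
  forall e, 0 < e -> exists N, forall c, N < `|c| -> nrm (T c t x - S t x) < e.
Proof.
move=> t0 Kx e e0; have e5 : 0 < e / 5 by rewrite divr_gt0.
have [_ [g Kg <-]] := resolvent_lim_dense Kx e5.
set y := resolvent_lim g; set w := resolvent_lim y => wx.
have Ky : in_closure kerdom y by apply: in_closureS; exact: resolvent_lim_kerdom.
have Kw : in_closure kerdom w by apply: in_closureS; exact: resolvent_lim_kerdom.
have t1 : 0 < 2 * t + 1 by rewrite ltr_wpDl ?mulr_ge0.
have [N1 N1P] := resolvent_c_cvg y e5.
(* Divided by 2 t + 1 so that the Duhamel bound, 2 t times this accuracy, is at most [e / 5]. *)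
have [N2 N2P] := resolvent_c_cvg_unif t0 Kg (divr_gt0 e5 t1).
have [N3 N3P] := resolvent_c_cvg (S t y) e5.
exists (Num.max N1 (Num.max N2 N3)) => c; rewrite !gt_max => /and3P[c1 c2 c3].
have h1 : nrm (T c t x - T c t w) < e / 5.
  by rewrite -(sgB (TS c))// (le_lt_trans (sg_le (TS c) t0 _)).
have h2 : nrm (T c t w - T c t (resolvent_c c y)) < e / 5.
  by rewrite -(sgB (TS c))// (le_lt_trans (sg_le (TS c) t0 _))// nrmBC N1P.
have h3 := duhamel_le t0 (divr_gt0 e5 t1) Kg (N2P c c2).
have h4 := N3P c c3.
have h5 : nrm (S t w - S t x) < e / 5.
  rewrite -(sgB SS)// (le_lt_trans (sg_le SS t0 _))//; last by rewrite nrmBC.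
  exact: subspaceB KS _ _ _ _.
have h6 : 2 * (e / 5 / (2 * t + 1)) * t <= e / 5.
  rewrite mulrAC mulrA ler_pdivrMr//; nra.
rewrite -resolvent_lim_sg// -/w in h4; rewrite nrmBC -/y in h3.
have := nrm_tri (T c t w) (T c t x) (S t x).
have := nrm_tri (T c t (resolvent_c c y)) (T c t w) (S t x).
have := nrm_tri (resolvent_c c (S t y)) (T c t (resolvent_c c y)) (S t x).
have := nrm_tri (S t w) (resolvent_c c (S t y)) (S t x); lra.
Qed.

End Trotter_Kato.

End Core.

End Hilbert.

(** * Limits of sequences; linearity, uniqueness and dissipativity of generators *)

Section generator.
Context {R : realType} {V : lmodType R} {ip : V -> V -> R}.
Hypothesis Hip : hilbert ip.
Local Notation nrm := (nrm (ip:=ip)).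

Definition scvg (a_ : nat -> V) (a : V) : Prop := forall e, 0 < e ->
  exists N, forall n, (N <= n)%N -> nrm (a_ n - a) < e.

Lemma scvg_uniq (a_ : nat -> V) a b : scvg a_ a -> scvg a_ b -> a = b.
Proof.
move=> Ha Hb; apply/eqP; rewrite -subr_eq0; apply/eqP/(nrm_lt0 Hip) => e e0.
have e2 : 0 < e / 2 by rewrite divr_gt0.
have [N1 N1P] := Ha _ e2; have [N2 N2P] := Hb _ e2.
have := N1P (maxn N1 N2) (leq_maxl _ _); have := N2P (maxn N1 N2) (leq_maxr _ _).
move=> h1 h2; rewrite (splitr e).
apply: le_lt_trans (nrm_tri Hip (a_ (maxn N1 N2)) a b) _.
by rewrite (nrmBC Hip a); exact: ltrD h2 h1.
Qed.

Lemma scvg_lin c (a_ b_ : nat -> V) a b : scvg a_ a -> scvg b_ b ->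
  scvg (fun n => c *: a_ n + b_ n) (c *: a + b).
Proof.
move=> Ha Hb e e0; have c1 : 0 < `|c| + 1 by rewrite ltr_wpDl.
have e2 : 0 < e / 2 by rewrite divr_gt0.
have e3 : 0 < e / 2 / (`|c| + 1) by rewrite divr_gt0.
have [N1 N1P] := Ha _ e3; have [N2 N2P] := Hb _ e2.
exists (maxn N1 N2) => n; rewrite geq_max => /andP[/N1P h1 /N2P h2].
have -> : c *: a_ n + b_ n - (c *: a + b) = c *: (a_ n - a) + (b_ n - b).
  by rewrite scalerBr opprD addrACA.
apply: le_lt_trans (nrmD Hip _ _) _; rewrite (nrmZ Hip) (splitr e).
apply: ltrD h2; apply: le_lt_trans (_ : `|c| * (e / 2 / (`|c| + 1)) < _).
  by rewrite ler_wpM2l// ltW.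
by rewrite mulrCA gtr_pMr// ltr_pdivrMr// mul1r ltrDl.
Qed.

Lemma scvg_approx (S : set V) a : in_closure (ip:=ip) S a ->
  exists2 a_ : nat -> V, (forall n, S (a_ n)) & scvg a_ a.
Proof.
move=> Sa; have /choice [a_ aP] : forall n, exists b, S b /\ nrm (a - b) < n.+1%:R^-1.
  move=> n; have n0 : 0 < n.+1%:R^-1 :> R by rewrite invr_gt0.
  by have [b bS ab] := Sa _ n0; exists b.
exists a_ => [n|e e0]; first by have [] := aP n.
have [N _ NP] := near_infty_natSinv_lt (PosNum e0); exists N => n /NP /= h.
by rewrite (nrmBC Hip); apply: lt_trans h; have [] := aP n.
Qed.

Variable T : R -> V -> V.
Hypothesis TS : semigroup (ip:=ip) setT T.

(** Together with [gen_uniq] it is the source of the linearity of [B], which [transport_extension]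
    does not state. *)
Lemma gen_lin a u w u' w' : gen (ip:=ip) T u w -> gen (ip:=ip) T u' w' ->
  gen (ip:=ip) T (a *: u + u') (a *: w + w').
Proof.
move=> Hu Hu' e e0; have a1 : 0 < `|a| + 1 by rewrite ltr_wpDl.
have e2 : 0 < e / 2 by rewrite divr_gt0.
have e3 : 0 < e / 2 / (`|a| + 1) by rewrite divr_gt0.
have [d1 d10 D1] := Hu _ e3; have [d2 d20 D2] := Hu' _ e2.
exists (Num.min d1 d2); first by rewrite lt_min d10.
move=> h h0; rewrite lt_min => /andP[/(D1 h h0) h1 /(D2 h h0) h2].
have [_ L _ _ _] := TS; rewrite L//; last exact: ltW.
have -> : h^-1 *: (a *: T h u + T h u' - (a *: u + u')) - (a *: w + w') =
    a *: (h^-1 *: (T h u - u) - w) + (h^-1 *: (T h u' - u') - w').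
  have -> : a *: T h u + T h u' - (a *: u + u') = a *: (T h u - u) + (T h u' - u').
    by rewrite scalerBr opprD addrACA.
  by rewrite scalerDr scalerA mulrC -scalerA opprD addrACA -scalerBr.
apply: le_lt_trans (nrmD Hip _ _) _; rewrite (nrmZ Hip) (splitr e).
apply: ltrD h2; apply: le_lt_trans (_ : `|a| * (e / 2 / (`|a| + 1)) < _).
  by rewrite ler_wpM2l// ltW.
by rewrite mulrCA gtr_pMr// ltr_pdivrMr// mul1r ltrDl.
Qed.

Lemma gen_uniq u w w' : gen (ip:=ip) T u w -> gen (ip:=ip) T u w' -> w = w'.
Proof.
move=> Hw Hw'; apply/eqP; rewrite -subr_eq0; apply/eqP/(nrm_lt0 Hip) => e e0.
have e2 : 0 < e / 2 by rewrite divr_gt0.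
have [d1 d10 D1] := Hw _ e2; have [d2 d20 D2] := Hw' _ e2.
pose h := Num.min d1 d2 / 2.
have m0 : 0 < Num.min d1 d2 by rewrite lt_min d10.
have h0 : 0 < h by rewrite divr_gt0.
have : h < Num.min d1 d2 by rewrite ltr_pdivrMr// ltr_pMr// ltr1n.
rewrite lt_min => /andP[/(D1 h h0) h1 /(D2 h h0) h2].
rewrite (splitr e); apply: le_lt_trans (nrm_tri Hip (h^-1 *: (T h u - u)) w w') _.
by rewrite (nrmBC Hip w); exact: ltrD.
Qed.

(** Contractivity gives <T h u, u> <= |u|^2, so every difference quotient has a nonpositive product
    with [u]. *)
Lemma gen_dissipative u w : gen (ip:=ip) T u w -> ip w u <= 0.
Proof.
move=> H; apply/ler_addgt0Pr => e e0; rewrite add0r.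
have n1 : 0 < nrm u + 1 by rewrite ltr_wpDl// nrm_ge0.
have [d d0 D] := H _ (divr_gt0 e0 n1).
have h0 : 0 < d / 2 by rewrite divr_gt0.
have hd : d / 2 < d by rewrite ltr_pdivrMr// ltr_pMr// ltr1n.
have := D _ h0 hd; set h := d / 2 in h0 *; rewrite (nrmBC Hip) => Dh.
have -> : ip w u = ip (w - h^-1 *: (T h u - u)) u + h^-1 * ip (T h u - u) u.
  have [_ _ Z _ _ _] := Hip.
  by rewrite (ipBl Hip w) Z subrK.
have : ip (T h u - u) u <= 0.
  have [_ _ C _ _] := TS; rewrite (ipBl Hip) subr_le0.
  apply: le_trans (ip_le Hip _ _) _; rewrite -(nrm_sqr Hip) expr2.
  by rewrite ler_wpM2r ?nrm_ge0// C// ltW.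
move=> h1; rewrite -[leRHS]addr0; apply: lerD; last first.
  by rewrite mulr_ge0_le0// invr_ge0 ltW.
apply: le_trans (ip_le Hip _ _) _; apply: le_trans (_ : e / (nrm u + 1) * nrm u <= _).
  by rewrite ler_wpM2r ?nrm_ge0// ltW.
by rewrite mulrAC ler_pdivrMr// ler_wpM2l ?(ltW e0)// lerDl.
Qed.

End generator.

(** * The space l2 *)

Lemma cauchy_seq_cvg {R : realType} (u : R ^nat) :
  (forall e : R, 0 < e -> exists N, forall m n, (N <= m)%N -> (N <= n)%N ->
     `|u m - u n| < e) -> cvgn u.
Proof.
move=> h; apply/cauchy_cvgP/cauchy_exP => e e0.
have [N NP] := h e e0; exists (u N); exists N => // n /= Nn.
by rewrite /ball/=; exact: NP.
Qed.

Lemma ler_bound_seq {R : realType} (u : R ^nat) (l M : R) : u @ \oo --> l ->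
  (exists N, forall n, (N <= n)%N -> u n <= M) -> l <= M.
Proof.
move=> ul [N NP]; rewrite -(cvg_lim _ ul)//.
by apply: limr_le; [apply: cvgP ul|exists N].
Qed.

Lemma ger_bound_seq {R : realType} (u : R ^nat) (l M : R) : u @ \oo --> l ->
  (exists N, forall n, (N <= n)%N -> M <= u n) -> M <= l.
Proof.
move=> ul [N NP]; rewrite -(cvg_lim _ ul)//.
by apply: limr_ge; [apply: cvgP ul|exists N].
Qed.

Lemma cvgn_sum {R : realType} (F : nat -> R ^nat) (l : R ^nat) p :
  (forall k, F k @ \oo --> l k) ->
  (fun n => \sum_(0 <= k < p) F k n) @ \oo --> \sum_(0 <= k < p) l k.
Proof.
move=> Fl; elim: p => [|p IH].
  by rewrite big_nil; under eq_fun do rewrite big_nil; exact: cvg_cst.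
rewrite big_nat_recr//=; under eq_fun do rewrite big_nat_recr//=.
by apply: cvgD.
Qed.

Section l2.
Context {R : realType}.
Implicit Types a b : R ^nat.

Definition sqsum a : Prop := cvgn (series (fun k => a k ^+ 2)).

Lemma series_nneg_bounded a (M : R) : (forall k, 0 <= a k) ->
  (forall n, series a n <= M) -> cvgn (series a).
Proof.
move=> a0 aM; apply: nondecreasing_is_cvgn.
  by apply: nondecreasing_series => i _ _; exact: a0.
by exists M => _ [n _ <-].
Qed.

Lemma series_nneg_le a n : (forall k, 0 <= a k) -> cvgn (series a) ->
  series a n <= limn (series a).
Proof.
move=> a0 ac; apply: nondecreasing_cvgn_le => //.
by apply: nondecreasing_series => i _ _; exact: a0.
Qed.

Lemma sqsum_mul a b : sqsum a -> sqsum b -> cvgn (series (fun k => a k * b k)).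
Proof.
move=> sa sb; apply: normed_cvg.
have sab := is_cvg_seriesD sa sb.
apply: (series_le_cvg _ _ _ sab) => [k|k|k] /=; rewrite ?addr_ge0 ?sqr_ge0//.
have := sqr_ge0 (`|a k| - `|b k|).
by rewrite normrM !fctE -(real_normK (num_real (a k))) -(real_normK (num_real (b k))); nra.
Qed.

Lemma sqsumP c a b : sqsum a -> sqsum b -> sqsum (c *: a + b).
Proof.
move=> sa sb; have sab := sqsum_mul sa sb.
rewrite /sqsum (_ : (fun k => (c *: a + b) k ^+ 2) = (c ^+ 2) *: (fun k => a k ^+ 2) +
   ((2 * c) *: (fun k => a k * b k) + (fun k => b k ^+ 2))); last first.
  apply/funext => k.
  change ((c * a k + b k) ^+ 2 = c ^+ 2 * a k ^+ 2 + ((2 * c) * (a k * b k) + b k ^+ 2)); ring.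
by apply: is_cvg_seriesD; [exact: is_cvg_seriesZ|apply: is_cvg_seriesD => //; exact: is_cvg_seriesZ].
Qed.

Lemma sqsum0 : sqsum (0 : R ^nat).
Proof.
apply: (@series_nneg_bounded _ 0) => [k|n]; first exact: sqr_ge0.
by rewrite seriesEnat /= big1// => k _; rewrite expr0n.
Qed.

(** A boolean predicate, so that the module structure of [l2] comes from the subtype mechanism and
    equality in [l2] is equality of the sequences. *)
Definition l2_pred : {pred R ^nat} := fun a => `[< sqsum a >].

Record l2 := L2seq { l2val :> nat -> R; l2valP : l2_pred l2val }.

HB.instance Definition _ := [isSub for l2val].
HB.instance Definition _ := [Choice of l2 by <:].

Lemma l2_submod_closed : submod_closed l2_pred.
Proof.
split; first by apply/asboolP; exact: sqsum0.
by move=> c a b /asboolP sa /asboolP sb; apply/asboolP; exact: sqsumP.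
Qed.

HB.instance Definition _ := GRing.isSubmodClosed.Build _ _ l2_pred l2_submod_closed.
HB.instance Definition _ := [SubChoice_isSubLmodule of l2 by <:].

Definition mkl2 a (sa : sqsum a) : l2 := L2seq (introT (asboolP _) sa).

Lemma l2_sqsum (a : l2) : sqsum a.
Proof. by apply/asboolP; exact: l2valP. Qed.

Arguments l2_sqsum : clear implicits.

Lemma l2P (a b : l2) : (forall k, a k = b k) -> a = b.
Proof. by move=> ab; apply/val_inj/funext. Qed.

Lemma l2B (a b : l2) k : (a - b) k = a k - b k. Proof. by []. Qed.
Lemma l20 k : (0 : l2) k = 0. Proof. by []. Qed.

Definition l2ip (a b : l2) : R := limn (series (fun k => a k * b k)).

Lemma l2ip_cvg (a b : l2) : series (fun k => a k * b k) @ \oo --> l2ip a b.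
Proof. exact: sqsum_mul (l2_sqsum a) (l2_sqsum b). Qed.

Arguments l2ip_cvg : clear implicits.

Lemma l2ipE (a b : l2) (l : R) : series (fun k => a k * b k) @ \oo --> l -> l2ip a b = l.
Proof. exact: cvg_lim. Qed.

Lemma l2ip_sum_le (a : l2) n : \sum_(0 <= k < n) a k ^+ 2 <= l2ip a a.
Proof.
rewrite (eq_bigr (fun k => a k * a k)) => [|k _]; last exact: expr2.
have := @series_nneg_le (fun k => a k * a k) n; rewrite seriesEnat /=.
by apply=> [k|]; [rewrite -expr2 sqr_ge0|exact: sqsum_mul (l2_sqsum a) (l2_sqsum a)].
Qed.

Lemma l2ip_coord_le (a : l2) k : a k ^+ 2 <= l2ip a a.
Proof.
apply: le_trans (l2ip_sum_le a k.+1); rewrite big_nat_recr//= lerDr.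
by apply: sumr_ge0 => i _; exact: sqr_ge0.
Qed.

Lemma l2ip_bounded (a : l2) (M : R) :
  (forall n, \sum_(0 <= k < n) a k ^+ 2 <= M) -> l2ip a a <= M.
Proof.
move=> h; apply: ler_bound_seq (l2ip_cvg a a) _; exists 0%N => n _.
by rewrite seriesEnat /=; under eq_bigr do rewrite -expr2.
Qed.

Lemma l2_hilbert : hilbert l2ip.
Proof.
split.
- by move=> a b; congr (limn (series _)); apply/funext => k; rewrite mulrC.
- move=> a b c; rewrite -[RHS]lim_seriesD//; [|exact: sqsum_mul (l2_sqsum a) (l2_sqsum c)
    |exact: sqsum_mul (l2_sqsum b) (l2_sqsum c)].
  by congr (limn (series _)); apply/funext => k; exact: mulrDl.
- move=> c a b; apply: l2ipE.
  rewrite (_ : series _ = (cst c) \* series (fun k => a k * b k)); last first.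
    apply/funext => n; rewrite /= !seriesEnat /= mulr_sumr.
    by apply: eq_bigr => k _; rewrite mulrA.
  by apply: cvgM; [exact: cvg_cst|exact: l2ip_cvg].
- move=> a; apply: ger_bound_seq (l2ip_cvg a a) _; exists 0%N => n _.
  by rewrite seriesEnat /= sumr_ge0// => k _; rewrite -expr2 sqr_ge0.
- move=> a a0; apply: l2P => k; apply/eqP; rewrite -sqrf_eq0 eq_le sqr_ge0 andbT.
  by rewrite (le_trans (l2ip_coord_le _ _))// a0.
- move=> u uC.
  have coordC k : cvgn (fun n => u n k).
    apply: cauchy_seq_cvg => e e0; have [N NP] := uC (e ^+ 2) (exprn_gt0 2 e0).
    exists N => m n Nm Nn; have := le_lt_trans (l2ip_coord_le (u m - u n) k) (NP m n Nm Nn).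
    rewrite -(real_normK (num_real _)) ltr_pXn2r// ?nnegrE//; exact: ltW.
  pose l k := limn (fun n => u n k).
  (* Completeness rests on finite sums: for fixed [p] let [m] go to infinity coordinate by
     coordinate; the bound does not depend on [p]. *)
  have tail e N : (forall m n, (N <= m)%N -> (N <= n)%N -> l2ip (u m - u n) (u m - u n) < e) ->
     forall n, (N <= n)%N -> forall p, \sum_(0 <= k < p) (u n k - l k) ^+ 2 <= e.
    move=> NP n Nn p.
    have : (fun m => \sum_(0 <= k < p) (u n k - u m k) ^+ 2) @ \oo -->
        \sum_(0 <= k < p) (u n k - l k) ^+ 2.
      apply: cvgn_sum => k; under eq_fun do rewrite expr2.
      rewrite expr2; have h : (fun m => u n k - u m k) @ \oo --> u n k - l k.
        by apply: cvgB; [exact: cvg_cst|exact: coordC].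
      exact: cvgM.
    move=> /ler_bound_seq; apply; exists N => m Nm.
    apply: le_trans (ltW (NP n m Nn Nm)); apply: le_trans (l2ip_sum_le _ p).
    by [].
  (* A single index at finite distance from [l] suffices to put [l] in l2. *)
  have [N NP] := uC 1 ltr01.
  have sN : sqsum (fun k => u N k - l k).
    apply: (@series_nneg_bounded _ 1) => [k|p]; first exact: sqr_ge0.
    by rewrite seriesEnat; exact: tail NP N (leqnn _) p.
  have sl : sqsum l.
    rewrite (_ : l = (-1) *: (fun k => u N k - l k) + u N); first exact: sqsumP sN (l2_sqsum _).
    by apply/funext => k; change (l k = -1 * (u N k - l k) + u N k); ring.
  exists (mkl2 sl) => e e0; have [N' N'P] := uC (e / 2) (divr_gt0 e0 (ltr0Sn _ _)).
  exists N' => n N'n; apply: (@le_lt_trans _ _ (e / 2)); last by lra.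
  by apply: l2ip_bounded => p; exact: tail N'P n N'n p.
Qed.

Lemma l2_tail0 (a : l2) (e : R) : 0 < e -> exists N, forall n, (N <= n)%N ->
  l2ip a a - \sum_(0 <= k < n) a k ^+ 2 < e.
Proof.
move=> e0; have /cvgrPdist_lt /(_ e e0)[N _ NP] := l2ip_cvg a a.
exists N => n /NP /=; rewrite seriesEnat /= => h; apply: le_lt_trans h.
by rewrite (le_trans (ler_norm _))//; under eq_bigr do rewrite expr2.
Qed.

Section multiplier.
Context (m : R ^nat) (m1 : forall k, `|m k| <= 1).

Lemma sqsum_multiplier a : sqsum a -> sqsum (fun k => m k * a k).
Proof.
move=> sa; apply: (series_le_cvg _ _ _ sa) => k; rewrite ?sqr_ge0//.
rewrite exprMn ler_piMl ?sqr_ge0// -(real_normK (num_real _)).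
by rewrite expr_le1.
Qed.

Definition multiplier (a : l2) : l2 := mkl2 (sqsum_multiplier (l2_sqsum a)).

Lemma multiplier_linear : linear multiplier.
Proof.
move=> c a b; apply: l2P => k.
change (m k * (c * a k + b k) = c * (m k * a k) + m k * b k); ring.
Qed.

HB.instance Definition _ :=
  GRing.isLinear.Build R l2 l2 _ multiplier multiplier_linear.

Lemma multiplier_sym (a b : l2) : l2ip (multiplier a) b = l2ip a (multiplier b).
Proof. by congr (limn (series _)); apply/funext => k /=; rewrite mulrCA mulrA. Qed.

Lemma multiplier_le (a : l2) : nrm (ip:=l2ip) (multiplier a) <= nrm (ip:=l2ip) a.
Proof.
apply: ler_wsqrtr; apply: l2ip_bounded => n; apply: le_trans (l2ip_sum_le _ n).
apply: ler_sum => k _ /=.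
rewrite exprMn ler_piMl ?sqr_ge0// -(real_normK (num_real _)).
by rewrite expr_le1.
Qed.

End multiplier.
End l2.
Arguments l2 : clear implicits.
Arguments l2_sqsum {R} a.
Arguments l2ip_cvg {R} a b.

(** * Functions of class C^k on R^d *)

Section Derive.
Context {R : realType}.

Lemma is_derive_line {V W : normedModType R} (f : V -> W) z v t :
  derivable f (t *: v + z) v ->
  is_derive t 1 (fun s : R => f (s *: v + z)) ('D_v f (t *: v + z)).
Proof.
have E : (fun h : R => h^-1 *: (((fun s : R => f (s *: v + z)) \o shift t) (h *: (1 : R^o)) -
      f (t *: v + z))) =
   (fun h => h^-1 *: ((f \o shift (t *: v + z)) (h *: v) - f (t *: v + z))).
  apply/funext => h; congr (_ *: (f _ - _)).
  by rewrite /= scalerDl -addrA [h%:A]mulr1.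
by move=> df; apply: DeriveDef; rewrite /derivable /derive E.
Qed.

Lemma MVT_line {V : normedModType R} (f : V -> R) z v (t : R) :
  (forall s : R, `|s| <= `|t| -> derivable f (s *: v + z) v) ->
  exists2 s, `|s| <= `|t| & f (t *: v + z) - f z = t * 'D_v f (s *: v + z).
Proof.
move=> df.
have D (s : R) : `|s| <= `|t| -> is_derive s (1 : R) (fun s : R => f (s *: v + z)) ('D_v f (s *: v + z)).
  by move=> st; apply: is_derive_line; exact: df.
have [t0|t0] := leP 0 t.
  have [||s] := @MVT_segment R (fun s => f (s *: v + z)) (fun s => 'D_v f (s *: v + z)) 0 t t0.
  - move=> s; rewrite in_itv/= => /andP[s0 st]; apply: D.
    by rewrite ger0_norm ?ltW// ger0_norm// ltW.
  - apply: derivable_within_continuous => s; rewrite in_itv/= => /andP[s0 st].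
    by have [] := D s; rewrite ?ger0_norm.
  - rewrite in_itv/= => /andP[s0 st]; rewrite scale0r add0r subr0 mulrC => E.
    by exists s; rewrite ?ger0_norm.
have [||s] := @MVT_segment R (fun s => f (s *: v + z)) (fun s => 'D_v f (s *: v + z)) t 0 (ltW t0).
- move=> s; rewrite in_itv/= => /andP[s0 st]; apply: D.
  by rewrite ltr0_norm// ltr0_norm// lerN2 ltW.
- apply: derivable_within_continuous => s; rewrite in_itv/= => /andP[s0 st].
  by have [] := D s; rewrite ?ler0_norm ?lerN2// ltW.
- rewrite in_itv/= => /andP[s0 st]; rewrite scale0r add0r sub0r mulrN => E.
  exists s; first by rewrite !ler0_norm ?lerN2// ltW.
  by apply/eqP; rewrite -eqr_opp opprB E mulrC.
Qed.

Lemma is_derive_sumr {V : normedModType R} (I : Type) (r : seq I) (F : I -> V -> R)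
    (dF : I -> R) y v :
  (forall i, is_derive y v (F i) (dF i)) ->
  is_derive y v (fun z => \sum_(i <- r) F i z) (\sum_(i <- r) dF i).
Proof.
move=> h; elim: r => [|i r IH].
  rewrite big_nil (_ : (fun z => _) = cst 0); first exact: is_derive_cst.
  by apply/funext => z; rewrite big_nil.
rewrite big_cons (_ : (fun z => _) = F i + (fun z => \sum_(i <- r) F i z)).
  exact: is_deriveD.
by apply/funext => z; rewrite big_cons.
Qed.

Lemma is_derive_prodr {V : normedModType R} n (F : 'I_n -> V -> R) (dF : 'I_n -> R) y v :
  (forall i, is_derive y v (F i) (dF i)) ->
  is_derive y v (fun z => \prod_(i < n) F i z)
    (\sum_(i < n) \prod_(j < n) if j == i then dF j else F j y).
Proof.
elim: n F dF => [|n IH] F dF h.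
  rewrite big_ord0 (_ : (fun z => _) = cst 1); first exact: is_derive_cst.
  by apply/funext => z; rewrite big_ord0.
have h0 := h ord0; have hS := IH (fun i => F (lift ord0 i)) (fun i => dF (lift ord0 i)) (fun i => h _).
have -> : (fun z => \prod_(i < n.+1) F i z) = F ord0 * (fun z => \prod_(i < n) F (lift ord0 i) z).
  by apply/funext => z; rewrite big_ord_recl.
apply: (is_derive_eq (is_deriveM h0 hS)).
rewrite [RHS]big_ord_recl big_ord_recl eqxx addrC; congr (_ + _).
  by rewrite [RHS]mulrC; congr (_ * _); apply: eq_bigr.
rewrite -[LHS]/(_ * _) mulr_sumr; apply: eq_bigr => i _.
by rewrite big_ord_recl /=; congr (_ * _); apply: eq_bigr.
Qed.

(** Jacobi's formula: the product rule in the Leibniz expansion differentiates one row at a time,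
    and expanding along the differentiated row produces the cofactors. *)
Lemma is_derive_det {V : normedModType R} n (A : V -> 'M[R]_n) (dA : 'M[R]_n) y v :
  (forall i j, is_derive y v (fun z => A z i j) (dA i j)) ->
  is_derive y v (fun z => \det (A z)) (\sum_i \sum_j dA i j * cofactor (A y) i j).
Proof.
move=> h.
pose Ai i := \matrix_(k, j) (if k == i then dA k j else A y k j).
have E i : \det (Ai i) = \sum_j dA i j * cofactor (A y) i j.
  rewrite (expand_det_row _ i); apply: eq_bigr => j _.
  rewrite mxE eqxx; congr (_ * (_ * \det _)); apply/matrixP => k l.
  by rewrite !mxE eq_sym (negPf (neq_lift _ _)).
under eq_bigr do rewrite -E.
have H : forall s : 'S_n, is_derive y v (fun z => (-1) ^+ s * \prod_i A z i (s i))
    ((-1) ^+ s * \sum_i \prod_j if j == i then dA j (s j) else A y j (s j)).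
  move=> s; have := is_derive_prodr (fun i => h i (s i)) => H.
  exact: is_deriveZ.
have := is_derive_sumr (index_enum _) H.
rewrite (_ : \sum_(i <- _) _ = \sum_i \det (Ai i))//.
rewrite /determinant exchange_big/=; apply: eq_bigr => s _; rewrite mulr_sumr.
by apply: eq_bigr => i _; congr (_ * _); apply: eq_bigr => j _; rewrite mxE.
Qed.

Lemma continuous_sumr {T : topologicalType} (I : Type) (r : seq I) (F : I -> T -> R) (x : T) :
  (forall i, {for x, continuous (F i)}) ->
  {for x, continuous (fun z => \sum_(i <- r) F i z)}.
Proof.
move=> h; elim: r => [|i r IH].
  rewrite (_ : (fun z => _) = cst 0); first exact: cst_continuous.
  by apply/funext => z; rewrite big_nil.
rewrite (_ : (fun z => _) = (fun z => F i z + (\sum_(i <- r) F i z))).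
  by apply: continuousD; [exact: h|exact: IH].
by apply/funext => z; rewrite big_cons.
Qed.

End Derive.

(** * Differentiability from continuous partial derivatives, and symmetry of second derivatives *)

Section C1.
Context {R : realType} {d : nat}.
Implicit Types (f g : 'rV[R]_d -> R) (y z h : 'rV[R]_d) (a b : 'I_d).

Lemma rV_norm_le h (e : R) : 0 <= e -> (forall a, `|h 0 a| <= e) -> `|h| <= e.
Proof.
move=> e0 H; rewrite /Num.norm/= mx_normrE; apply: bigmax_le => //= -[i j] _ /=.
by rewrite ord1.
Qed.

Lemma coord_norm_le h a : `|h 0 a| <= `|h|.
Proof. by rewrite [leRHS]/Num.norm/= mx_normrE; apply/bigmax_geP; right => /=; exists (0, a). Qed.

Definition lincomb (c : 'I_d -> R) h : R := \sum_a h 0 a * c a.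

Lemma lincomb_linear c : linear (lincomb c).
Proof.
move=> k u v; rewrite /lincomb scaler_sumr -big_split; apply: eq_bigr => a _ /=.
by rewrite !mxE mulrDl -mulrA.
Qed.

HB.instance Definition _ c :=
  GRing.isLinear.Build R 'rV[R]_d R _ (lincomb c) (lincomb_linear c).

Lemma lincomb_continuous c : continuous (lincomb c).
Proof.
move=> h; apply: continuous_sumr => a; apply: continuousM; last exact: cst_continuous.
exact: coord_continuous.
Qed.

Definition trunc h (k : nat) : 'rV[R]_d := \row_a (if (a < k)%N then h 0 a else 0).

Lemma truncS h a : trunc h a.+1 = h 0 a *: delta_mx 0 a + trunc h a.
Proof.
apply/rowP => b; rewrite !mxE eqxx/= ltnS leq_eqVlt.
have [->|ba] := eqVneq b a; first by rewrite eqxx/= ltnn mulr1 addr0.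
by rewrite mulr0 add0r (_ : (b == a :> nat) = false)//; apply/negbTE.
Qed.

(** The truncations [trunc h k] lead from 0 to [h] one coordinate at a time; on each leg the mean
    value theorem produces a partial derivative at a point no farther from [y] than [h + y], where
    it is close to its value at [y]. *)
Lemma C1_differentiable f y :
  (exists2 r : R, 0 < r & forall z, `|z - y| < r -> forall a, derivable f z (delta_mx 0 a)) ->
  (forall a, {for y, continuous (partial a f)}) ->
  differentiable f y /\ 'd f y = lincomb (fun a => partial a f y) :> (_ -> _).
Proof.
move=> [r r0 df] cf.
suff E : f \o shift y = cst (f y) + lincomb (fun a => partial a f y) +o_ (0 : 'rV[R]_d) id.
  have D := diff_unique (@lincomb_continuous _) E; split => //.
  by apply/diff_locallyP; rewrite D; split => //; exact: lincomb_continuous.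
apply/eqaddoP => _/posnumP[e].
(* One error per leg; [d.+1] instead of [d] since [d] may be 0. *)
pose e' := e%:num / d.+1%:R.
have e'0 : 0 < e' by rewrite divr_gt0.
have : \forall z \near y, forall a, `|partial a f y - partial a f z| < e'.
  have H a : \forall z \near y, `|partial a f y - partial a f z| < e'.
    by have /cvgrPdist_lt/(_ _ e'0) := cf a.
  exact: filter_forall H.
move=> /nbhs_ballP[r1 /= r10 r1P].
have n0 : \forall h \near nbhs (0 : 'rV[R]_d), `|h| < Num.min r r1.
  apply/nbhs_ballP; exists (Num.min r r1); first by rewrite /= lt_min r0.
  by move=> h; rewrite -ball_normE/= sub0r normrN.
suff H (h : 'rV[R]_d) : `|h| < Num.min r r1 ->
    `|f (h + y) - (f y + lincomb (fun a => partial a f y) h)| <= e%:num * `|h|.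
  by apply: filterS n0 => h; exact: H.
rewrite lt_min => /andP[hr hr1].
have hh k a (s : R) : `|s| <= `|h 0 a| -> (k <= a)%N -> `|s *: delta_mx 0 a + trunc h k| <= `|h|.
  move=> sh ka; apply: rV_norm_le => // b; rewrite !mxE eqxx/=.
  have [->|ba] := eqVneq b a.
    by rewrite ltnNge ka/= mulr1 addr0 (le_trans sh)// coord_norm_le.
  by rewrite mulr0 add0r; case: ifP => _; rewrite ?normr0// coord_norm_le.
have step a : `|f (trunc h a.+1 + y) - f (trunc h a + y) - h 0 a * partial a f y| <= e' * `|h|.
  have [s sh] : exists2 s, `|s| <= `|h 0 a| & f (h 0 a *: delta_mx 0 a + (trunc h a + y)) -
      f (trunc h a + y) = h 0 a * 'D_(delta_mx 0 a) f (s *: delta_mx 0 a + (trunc h a + y)).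
    apply: MVT_line => s sh; apply: df; rewrite addrA addrK (le_lt_trans _ hr)//.
    exact: hh.
  have -> : trunc h a.+1 + y = h 0 a *: delta_mx 0 a + (trunc h a + y) by rewrite truncS addrA.
  move=> ->; rewrite -mulrBr normrM mulrC.
  rewrite ler_pM// ?coord_norm_le// distrC ltW// r1P// -ball_normE/=.
  by rewrite distrC addrA addrK (le_lt_trans _ hr1)// hh.
have t0 : trunc h 0 = 0 by apply/rowP => a; rewrite !mxE.
have td : trunc h d = h by apply/rowP => a; rewrite !mxE ltn_ord.
have -> : f (h + y) - (f y + lincomb (fun a => partial a f y) h) =
    \sum_(a < d) (f (trunc h a.+1 + y) - f (trunc h a + y) - h 0 a * partial a f y).
  rewrite sumrB -(big_mkord predT (fun k => f (trunc h k.+1 + y) - f (trunc h k + y))).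
  by rewrite telescope_sumr// td t0 add0r opprD addrA.
apply: le_trans (ler_norm_sum _ _ _) _; apply: le_trans (ler_sum _ (fun a _ => step a)) _.
rewrite sumr_const card_ord -mulr_natr mulrAC ler_wpM2r// /e' mulrAC.
by rewrite ler_pdivrMr// ler_wpM2l// ler_nat.
Qed.

Lemma derive_translate f w z v : 'D_v (fun z => f (w + z)) z = 'D_v f (w + z).
Proof.
rewrite /derive; do 2 f_equal; apply/funext => h /=.
by rewrite addrCA.
Qed.

Lemma derivable_translate f w z v : derivable f (w + z) v -> derivable (fun z => f (w + z)) z v.
Proof.
rewrite /derivable; suff -> : (fun t : R => t^-1 *: ((f \o shift (w + z)) (t *: v) - f (w + z))) =
  (fun t : R => t^-1 *: (((fun z => f (w + z)) \o shift z) (t *: v) - f (w + z))) by [].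
by apply/funext => t /=; rewrite addrCA.
Qed.

(** The mean value theorem twice: in direction [a] for the increment [ph] of [f] along [b], then in
    direction [b] for [partial a f]. *)
Lemma second_difference f a b y (t : R) :
  (forall s s' : R, `|s| <= `|t| -> `|s'| <= `|t| ->
     let z := s' *: delta_mx 0 b + (s *: delta_mx 0 a + y) in
     derivable f z (delta_mx 0 a) /\ derivable (partial a f) z (delta_mx 0 b)) ->
  exists s s', [/\ `|s| <= `|t|, `|s'| <= `|t| &
    f (t *: delta_mx 0 b + (t *: delta_mx 0 a + y)) - f (t *: delta_mx 0 a + y)
    - (f (t *: delta_mx 0 b + y) - f y)
    = t * (t * partial b (partial a f) (s' *: delta_mx 0 b + (s *: delta_mx 0 a + y)))].
Proof.
move=> H; pose ph z := f (t *: delta_mx 0 b + z) - f z.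
have t0 : `|0 : R| <= `|t| by rewrite normr0.
have Da (s : R) : `|s| <= `|t| -> is_derive (s *: delta_mx 0 a + y) (delta_mx 0 a) ph
    (partial a f (t *: delta_mx 0 b + (s *: delta_mx 0 a + y)) - partial a f (s *: delta_mx 0 a + y)).
  move=> st; have [h1 _] := H s t st (lexx _).
  have [h2 _] := H s 0 st t0; rewrite scale0r add0r in h2.
  apply: is_deriveB; last exact: derivableP.
  have := derivableP (derivable_translate h1).
  by rewrite derive_translate.
have [|s st] := @MVT_line R _ ph y (delta_mx 0 a) t.
  by move=> s st; have [] := Da s st.
rewrite /ph (@derive_val _ _ _ _ _ _ _ (Da s st)) => ->.
have [|s' st' ->] := @MVT_line R _ (partial a f) (s *: delta_mx 0 a + y) (delta_mx 0 b) t.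
  by move=> s' st'; have [] := H s s' st st'.
by exists s, s'.
Qed.

Lemma ler_dist_half (q p1 p2 e : R) : `|p1 - q| < e / 2 -> `|p2 - q| < e / 2 ->
  `|p1 - p2| <= e.
Proof.
move=> h1 h2; rewrite -(subrKA q) (le_trans (ler_normD _ _))// (distrC q).
by rewrite [leRHS](splitr e) lerD// ltW.
Qed.

(* Both iterated derivatives are recovered from the same second difference. *)
Lemma Schwarz f a b y :
  (\forall z \near y, [/\ derivable f z (delta_mx 0 a), derivable f z (delta_mx 0 b),
     derivable (partial a f) z (delta_mx 0 b) & derivable (partial b f) z (delta_mx 0 a)]) ->
  {for y, continuous (partial b (partial a f))} ->
  {for y, continuous (partial a (partial b f))} ->
  partial b (partial a f) y = partial a (partial b f) y.
Proof.
move=> nf cba cab; apply/eqP; rewrite -subr_eq0 -normr_le0; apply/ler_addgt0Pr => e e0.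
rewrite add0r; have e2 : 0 < e / 2 by rewrite divr_gt0.
pose P2 : set 'rV[R]_d := [set z | `|partial b (partial a f) y - partial b (partial a f) z| < e / 2].
pose P3 : set 'rV[R]_d := [set z | `|partial a (partial b f) y - partial a (partial b f) z| < e / 2].
have n2 : nbhs y P2 by have /cvgrPdist_lt/(_ _ e2) := cba.
have n3 : nbhs y P3 by have /cvgrPdist_lt/(_ _ e2) := cab.
pose P1 : set 'rV[R]_d := [set z | [/\ derivable f z (delta_mx 0 a), derivable f z (delta_mx 0 b),
     derivable (partial a f) z (delta_mx 0 b) & derivable (partial b f) z (delta_mx 0 a)]].
have : nbhs y (P1 `&` (P2 `&` P3)) by apply: filterI; [exact: nf|apply: filterI].
move=> /nbhs_ballP[r /= r0 rP].
(* Two displacements of length at most [t] then stay well inside the ball of radius [r]. *)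
pose t := r / 4; have t0 : 0 < t by rewrite divr_gt0.
have near_pt (s s' : R) c c' : `|s| <= `|t| -> `|s'| <= `|t| ->
    ball y r (s' *: delta_mx 0 c' + (s *: delta_mx 0 c + y)).
  move=> st st'; rewrite -ball_normE/= distrC addrA addrK.
  have dn k : `|delta_mx 0 k : 'rV[R]_d| <= 1.
    apply: (@rV_norm_le (delta_mx 0 k) 1 ler01) => l; rewrite mxE eqxx /=.
    by case: (l == k); rewrite ?normr1 ?normr0.
  apply: (@le_lt_trans _ _ (t + t)); last by rewrite /t; lra.
  rewrite (le_trans (ler_normD _ _))// !normrZ lerD//.
    by rewrite -[leRHS]mulr1 ler_pM// (le_trans st')// gtr0_norm.
  by rewrite -[leRHS]mulr1 ler_pM// (le_trans st)// gtr0_norm.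
have [|s [s' [st st' E]]] := @second_difference f a b y t.
  by move=> s s' st st' /=; have [[]] := rP _ (near_pt s s' a b st st').
have [|u [u' [ut ut' E']]] := @second_difference f b a y t.
  by move=> u u' ut ut' /=; have [[]] := rP _ (near_pt u u' b a ut ut').
have : t * (t * partial b (partial a f) (s' *: delta_mx 0 b + (s *: delta_mx 0 a + y)))
   = t * (t * partial a (partial b f) (u' *: delta_mx 0 a + (u *: delta_mx 0 b + y))).
  apply: (eq_trans (esym E)); apply: (eq_trans _ E').
  rewrite [t *: delta_mx 0 b + (_ + _)]addrCA.
  move: (f (_ + (_ + _))) (f (t *: delta_mx 0 a + y)) (f (t *: delta_mx 0 b + y)) (f y).
  by move=> f1 f2 f3 f4; ring.
move=> /(mulfI (lt0r_neq0 t0))/(mulfI (lt0r_neq0 t0)) EE.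
have [_ [h1 _]] := rP _ (near_pt s s' a b st st').
have [_ [_ h2]] := rP _ (near_pt u u' b a ut ut').
move: h1 h2; rewrite /P2 /P3 /= EE.
move: (partial a (partial b f) (_ + _)) => q.
move: (partial b (partial a f) y) (partial a (partial b f) y) => p1 p2 h1 h2.
exact: ler_dist_half h1 h2.
Qed.

End C1.

Lemma open_near {T : topologicalType} (W : set T) x : open W -> W x -> \forall z \near x, W z.
Proof. by move=> Wo Wx; exact: open_nbhs_nbhs. Qed.

(** * Stability of class C^k under algebraic operations *)

Section Ck.
Context {R : realType} {d : nat}.
Implicit Types (f g : 'rV[R]_d -> R) (y : 'rV[R]_d) (a b : 'I_d) (k : nat).

Lemma Ck_continuous k (W : set 'rV[R]_d) f y : Ck k W f -> W y -> {for y, continuous f}.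
Proof. by case: k => [|k] [h _] /h. Qed.

Lemma Ck_derivable k (W : set 'rV[R]_d) f y a : Ck k.+1 W f -> W y ->
  derivable f y (delta_mx 0 a).
Proof. by move=> [_ /(_ a)[h _]] /h. Qed.

Lemma Ck_partial k (W : set 'rV[R]_d) f a : Ck k.+1 W f -> Ck k W (partial a f).
Proof. by move=> [_ /(_ a)[]]. Qed.

Lemma CkW k (W : set 'rV[R]_d) f : Ck k.+1 W f -> Ck k W f.
Proof.
elim: k f => [|k IH] f [fc fd]; first by split.
by split => // a; have [fa fk] := fd a; split => //; exact: IH.
Qed.

Lemma Ck_sub k (W W' : set 'rV[R]_d) f : W' `<=` W -> Ck k W f -> Ck k W' f.
Proof.
move=> WW; elim: k f => [|k IH] f [fc fd]; first by split => // y /WW /fc.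
split=> [y /WW /fc//|a]; have [fa fk] := fd a; split; last exact: IH.
by move=> y /WW /fa.
Qed.

Context {W : set 'rV[R]_d} (Wo : open W).

(** A derivative sees a whole neighbourhood of the point: openness of [W] is what allows identities
    valid on [W] alone to be differentiated. *)
Lemma partial_ext f g y a : (forall z, W z -> f z = g z) -> W y ->
  partial a f y = partial a g y.
Proof.
move=> fg Wy; apply: near_eq_derive; apply: filterS (open_near Wo Wy) => z; exact: fg.
Qed.

Lemma derivable_ext f g y v : (forall z, W z -> f z = g z) -> W y ->
  derivable f y v -> derivable g y v.
Proof.
move=> fg Wy; apply: near_eq_derivable; apply: filterS (open_near Wo Wy) => z; exact: fg.
Qed.

Lemma continuous_ext f g y : (forall z, W z -> f z = g z) -> W y ->
  {for y, continuous f} -> {for y, continuous g}.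
Proof.
move=> fg Wy; rewrite /prop_for /continuous_at -(fg _ Wy) => fc; apply: cvg_trans fc.
have E : {near y, f =1 g}.
  by have := open_near Wo Wy; apply: filterS => z; exact: fg.
exact: (@near_eq_cvg _ _ (nbhs y) (nbhs_filter y) _ _ E).
Qed.

Lemma Ck_ext k f g : (forall z, W z -> f z = g z) -> Ck k W f -> Ck k W g.
Proof.
elim: k f g => [|k IH] f g fg [fc fd].
  by split=> // y Wy; exact: continuous_ext (fg) Wy (fc y Wy).
split=> [y Wy|a]; first exact: continuous_ext (fg) Wy (fc y Wy).
have [fa fk] := fd a; split=> [y Wy|].
  exact: derivable_ext (fg) Wy (fa y Wy).
by apply: IH fk => z Wz; exact: partial_ext.
Qed.

Lemma Ck_cst k (c : R) : Ck k W (fun=> c).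
Proof.
elim: k c => [|k IH] c; first by split=> // y _; exact: cst_continuous.
split=> [y _|a]; first exact: cst_continuous.
split=> [y _|]; first exact: derivable_cst.
apply: Ck_ext (IH 0) => z _; rewrite /partial.
by rewrite -[RHS]/('D_(delta_mx 0 a) (cst c) z) derive_cst.
Qed.

Lemma CkD k f g : Ck k W f -> Ck k W g -> Ck k W (fun z => f z + g z).
Proof.
elim: k f g => [|k IH] f g Cf Cg.
  by split=> // y Wy; apply: continuousD; [exact: Ck_continuous Cf Wy|exact: Ck_continuous Cg Wy].
split=> [y Wy|a].
  by apply: continuousD; [exact: Ck_continuous Cf Wy|exact: Ck_continuous Cg Wy].
have df y (Wy : W y) := Ck_derivable (a := a) Cf Wy; have dg y (Wy : W y) := Ck_derivable (a := a) Cg Wy.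
split=> [y Wy|]; first exact: derivableD (df y Wy) (dg y Wy).
apply: Ck_ext (IH _ _ (Ck_partial a Cf) (Ck_partial a Cg)) => z Wz.
by rewrite /partial -deriveD//; [exact: df|exact: dg].
Qed.

Lemma CkM k f g : Ck k W f -> Ck k W g -> Ck k W (fun z => f z * g z).
Proof.
elim: k f g => [|k IH] f g Cf Cg.
  by split=> // y Wy; apply: continuousM; [exact: Ck_continuous Cf Wy|exact: Ck_continuous Cg Wy].
split=> [y Wy|a].
  by apply: continuousM; [exact: Ck_continuous Cf Wy|exact: Ck_continuous Cg Wy].
have df y (Wy : W y) := Ck_derivable (a := a) Cf Wy; have dg y (Wy : W y) := Ck_derivable (a := a) Cg Wy.
split=> [y Wy|]; first exact: derivableM (df y Wy) (dg y Wy).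
apply: Ck_ext (CkD (IH _ _ (CkW Cf) (Ck_partial a Cg)) (IH _ _ (CkW Cg) (Ck_partial a Cf))) => z Wz.
by rewrite /partial -[in RHS]/('D_(delta_mx 0 a) (f * g) z) deriveM//; [exact: df|exact: dg].
Qed.

Lemma CkZ k (c : R) f : Ck k W f -> Ck k W (fun z => c * f z).
Proof. by move=> Cf; apply: CkM => //; exact: Ck_cst. Qed.

Lemma CkB k f g : Ck k W f -> Ck k W g -> Ck k W (fun z => f z - g z).
Proof.
move=> Cf Cg; apply: Ck_ext (CkD Cf (CkZ (-1) Cg)) => z _.
by rewrite mulN1r.
Qed.

Lemma CkV k f : (forall y, W y -> f y != 0) -> Ck k W f -> Ck k W (fun z => (f z)^-1).
Proof.
move=> f0; elim: k => [|k IH] Cf.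
  by split=> // y Wy; apply: continuousV; [exact: f0|exact: Ck_continuous Cf Wy].
split=> [y Wy|a].
  by apply: continuousV; [exact: f0|exact: Ck_continuous Cf Wy].
have df y (Wy : W y) := Ck_derivable (a := a) Cf Wy; have Iv := IH (CkW Cf).
split=> [y Wy|]; first exact: derivableV (f0 _ Wy) (df y Wy).
apply: Ck_ext (CkM (CkZ (-1) (CkM Iv Iv)) (Ck_partial a Cf)) => z Wz.
rewrite /partial deriveV ?f0//; last exact: df.
by rewrite mulN1r -invfM -expr2.
Qed.

Lemma Ck_sum k (I : Type) (r : seq I) (F : I -> 'rV[R]_d -> R) :
  (forall i, Ck k W (F i)) -> Ck k W (fun z => \sum_(i <- r) F i z).
Proof.
move=> h; elim: r => [|i r IH].
  by apply: Ck_ext (Ck_cst k 0) => z _; rewrite big_nil.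
by apply: Ck_ext (CkD (h i) IH) => z _; rewrite big_cons.
Qed.

Lemma Ck_prod k (I : Type) (r : seq I) (F : I -> 'rV[R]_d -> R) :
  (forall i, Ck k W (F i)) -> Ck k W (fun z => \prod_(i <- r) F i z).
Proof.
move=> h; elim: r => [|i r IH].
  by apply: Ck_ext (Ck_cst k 1) => z _; rewrite big_nil.
by apply: Ck_ext (CkM (h i) IH) => z _; rewrite big_cons.
Qed.

Lemma Ck_det k n (A : 'rV[R]_d -> 'M[R]_n) :
  (forall i j, Ck k W (fun z => A z i j)) -> Ck k W (fun z => \det (A z)).
Proof.
by move=> h; apply: Ck_sum => s; apply: CkZ; apply: Ck_prod => i; exact: h.
Qed.

Lemma Ck_invmx k n (A : 'rV[R]_d -> 'M[R]_n) :
  (forall y, W y -> \det (A y) != 0) ->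
  (forall i j, Ck k W (fun z => A z i j)) ->
  forall i j, Ck k W (fun z => invmx (A z) i j).
Proof.
move=> A0 h i j.
apply: (@Ck_ext _ (fun z => (\det (A z))^-1 * ((-1) ^+ (j + i) * \det (row' j (col' i (A z)))))).
  by move=> z Wz; rewrite /invmx unitmxE unitfE A0// !mxE.
apply: CkM; first by apply: CkV => //; exact: Ck_det.
apply: CkZ; apply: Ck_det => i' j'.
by apply: Ck_ext (h (lift j i') (lift i j')) => z _; rewrite !mxE.
Qed.

Lemma Ck1_differentiable f y : Ck 1 W f -> W y ->
  differentiable f y /\ 'd f y = lincomb (fun a => partial a f y) :> (_ -> _).
Proof.
move=> Cf Wy; apply: C1_differentiable.
  have /nbhs_ballP[r /= r0 rP] := open_near Wo Wy.
  exists r => // z zy a; apply: Ck_derivable Cf _; apply: rP.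
  by rewrite -ball_normE/= distrC.
by move=> a; apply: (Ck_continuous (k := 0)) Wy; exact: Ck_partial.
Qed.

Lemma Schwarz_Ck f a b y : Ck 2 W f -> W y ->
  partial b (partial a f) y = partial a (partial b f) y.
Proof.
move=> Cf Wy; have Ca := Ck_partial a Cf; have Cb := Ck_partial b Cf.
apply: Schwarz.
- apply: filterS (open_near Wo Wy) => z Wz.
  split; [exact: Ck_derivable Cf Wz|exact: Ck_derivable Cf Wz|exact: Ck_derivable Ca Wz|
    exact: Ck_derivable Cb Wz].
- by apply: (Ck_continuous (k := 0)) Wy; exact: Ck_partial.
- by apply: (Ck_continuous (k := 0)) Wy; exact: Ck_partial.
Qed.

End Ck.

Lemma differentiable_rV {R : realType} {V : normedModType R} d (tau : V -> 'rV[R]_d) y :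
  (forall c, differentiable (fun z => tau z 0 c) y) -> differentiable tau y.
Proof.
move=> h.
have -> : tau = \sum_(c < d) (fun z => tau z 0 c *: delta_mx 0 c).
  by apply/funext => z; rewrite fct_sumE {1}(row_sum_delta (tau z)).
by apply: differentiable_sum => c; apply: differentiableZl.
Qed.

(** Partial derivatives alone do not compose, so class C^1 is first turned into Fréchet
    differentiability of both maps. *)
Lemma partial_comp {R : realType} m d (V : set 'rV[R]_m) (W : set 'rV[R]_d)
    (tau : 'rV[R]_m -> 'rV[R]_d) (f : 'rV[R]_d -> R) y a : open V -> open W -> V y ->
  (forall c, Ck 1 V (fun z => tau z 0 c)) -> Ck 1 W f -> W (tau y) ->
  derivable (fun z => f (tau z)) y (delta_mx 0 a) /\
  partial a (fun z => f (tau z)) y =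
    \sum_c partial a (fun z => tau z 0 c) y * partial c f (tau y).
Proof.
move=> Vo Wo Vy Ct Cf Wt.
have [df dfE] := Ck1_differentiable Wo Cf Wt.
have dt : differentiable tau y.
  by apply: differentiable_rV => c; have [] := Ck1_differentiable Vo (Ct c) Vy.
have dft : differentiable (f \o tau) y by exact: differentiable_comp.
split; first exact: diff_derivable dft.
rewrite /partial -[LHS]/('D_(delta_mx 0 a) (f \o tau) y) deriveE// diff_comp//= dfE.
rewrite /lincomb; apply: eq_bigr => c _; congr (_ * _).
rewrite -deriveE// derive_mx ?mxE//.
exact: diff_derivable.
Qed.

(** * The generator on smooth functions *)

Section divergence.
Context {R : realType} {d : nat}.
Implicit Types (y : 'rV[R]_d) (a b c e : 'I_d).

Lemma is_derive_partial k (W : set 'rV[R]_d) (f : 'rV[R]_d -> R) y a : Ck k.+1 W f -> W y ->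
  is_derive y (delta_mx 0 a) f (partial a f y).
Proof. by move=> Cf Wy; apply: derivableP; exact: Ck_derivable Cf Wy. Qed.

Lemma partial_is_derive (f : 'rV[R]_d -> R) y a (l : R) :
  is_derive y (delta_mx 0 a) f l -> partial a f y = l.
Proof. by move=> h; exact: derive_val. Qed.

(* Divergence for the density [sqrt delta], with the square root cleared. *)
Definition divcoord (delta : 'rV[R]_d -> R) (X : 'I_d -> 'rV[R]_d -> R) y : R :=
  \sum_a (partial a (X a) y + X a y * (partial a delta y / (2 * delta y))).

(** For s with s^2 = delta, the logarithmic derivative of s is partial delta / (2 delta), where the
    square root has disappeared. *)
Lemma divcoordE (W : set 'rV[R]_d) delta X y : open W -> W y ->
  Ck 1 W delta -> (forall z, W z -> 0 < delta z) -> (forall a, Ck 1 W (X a)) ->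
  (Num.sqrt (delta y))^-1 * \sum_a partial a (fun z => Num.sqrt (delta z) * X a z) y =
  divcoord delta X y.
Proof.
move=> Wo Wy Cd d0 CX; pose s z := Num.sqrt (delta z).
have s0 : 0 < s y by rewrite sqrtr_gt0 d0.
have ds : differentiable s y.
  apply: (@differentiable_comp _ _ _ _ delta (@Num.sqrt R)).
    by have [] := Ck1_differentiable Wo Cd Wy.
  apply/derivable1_diffP; have h := is_derive1_sqrt (d0 _ Wy).
  exact: ex_derive.
have Ds a : is_derive y (delta_mx 0 a) s (partial a s y).
  by apply: derivableP; exact: diff_derivable.
have dE a : partial a delta y = 2 * s y * partial a s y.
  have := partial_is_derive (is_deriveM (Ds a) (Ds a)); rewrite /GRing.scale/=.
  have ss z : W z -> s z * s z = delta z by move=> Wz; rewrite -expr2 sqr_sqrtr// ltW// d0.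
  move=> /(eq_trans (esym (partial_ext Wo a ss Wy))) ->; ring.
have sE : delta y = s y ^+ 2 by rewrite sqr_sqrtr// ltW// d0.
rewrite mulr_sumr; apply: eq_bigr => a _.
rewrite (partial_is_derive (is_deriveM (Ds a) (is_derive_partial a (CX a) Wy))).
rewrite /GRing.scale/= -/(s y) dE sE; field.
by rewrite gt_eqF.
Qed.

Lemma cofactor_trace n (J N : 'M[R]_n) : \det J != 0 ->
  \sum_i \sum_j N i j * cofactor J i j = \det J * \tr (invmx J *m N).
Proof.
move=> J0; rewrite mxtrace_mulC /mxtrace mulr_sumr; apply: eq_bigr => i _.
rewrite mxE mulr_sumr; apply: eq_bigr => j _.
by rewrite /invmx unitmxE unitfE J0 !mxE; field.
Qed.

(* Coordinate invariance of the divergence: [tau] is a change of coordinates,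
   [X'] and [delta'] are the transported field and density. *)
Lemma divcoord_invariant (W W' : set 'rV[R]_d) (tau : 'rV[R]_d -> 'rV[R]_d)
    (delta delta' : 'rV[R]_d -> R) (X X' : 'I_d -> 'rV[R]_d -> R) y :
  open W -> open W' -> (forall z, W z -> W' (tau z)) -> W y ->
  (forall c, Ck 2 W (fun z => tau z 0 c)) ->
  (forall z, W z -> \det (jac tau z) != 0) ->
  Ck 1 W delta -> Ck 1 W' delta' ->
  (forall z, W' z -> delta' z != 0) ->
  (forall z, W z -> delta z = \det (jac tau z) ^+ 2 * delta' (tau z)) ->
  (forall a, Ck 1 W (X a)) -> (forall a, Ck 1 W' (X' a)) ->
  (forall z c, W z -> X' c (tau z) = \sum_b X b z * jac tau z b c) ->
  divcoord delta X y = divcoord delta' X' (tau y).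
Proof.
move=> Wo Wo' WW Wy Ct J0 Cd Cd' d0' dE CX CX' XE.
have Ct1 c : Ck 1 W (fun z => tau z 0 c) by exact: CkW.
have CJ b c : Ck 1 W (fun z => jac tau z b c).
  by apply: (Ck_ext Wo _ (Ck_partial b (Ct c))) => z _; rewrite mxE.
pose J := jac tau y; pose DJ b : 'M[R]_d := \matrix_(a, c) partial b (fun z => jac tau z a c) y.
have Ju : J \in unitmx by rewrite unitmxE unitfE J0.
(* Schwarz's theorem for [tau]: derivatives of the Jacobian can be regrouped by the direction of the
   field component that multiplies them. *)
have DJsym a b c : partial a (fun z => jac tau z b c) y = DJ b a c.
  have JE b' z : jac tau z b' c = partial b' (fun z => tau z 0 c) z by rewrite mxE.
  have -> : DJ b a c = partial b (fun z => jac tau z a c) y by rewrite mxE.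
  apply: (eq_trans (partial_ext Wo a (fun z _ => JE b z) Wy)).
  apply: (eq_trans _ (esym (partial_ext Wo b (fun z _ => JE a z) Wy))).
  exact: (Schwarz_Ck Wo _ _ (Ct c) Wy).
have ddet b : partial b (fun z => \det (jac tau z)) y = \det J * \tr (invmx J *m DJ b).
  rewrite -cofactor_trace ?J0//; apply: partial_is_derive.
  have h i j : is_derive y (delta_mx 0 b) (fun z => jac tau z i j) (DJ b i j).
    by rewrite mxE; exact: is_derive_partial (CJ i j) Wy.
  exact: is_derive_det h.
(* Logarithmic derivative of delta = (det J)^2 delta'(tau): Jacobi's formula gives the trace, the
   chain rule the sum. *)
have ddelta b : partial b delta y / (2 * delta y) = \tr (invmx J *m DJ b) +
    \sum_e J b e * (partial e delta' (tau y) / (2 * delta' (tau y))).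
  have [dt dtE] := partial_comp b Wo Wo' Wy Ct1 Cd' (WW _ Wy).
  have Ddet := is_derive_partial b (Ck_det Wo CJ) Wy.
  have Dd' := derivableP dt; rewrite -/(partial b _ y) dtE in Dd'.
  have := partial_is_derive (is_deriveM (is_deriveM Ddet Ddet) Dd').
  rewrite /GRing.scale/= => E.
  have -> : partial b delta y = \det J * \det J * (\sum_e J b e * partial e delta' (tau y))
      + delta' (tau y) * (2 * \det J * (\det J * \tr (invmx J *m DJ b))).
    have dE2 z : W z -> delta z = \det (jac tau z) * \det (jac tau z) * delta' (tau z).
      by move=> Wz; rewrite dE// expr2.
    apply: (eq_trans (partial_ext Wo b dE2 Wy)); apply: (eq_trans E).
    rewrite ddet; congr (_ + _); last by rewrite -/J; ring.
    by congr (_ * _); apply: eq_bigr => e _; rewrite mxE.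
  have -> : \sum_e J b e * (partial e delta' (tau y) / (2 * delta' (tau y))) =
     (\sum_e J b e * partial e delta' (tau y)) / (2 * delta' (tau y)).
    by rewrite mulr_suml; apply: eq_bigr => e _; rewrite mulrA.
  rewrite dE// -/J; have := J0 y Wy; have := d0' _ (WW _ Wy); rewrite -/J => h1 h2.
  by field; rewrite h1 h2.
have DX a c : \sum_e J a e * partial e (X' c) (tau y) =
    \sum_b (partial a (X b) y * J b c + X b y * DJ b a c).
  have <- : partial a (fun z => X' c (tau z)) y = \sum_e J a e * partial e (X' c) (tau y).
    have [_ ->] := partial_comp a Wo Wo' Wy Ct1 (CX' c) (WW _ Wy).
    by apply: eq_bigr => e _; rewrite mxE.
  apply: (eq_trans (partial_ext Wo a (fun z => XE z c) Wy)); apply: partial_is_derive.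
  have h b : is_derive y (delta_mx 0 a) (fun z => X b z * jac tau z b c)
       (partial a (X b) y * J b c + X b y * DJ b a c).
    apply: is_derive_eq.
      exact: (is_deriveM (is_derive_partial a (CX b) Wy) (is_derive_partial a (CJ b c) Wy)).
    by rewrite /GRing.scale/= DJsym addrC [_ * partial a (X b) y]mulrC.
  exact: is_derive_sumr h.
pose DX' : 'M[R]_d := \matrix_(e, c) partial e (X' c) (tau y).
pose DXi : 'M[R]_d := \matrix_(a, b) partial a (X b) y.
(* The derivative of the transported field satisfies J DX' = DX J + sum_b X_b DJ_b; multiply by J^-1
   and take traces. The extra traces are exactly those that [ddelta] produces on the other side. *)
have trX : \sum_c partial c (X' c) (tau y) = \sum_a partial a (X a) y +
    \sum_b X b y * \tr (invmx J *m DJ b).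
  have E : J *m DX' = DXi *m J + \sum_b X b y *: DJ b.
    apply/matrixP => a c; rewrite !mxE summxE.
    transitivity (\sum_e J a e * partial e (X' c) (tau y)).
      by apply: eq_bigr => e _; rewrite !mxE.
    rewrite DX big_split/=; congr (_ + _); first by apply: eq_bigr => e _; rewrite !mxE.
    by apply: eq_bigr => e _; rewrite [in RHS]mxE.
  have -> : \sum_c partial c (X' c) (tau y) = \tr DX' by apply: eq_bigr => c _; rewrite mxE.
  have -> : \sum_a partial a (X a) y = \tr DXi by apply: eq_bigr => c _; rewrite mxE.
  rewrite -(mulKmx Ju DX') E mulmxDr mxtraceD; congr (_ + _).
    by rewrite mxtrace_mulC -mulmxA mulmxV// mulmx1.
  rewrite mulmx_sumr raddf_sum/=; apply: eq_bigr => b _.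
  by rewrite -scalemxAr mxtraceZ.
rewrite /divcoord !big_split/= trX -addrA; congr (_ + _).
have -> : \sum_c X' c (tau y) * (partial c delta' (tau y) / (2 * delta' (tau y))) =
   \sum_b X b y * (\sum_e J b e * (partial e delta' (tau y) / (2 * delta' (tau y)))).
  under eq_bigr do rewrite XE// mulr_suml.
  rewrite exchange_big/=; apply: eq_bigr => b _; rewrite mulr_sumr.
  by apply: eq_bigr => e _; rewrite -mulrA.
rewrite -big_split/=; apply: eq_bigr => b _; by rewrite ddelta mulrDr.
Qed.

(** The segment from the identity to [A] consists of positive definite matrices, so the determinant
    never vanishes on it and keeps the sign it has at the identity. *)
Lemma posdef_det_gt0 (A : 'M[R]_d) :
  (forall v : 'rV[R]_d, v != 0 -> 0 < (v *m A *m v^T) 0 0) -> 0 < \det A.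
Proof.
move=> Apos; pose B (t : R) : 'M[R]_d := (1 - t)%:M + t *: A.
have vv (v : 'rV[R]_d) : v != 0 -> 0 < (v *m v^T) 0 0.
  move=> v0; rewrite mxE lt_neqAle; apply/andP; split.
    apply/eqP => /esym/eqP; rewrite psumr_eq0; last by move=> i _; rewrite mxE -expr2 sqr_ge0.
    move=> /allP h; move/eqP : v0; apply; apply/rowP => i; rewrite mxE.
    by have := h i (mem_index_enum _); rewrite /= mxE -expr2 sqrf_eq0 => /eqP.
  by apply: sumr_ge0 => i _; rewrite mxE -expr2 sqr_ge0.
have B0 t : 0 <= t -> t <= 1 -> \det (B t) != 0.
  move=> t0 t1; apply/det0P => -[v v0 vB].
  have : 0 < (v *m B t *m v^T) 0 0.
    rewrite mulmxDr mulmxDl mul_mx_scalar -scalemxAr -!scalemxAl !mxE.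
    have h1 := vv _ v0; have h2 := Apos _ v0; rewrite [X in X < _]/0.
    have [->|tn0] := eqVneq t 0; first by rewrite subr0 mul1r mul0r addr0; move: h1; rewrite mxE.
    have tp : 0 < t by rewrite lt_neqAle eq_sym tn0.
    rewrite ltr_wpDl//; last by move: h2; rewrite mxE => h2; rewrite mulr_gt0.
    by rewrite mulr_ge0 ?subr_ge0//; move: h1; rewrite mxE => /ltW.
  by rewrite vB mul0mx mxE ltxx.
have cB : continuous (fun t => \det (B t)).
  move=> t; apply/differentiable_continuous/derivable1_diffP.
  pose c i j : R := (1%:M : 'M[R]_d) i j.
  have h i j : is_derive t (1 : R) (fun t => B t i j) ((A - 1%:M) i j).
    have -> : (fun t => B t i j) = cst (c i j) + (A i j - c i j) \*: id.
      apply/funext => u; rewrite /= !mxE /cst /=.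
      change ((1 - u) *+ (i == j) + u * A i j = c i j + (A i j - c i j) * u).
      by rewrite /c mxE; case: (i == j); rewrite /= ?mulr1n ?mulr0n; ring.
    apply: (is_derive_eq (is_deriveD (is_derive_cst (c i j) t 1)
       (is_deriveZ (A i j - c i j) (is_derive_id t (1 : R))))).
    by rewrite add0r /c !mxE /GRing.scale/= mulr1.
  have H := is_derive_det h; exact: ex_derive.
have [//|Ale0] := ltP 0 (\det A).
have [|||t tI tE] := @IVT R (fun t => \det (B t)) 0 1 0.
- by [].
- by apply: continuous_subspaceT.
- have -> : B 0 = 1%:M by rewrite /B subr0 scale0r addr0.
  have -> : B 1 = A by rewrite /B subrr scale1r raddf0 add0r.
  by rewrite det1 ge_min le_max ler01 Ale0 orbT.
move: tI; rewrite in_itv/= => /andP[t0 t1].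
by have := B0 t t0 t1; rewrite tE eqxx.
Qed.

Lemma divcoord_ext (W : set 'rV[R]_d) delta (X Y : 'I_d -> 'rV[R]_d -> R) y :
  open W -> W y -> (forall a z, W z -> X a z = Y a z) ->
  divcoord delta X y = divcoord delta Y y.
Proof.
move=> Wo Wy XY; apply: eq_bigr => a _.
by rewrite (partial_ext Wo a (XY a) Wy) XY.
Qed.

(** For X = grad h and Y = grad f, the two separate sums become the two copies of grad f . grad h in
    the Laplacian of a product. *)
Lemma divcoordM (W : set 'rV[R]_d) delta (F H : 'rV[R]_d -> R) (X Y : 'I_d -> 'rV[R]_d -> R) y :
  W y -> Ck 1 W F -> Ck 1 W H -> (forall a, Ck 1 W (X a)) -> (forall a, Ck 1 W (Y a)) ->
  divcoord delta (fun a z => F z * X a z + H z * Y a z) y =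
  F y * divcoord delta X y + H y * divcoord delta Y y +
  ((\sum_a Y a y * partial a H y) + \sum_a X a y * partial a F y).
Proof.
move=> Wy CF CH CX CY; rewrite /divcoord !mulr_sumr -!big_split/=; apply: eq_bigr => a _.
have -> : partial a (fun z => F z * X a z + H z * Y a z) y =
  (F y * partial a (X a) y + X a y * partial a F y) + (H y * partial a (Y a) y + Y a y * partial a H y).
  exact: (partial_is_derive (is_deriveD
    (is_deriveM (is_derive_partial a CF Wy) (is_derive_partial a (CX a) Wy))
    (is_deriveM (is_derive_partial a CH Wy) (is_derive_partial a (CY a) Wy)))).
move: (partial a (X a) y) (partial a (Y a) y) (partial a F y) (partial a H y) (partial a delta y / _).
move: (F y) (H y) (X a y) (Y a y) => *; ring.
Qed.

End divergence.

(** * Gradient, divergence and generator on the manifold *)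

Section manifold.
Context {R : realType} {d : nat} {M : riemannian_manifold R d}.
Implicit Types (f h : M -> R) (X Y : vfield M) (x : M) (y : 'rV[R]_d) (i j : chart_idx M).

Lemma open_chart_img i : open (chart_img i).
Proof. exact: chart_img_open. Qed.

Lemma chart_imgP i x : chart_dom i x -> chart_img i (chart i x).
Proof. by move=> ix; exists x. Qed.

Lemma param_dom i y : chart_img i y -> chart_dom i (param i y).
Proof. by move=> [x ix <-]; rewrite chartK. Qed.

Lemma paramK i y : chart_img i y -> chart i (param i y) = y.
Proof. by move=> [x ix <-]; rewrite chartK. Qed.

Definition trans i j y : 'rV[R]_d := chart j (param i y).

Definition trans_dom i j : set 'rV[R]_d := chart i @` (chart_dom i `&` chart_dom j).

Lemma trans_domP i j y : trans_dom i j y ->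
  [/\ chart_img i y, chart_dom i (param i y) & chart_dom j (param i y)].
Proof. by move=> [x [ix jx] <-]; rewrite chartK//; split => //; exact: chart_imgP. Qed.

Lemma trans_dom_open i j : open (trans_dom i j).
Proof.
rewrite openE => y [x [ix jx] <-].
have h1 : nbhs (chart i x) (chart_img i).
  by apply: open_nbhs_nbhs; split; [exact: chart_img_open|exact: chart_imgP].
have h2 : nbhs (chart i x) (param i @^-1` chart_dom j).
  apply: (param_continuous (chart_imgP ix)).
  rewrite chartK//; apply: open_nbhs_nbhs; split => //; exact: chart_dom_open.
have : nbhs (chart i x) (chart_img i `&` (param i @^-1` chart_dom j)) by exact: filterI.
apply: filterS => z [[x' ix' <-]] /=; rewrite chartK// => jx'.
by exists x'.
Qed.

Lemma metric_det_gt0 i y : chart_img i y -> 0 < \det (metric i y).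
Proof. by move=> [x ix <-]; apply: posdef_det_gt0 => v; exact: metric_pos. Qed.

Lemma metric_unit i y : chart_img i y -> metric i y \in unitmx.
Proof. by move=> iy; rewrite unitmxE unitfE gt_eqF// metric_det_gt0. Qed.

Lemma metric_det_neq0 i y : chart_img i y -> \det (metric i y) != 0.
Proof. by move=> iy; rewrite gt_eqF// metric_det_gt0. Qed.

Definition drow f i y : 'rV[R]_d := \row_a partial a (fun z => f (param i z)) y.

Lemma drow_trans f i j x : Ck_fun 1 f -> chart_dom i x -> chart_dom j x ->
  drow f i (chart i x) = drow f j (chart j x) *m (jac (trans i j) (chart i x))^T.
Proof.
move=> Cf ix jx; have ti : trans_dom i j (chart i x) by exists x.
apply/rowP => a; rewrite [LHS]mxE [RHS]mxE.
have E z : trans_dom i j z -> f (param i z) = f (param j (trans i j z)).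
  by move=> /trans_domP[_ _ h]; rewrite /trans chartK.
have H := partial_ext (f := fun z => f (param i z)) (g := fun z => f (param j (trans i j z))) (@trans_dom_open i j) a E ti.
rewrite H.
have tE : trans i j (chart i x) = chart j x by rewrite /trans chartK.
have [|_ ->] := partial_comp (f := fun z => f (param j z)) a (@trans_dom_open i j) (open_chart_img (i := j)) ti
  (fun c => transition_smooth i j 1 c) (Cf j).
  by rewrite -/(trans i j _) tE; exact: chart_imgP.
rewrite -/(trans i j _) tE; apply: eq_bigr => c _; rewrite !mxE mulrC; congr (_ * _).
Qed.

Lemma jac_unit i j x : chart_dom i x -> chart_dom j x ->
  jac (trans i j) (chart i x) \in unitmx.
Proof.
by move=> ix jx; rewrite unitmxE unitfE gt_eqF//; exact: transition_oriented.
Qed.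

Lemma gradE f i x : grad f i x = drow f i (chart i x) *m invmx (metric i (chart i x)).
Proof. by []. Qed.

Lemma grad_metric f i x : chart_dom i x ->
  grad f i x *m metric i (chart i x) = drow f i (chart i x).
Proof. by move=> ix; rewrite gradE mulmxKV// metric_unit//; exact: chart_imgP. Qed.

(** With J the Jacobian of the transition from [i] to [j], one has drow_i = drow_j J^T and metric_i
    = J metric_j J^T. Multiplying the claim by the invertible metric_j and J^T reduces it to the
    first identity. *)
Lemma grad_vfield f : Ck_fun 1 f -> is_vfield (grad f).
Proof.
move=> Cf i j x ix jx; set J := jac _ _.
have Ju : J \in unitmx by exact: jac_unit.
have gu : metric j (chart j x) \in unitmx by apply: metric_unit; exact: chart_imgP.
apply: (can_inj (mulmxK gu)); rewrite grad_metric//.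
apply: (can_inj (mulmxK (_ : J^T \in unitmx))); first by rewrite unitmx_tr.
rewrite -(drow_trans Cf ix jx) -!mulmxA mulmxA.
have -> : grad f i x *m (J *m (metric j (chart j x) *m J^T)) =
    grad f i x *m metric i (chart i x) by rewrite (metric_tensor ix jx) !mulmxA.
by rewrite grad_metric.
Qed.

(** [dotv] is computed in the chart [chart_at x], which may jump with [x]. Tensoriality gives the
    same value in every chart, so that continuity and measurability can be checked in a fixed
    one. *)
Lemma dotv_chart X Y i x : is_vfield X -> is_vfield Y -> chart_dom i x ->
  dotv X Y x = (X i x *m metric i (chart i x) *m (Y i x)^T) 0 0.
Proof.
move=> vX vY ix; rewrite /dotv; have jx := chart_at_dom x; set j := chart_at x in jx *.
rewrite (vX i j x ix jx) (vY i j x ix jx) (metric_tensor ix jx) trmx_mul.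
by rewrite !mulmxA.
Qed.

Lemma dotv_sum X Y i x : is_vfield X -> is_vfield Y -> chart_dom i x ->
  dotv X Y x = \sum_a \sum_c X i x 0 c * metric i (chart i x) c a * Y i x 0 a.
Proof.
move=> vX vY ix; rewrite (dotv_chart vX vY ix) mxE; apply: eq_bigr => a _.
by rewrite !mxE mulr_suml.
Qed.

Lemma dotv_gradr X f x :
  dotv X (grad f) x = \sum_a X (chart_at x) x 0 a * drow f (chart_at x) (chart (chart_at x) x) 0 a.
Proof.
have ix := chart_at_dom x; set i := chart_at x in ix *.
have gu : metric i (chart i x) \in unitmx by apply: metric_unit; exact: chart_imgP.
rewrite /dotv -/i gradE trmx_mul trmx_inv (Defs.metric_sym ix) mulmxA mulmxK// mxE.
by apply: eq_bigr => a _; rewrite !mxE.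
Qed.

Lemma dotvC X Y x : dotv X Y x = dotv Y X x.
Proof.
rewrite /dotv; have ix := chart_at_dom x; set i := chart_at x in ix *.
rewrite -[LHS]trace_mx11 -mxtrace_tr !trmx_mul trmxK (Defs.metric_sym ix) mulmxA.
by rewrite trace_mx11.
Qed.

Lemma Ck_grad f k i a : Ck_fun k.+1 f ->
  Ck k (chart_img i) (fun y => grad f i (param i y) 0 a).
Proof.
move=> Cf; have Wo : open (chart_img i) by exact: open_chart_img.
apply: (@Ck_ext _ _ _ Wo _ (fun y => \sum_b partial b (fun z => f (param i z)) y *
    invmx (metric i y) b a)).
  by move=> y iy; rewrite gradE paramK// mxE; apply: eq_bigr => b _; rewrite mxE.
apply: Ck_sum => // b; apply: CkM => //; first by exact: Ck_partial (Cf i).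
apply: Ck_invmx => //; first by move=> y; exact: metric_det_neq0.
by move=> b' c; exact: metric_smooth.
Qed.

Lemma Ck_funW k f : Ck_fun k.+1 f -> Ck_fun k f.
Proof. by move=> Cf i; exact: CkW. Qed.

Lemma grad_C1 f : Ck_fun 2 f -> C1_vfield (grad f).
Proof.
move=> Cf; split; first by apply: grad_vfield; exact: Ck_funW.
by move=> i a; exact: Ck_grad.
Qed.

Lemma divv_at X x : C1_vfield X -> divv X x =
  divcoord (fun y => \det (metric (chart_at x) y)) (fun a y => X (chart_at x) (param (chart_at x) y) 0 a)
     (chart (chart_at x) x).
Proof.
move=> [_ CX]; apply: (divcoordE (W := chart_img (chart_at x))).
- exact: open_chart_img.
- by apply: chart_imgP; exact: chart_at_dom.
- apply: Ck_det; first exact: open_chart_img.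
  by move=> a c; exact: metric_smooth.
- exact: metric_det_gt0.
- by move=> a; exact: CX.
Qed.

(** The counterpart of [dotv_chart] for the divergence: [divcoord_invariant] is applied on the
    overlap of the two charts, with det J^2 relating the determinants of the metric. *)
Lemma divv_chart X i x : C1_vfield X -> chart_dom i x -> divv X x =
  divcoord (fun y => \det (metric i y)) (fun a y => X i (param i y) 0 a) (chart i x).
Proof.
move=> C1X ix; rewrite divv_at//; have jx := chart_at_dom x.
move: (chart_at x) jx => j jx; have [vX CX] := C1X.
have tE : trans j i (chart j x) = chart i x by rewrite /trans chartK.
have sub k l : trans_dom k l `<=` chart_img k by move=> z /trans_domP[].
rewrite -tE; apply: (divcoord_invariant (W := trans_dom j i) (W' := chart_img i)).
- exact: trans_dom_open.
- exact: open_chart_img.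
- by move=> z /trans_domP[_ _ h]; exact: chart_imgP.
- by exists x.
- by move=> c; exact: transition_smooth.
- by move=> z [x' [jx' ix'] <-]; rewrite gt_eqF//; exact: transition_oriented.
- apply: (Ck_sub (sub j i)); apply: Ck_det; first exact: open_chart_img.
  by move=> a c; exact: metric_smooth.
- apply: Ck_det; first exact: open_chart_img.
  by move=> a c; exact: metric_smooth.
- by move=> z; exact: metric_det_neq0.
- move=> z [x' [jx' ix'] <-]; rewrite (metric_tensor jx' ix') !det_mulmx det_tr.
  rewrite -/(trans j i) (_ : trans j i (chart j x') = chart i x'); last by rewrite /trans chartK.
  rewrite expr2; ring.
- by move=> a; exact: (Ck_sub (sub j i)) (CX j a).
- by move=> a; exact: CX.
- move=> z c [x' [jx' ix'] <-]; rewrite /trans !chartK// (vX j i x' jx' ix') mxE.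
  by apply: eq_bigr.
Qed.

Lemma Ck_divcoord (W : set 'rV[R]_d) (delta : 'rV[R]_d -> R) (X : 'I_d -> 'rV[R]_d -> R) :
  open W -> Ck 1 W delta -> (forall z, W z -> delta z != 0) -> (forall a, Ck 1 W (X a)) ->
  Ck 0 W (divcoord delta X).
Proof.
move=> Wo Cd d0 CX; apply: Ck_sum => // a; apply: CkD => //; first exact: Ck_partial.
apply: CkM => //; first exact: CkW.
apply: CkM => //; first exact: Ck_partial.
apply: CkV => //; first by move=> y Wy; rewrite mulf_neq0 ?d0.
by apply: CkZ => //; exact: CkW.
Qed.

Lemma continuous_of_charts f :
  (forall i, exists2 G, Ck 0 (chart_img i) G & forall x, chart_dom i x -> f x = G (chart i x)) ->
  continuous f.
Proof.
move=> h x; have ix := chart_at_dom x; set i := chart_at x in ix *.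
have [G CG fG] := h i.
have cG : {for chart i x, continuous G} by apply: Ck_continuous CG _; exact: chart_imgP.
have c : {for x, continuous (G \o chart i)}.
  by apply: continuous_comp; [exact: chart_continuous|exact: cG].
rewrite /continuous_at fG//; apply: cvg_trans c.
have E : {near x, G \o chart i =1 f}.
  have : nbhs x (chart_dom i) by apply: open_nbhs_nbhs; split => //; exact: chart_dom_open.
  by apply: filterS => z iz; rewrite fG.
exact: (@near_eq_cvg _ _ (nbhs x) (nbhs_filter x) _ _ E).
Qed.

Lemma Ck_fun_continuous k f : Ck_fun k f -> continuous f.
Proof.
move=> Cf; apply: continuous_of_charts => i; exists (fun y => f (param i y)).
  by split => // y iy; exact: Ck_continuous (Cf i) iy.
by move=> x ix; rewrite chartK.
Qed.

Lemma divv_continuous X : C1_vfield X -> continuous (divv X).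
Proof.
move=> CX; apply: continuous_of_charts => i.
exists (divcoord (fun y => \det (metric i y)) (fun a y => X i (param i y) 0 a)); last first.
  by move=> x ix; exact: divv_chart.
apply: Ck_divcoord; first exact: open_chart_img.
- apply: Ck_det; first exact: open_chart_img.
  by move=> a c; exact: metric_smooth.
- by move=> z; exact: metric_det_neq0.
- by move=> a; exact: CX.2.
Qed.

Lemma dotv_continuous X Y : is_vfield X -> is_vfield Y ->
  (forall i a, Ck 0 (chart_img i) (fun y => X i (param i y) 0 a)) ->
  (forall i a, Ck 0 (chart_img i) (fun y => Y i (param i y) 0 a)) ->
  continuous (dotv X Y).
Proof.
move=> vX vY CX CY; apply: continuous_of_charts => i.
have Wo : open (chart_img i) by exact: open_chart_img.
exists (fun y => \sum_a \sum_c X i (param i y) 0 c * metric i y c a * Y i (param i y) 0 a).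
  apply: Ck_sum => // a; apply: Ck_sum => // c; apply: CkM => //; apply: CkM => //.
  exact: metric_smooth.
by move=> x ix; rewrite (dotv_sum vX vY ix) chartK.
Qed.

Lemma A0_continuous U f : Ck_fun 1 U -> smooth f -> continuous (A0 U f).
Proof.
move=> CU Cf x; apply: continuousB.
  by apply: divv_continuous; exact: grad_C1.
apply: dotv_continuous.
- exact: grad_vfield.
- exact/grad_vfield/Cf.
- by move=> i a; exact: Ck_grad.
- by move=> i a; exact: Ck_grad.
Qed.

Lemma grad_dot_continuous f h : smooth f -> smooth h -> continuous (dotv (grad f) (grad h)).
Proof.
move=> Cf Ch; apply: dotv_continuous.
- exact/grad_vfield/Cf.
- exact/grad_vfield/Ch.
- by move=> i a; exact: Ck_grad.
- by move=> i a; exact: Ck_grad.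
Qed.

Lemma smoothM f h : smooth f -> smooth h -> smooth (f \* h).
Proof. by move=> Cf Ch k i; apply: CkM; [exact: open_chart_img|exact: Cf|exact: Ch]. Qed.

Lemma smoothB f h : smooth f -> smooth h -> smooth (f \- h).
Proof. by move=> Cf Ch k i; apply: CkB; [exact: open_chart_img|exact: Cf|exact: Ch]. Qed.

Lemma smoothD f h : smooth f -> smooth h -> smooth (f \+ h).
Proof. by move=> Cf Ch k i; apply: CkD; [exact: open_chart_img|exact: Cf|exact: Ch]. Qed.

Lemma smoothZ (c : R) f : smooth f -> smooth (fun x => c * f x).
Proof. by move=> Cf k i; apply: CkZ; [exact: open_chart_img|exact: Cf]. Qed.

Lemma smooth_derive f i y a : smooth f -> chart_img i y ->
  is_derive y (delta_mx 0 a) (fun z => f (param i z)) (drow f i y 0 a).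
Proof. by move=> Cf iy; rewrite mxE; exact: is_derive_partial (Cf 1%N i) iy. Qed.

Lemma drowM f h i y : smooth f -> smooth h -> chart_img i y ->
  drow (f \* h) i y = f (param i y) *: drow h i y + h (param i y) *: drow f i y.
Proof.
move=> Cf Ch iy; apply/rowP => a; rewrite [LHS]mxE [RHS]mxE [X in _ = X + _]mxE [X in _ = _ + X]mxE.
exact: partial_is_derive (is_deriveM (smooth_derive a Cf iy) (smooth_derive a Ch iy)).
Qed.

Lemma drowB f h i y : smooth f -> smooth h -> chart_img i y ->
  drow (f \- h) i y = drow f i y - drow h i y.
Proof.
move=> Cf Ch iy; apply/rowP => a; rewrite [LHS]mxE [RHS]mxE [X in _ = _ + X]mxE.
exact: partial_is_derive (is_deriveB (smooth_derive a Cf iy) (smooth_derive a Ch iy)).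
Qed.

Lemma gradB f h i x : smooth f -> smooth h -> chart_dom i x ->
  grad (f \- h) i x = grad f i x - grad h i x.
Proof. by move=> Cf Ch ix; rewrite !gradE drowB ?mulmxBl//; exact: chart_imgP. Qed.

Lemma gradM f h i x : smooth f -> smooth h -> chart_dom i x ->
  grad (f \* h) i x = f x *: grad h i x + h x *: grad f i x.
Proof.
move=> Cf Ch ix; rewrite !gradE drowM ?mulmxDl//; last exact: chart_imgP.
by rewrite chartK// !scalemxAl.
Qed.

Lemma laplaceM f h x : smooth f -> smooth h ->
  laplace (f \* h) x = f x * laplace h x + h x * laplace f x + 2 * dotv (grad f) (grad h) x.
Proof.
move=> Cf Ch; have Cfh := smoothM Cf Ch.
rewrite /laplace !divv_at; [|exact/grad_C1/Cf|exact/grad_C1/Ch|exact/grad_C1/Cfh].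
have e1 : dotv (grad f) (grad h) x = \sum_a grad f (chart_at x) x 0 a *
    drow h (chart_at x) (chart (chart_at x) x) 0 a by exact: dotv_gradr.
have e2 : dotv (grad f) (grad h) x = \sum_a grad h (chart_at x) x 0 a *
    drow f (chart_at x) (chart (chart_at x) x) 0 a by rewrite dotvC; exact: dotv_gradr.
(* The two copies of the gradient product are expressed with the roles of [f] and [h] exchanged, to
   match the two sums of [divcoordM]. *)
rewrite mulr_natl mulr2n {1}e1 e2; have ix := chart_at_dom x.
move: (chart_at x) ix => i ix; have Wy := chart_imgP ix.
have Wo : open (chart_img i) by exact: open_chart_img.
have fx : f x = f (param i (chart i x)) by rewrite chartK.
have hx : h x = h (param i (chart i x)) by rewrite chartK.
have -> : \sum_a grad f i x 0 a * drow h i (chart i x) 0 a =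
    \sum_a grad f i (param i (chart i x)) 0 a * partial a (fun z => h (param i z)) (chart i x).
  by rewrite chartK//; apply: eq_bigr => a _; rewrite [X in _ * X = _]mxE.
have -> : \sum_a grad h i x 0 a * drow f i (chart i x) 0 a =
    \sum_a grad h i (param i (chart i x)) 0 a * partial a (fun z => f (param i z)) (chart i x).
  by rewrite chartK//; apply: eq_bigr => a _; rewrite [X in _ * X = _]mxE.
rewrite fx hx -(divcoordM (fun z => \det (metric i z)) Wy (Cf 1%N i) (Ch 1%N i)
  (fun a => Ck_grad i a (Ch 2%N)) (fun a => Ck_grad i a (Cf 2%N))).
apply: (divcoord_ext _ Wo Wy) => a z iz.
by rewrite gradM//; [rewrite !mxE|exact: param_dom].
Qed.

Lemma A0M U f h x : smooth f -> smooth h ->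
  A0 U (f \* h) x = f x * A0 U h x + h x * A0 U f x + 2 * dotv (grad f) (grad h) x.
Proof.
move=> Cf Ch; rewrite /A0 laplaceM//.
have -> : dotv (grad U) (grad (f \* h)) x =
    f x * dotv (grad U) (grad h) x + h x * dotv (grad U) (grad f) x.
  rewrite /dotv; have ix := chart_at_dom x.
  rewrite gradM// linearD/= mulmxDr mxE !linearZ/=.
  by rewrite [X in X + _ = _]mxE [X in _ + X = _]mxE.
move: (laplace f x) (laplace h x) (dotv (grad f) (grad h) x) (dotv (grad U) (grad h) x)
  (dotv (grad U) (grad f) x) (f x) (h x) => lf lh fh uh uf p q; ring.
Qed.

End manifold.

(** * Square-integrable functions and vector fields *)

Section integral.
Context {d : measure_display} {T : measurableType d} {R : realType} (P : probability T R).

Lemma fatou_bound (q : nat -> T -> R) (q' : T -> R) (e : \bar R) :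
  (forall k, measurable_fun setT (q k)) -> measurable_fun setT q' ->
  (forall k x, 0 <= q k x) -> (forall x, 0 <= q' x) ->
  {ae P, forall x, q ^~ x @ \oo --> q' x} ->
  (exists K, forall k, (K <= k)%N -> (\int[P]_x (q k x)%:E <= e)%E) ->
  (\int[P]_x (q' x)%:E <= e)%E.
Proof.
move=> mq mq' q0 q'0 [N [mN PN NP]] [K KP].
(* Overwriting the sequence by its limit on the null set makes it converge everywhere and leaves the
   integrals unchanged. *)
pose r k x := if x \in N then q' x else q k x.
have mr k : measurable_fun setT (r k).
  apply: measurable_fun_ifT => //; apply: (measurable_fun_bool true); rewrite setTI.
  rewrite (_ : _ @^-1` _ = N)//; apply/seteqP; split => x /=; first by move=> /set_mem.
  by move=> /mem_set ->.
have r0 k x : 0 <= r k x by rewrite /r; case: ifP.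
have rq k : (\int[P]_x (r k x)%:E = \int[P]_x (q k x)%:E)%E.
  apply: ge0_ae_eq_integral => //.
  - exact/measurable_EFinP.
  - exact/measurable_EFinP.
  - by move=> x _; rewrite lee_fin.
  - by move=> x _; rewrite lee_fin.
  exists N; split => // x /= h; apply: contrapT => xN; apply: h => _.
  by rewrite /r; case: ifP => //; rewrite inE.
have rc x : (fun k => (r k x)%:E) @ \oo --> (q' x)%:E.
  apply/fine_cvgP; split; first by apply: nearW.
  have [xN|xN] := boolP (x \in N).
    rewrite (_ : _ \o _ = cst (q' x)); first exact: cvg_cst.
    by apply/funext => k; rewrite /= /r xN.
  rewrite (_ : _ \o _ = q ^~ x); last by apply/funext => k; rewrite /= /r (negPf xN).
  apply: contrapT => h; move/negP: xN; apply; rewrite inE; exact: NP.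
have -> : (\int[P]_x (q' x)%:E = \int[P]_x limn_einf (fun k => (r k x)%:E))%E.
  by apply: eq_integral => x _; rewrite (cvg_limn_einf_sup (rc x)).1.
have := @fatou _ _ _ P setT measurableT (fun k x => (r k x)%:E).
move=> /(_ _ _)/le_trans; apply.
- by move=> k; exact/measurable_EFinP.
- by move=> k x _; rewrite lee_fin.
rewrite limn_einf_lim; apply: lime_le; first exact: is_cvg_einfs.
apply: nearW => n; apply: le_trans (KP (maxn n K) (leq_maxr _ _)).
by apply: ereal_inf_lbound; exists (maxn n K); rewrite /= ?leq_maxl// rq.
Qed.

(** The inequality D <= 2^-n + 2^n D^2 turns the bound 4^-n on the integral of the square into 2 *
    2^-n on that of [D n]. The sum therefore has integral at most 4 and is finite almost
    everywhere. *)
Lemma ae_summable (D : nat -> T -> R) :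
  (forall n, measurable_fun setT (D n)) -> (forall n x, 0 <= D n x) ->
  (forall n, (\int[P]_x (D n x ^+ 2)%:E <= (4^-1 ^+ n)%:E)%E) ->
  {ae P, forall x, cvgn (series (D ^~ x))}.
Proof.
move=> mD D0 DI.
have mD2 n : measurable_fun setT (EFin \o (fun x => D n x ^+ 2)).
  by apply/measurable_EFinP; exact: measurable_funX.
have mDE n : measurable_fun setT (EFin \o D n) by exact/measurable_EFinP.
have DI' n : (\int[P]_x (D n x)%:E <= (2 * 2^-1 ^+ n)%:E)%E.
  apply: (@le_trans _ _ (\int[P]_x ((2^-1 ^+ n)%:E + (2 ^+ n)%:E * (D n x ^+ 2)%:E))%E).
    apply: ge0_le_integral => //.
    - by move=> x _; rewrite lee_fin.
    - exact: mDE.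
    - by apply: emeasurable_funD => //; apply: measurable_funeM; exact: mD2.
    move=> x _; rewrite -EFinM -EFinD lee_fin exprVn.
    have p0 : 0 < 2 ^+ n :> R by rewrite exprn_gt0.
    have := D0 n x; move: (D n x) (2 ^+ n : R) p0 => u v v0 u0.
    have : 0 <= v * (u - v^-1) ^+ 2 by rewrite mulr_ge0 ?sqr_ge0// ltW.
    have -> : v * (u - v^-1) ^+ 2 = v * u ^+ 2 - 2 * u + v^-1 by field; rewrite gt_eqF.
    have : 0 < v^-1 by rewrite invr_gt0.
    lra.
  rewrite ge0_integralD//; last 2 first.
  - by move=> x _; rewrite -EFinM lee_fin mulr_ge0 ?sqr_ge0 ?exprn_ge0.
  - by apply: measurable_funeM; exact: mD2.
  have -> : (\int[P]_x ((2 ^+ n)%:E * (D n x ^+ 2)%:E) = (2 ^+ n)%:E * \int[P]_x (D n x ^+ 2)%:E)%E.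
    apply: ge0_integralZl_EFin => //.
    - by move=> x _; rewrite lee_fin sqr_ge0.
    - exact: mD2.
  have -> : (\int[P]_(x in [set: T]) (2^-1 ^+ n)%:E = (2^-1 ^+ n)%:E)%E.
    transitivity ((2^-1 ^+ n)%:E * P [set: T])%E; first exact: integral_cst.
    by rewrite probability_setT mule1.
  apply: (@le_trans _ _ ((2^-1 ^+ n)%:E + (2 ^+ n)%:E * (4^-1 ^+ n)%:E)%E).
    by rewrite leeD2l// lee_pmul2l// lte_fin exprn_gt0.
  rewrite -EFinM -EFinD lee_fin -exprMn (_ : 2 * 4^-1 = 2^-1 :> R); last by field.
  by rewrite mulr2n mulrDl mul1r.
pose S x := (\sum_(n <oo) (D n x)%:E)%E.
have mS : measurable_fun setT S.
  apply: (emeasurable_fun_cvg (fun n x => \sum_(0 <= i < n) (D i x)%:E)%E).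
    by move=> n; apply: emeasurable_sum.
  by move=> x _; apply: is_cvg_nneseries => n _ _; rewrite lee_fin.
have S0 x : (0 <= S x)%E by apply: nneseries_ge0 => n _ _; rewrite lee_fin.
have iS : P.-integrable setT S.
  apply/integrableP; split => //.
  under eq_integral do rewrite gee0_abs//.
  rewrite integral_nneseries//; last by move=> n x _; rewrite lee_fin.
  apply: (@le_lt_trans _ _ 4%:E); last exact: ltry.
  apply: lime_le; first by apply: is_cvg_nneseries => n _ _; apply: integral_ge0 => x _; rewrite lee_fin.
  apply: nearW => n.
  apply: (@le_trans _ _ (\sum_(0 <= i < n) (2 * 2^-1 ^+ i)%:E)%E); first exact: lee_sum.
  rewrite sumEFin lee_fin.
  suff -> : \sum_(0 <= i < n) 2 * 2^-1 ^+ i = 4 - 4 * 2^-1 ^+ n :> R.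
    by rewrite gerBl// mulr_ge0// exprn_ge0.
  elim: n => [|n IH]; first by rewrite big_nil expr0 mulr1 subrr.
  by rewrite big_nat_recr//= IH exprS; field.
have := integrable_ae measurableT iS; apply: filterS => x /(_ I) Sx.
apply: (@series_nneg_bounded _ _ (fine (S x))) => // n.
rewrite -lee_fin fineK// seriesEnat/= -sumEFin; apply: nneseries_lim_ge => k _ _.
by rewrite lee_fin.
Qed.

(** The factor [C] is there for vector fields, whose coordinates are bounded by the pointwise norm
    only up to a constant. *)
Lemma cvg_of_summable_steps (u D : R ^nat) (C : R) :
  (forall n, `|u n.+1 - u n| <= C * D n) -> (forall n, 0 <= D n) -> 0 <= C ->
  cvgn (series D) -> cvgn u.
Proof.
move=> uD D0 C0 cD.
have cs : cvgn (series (telescope u)).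
  apply: normed_cvg; apply: (series_le_cvg _ _ _ (is_cvg_seriesZ (k := C) cD)).
  - by move=> n; exact: normr_ge0.
  - by move=> n; rewrite -[(C *: D) n]/(C * D n) mulr_ge0.
  - by move=> n; exact: uD.
have -> : u = (fun n => u 0%N + series (telescope u) n).
  by apply/funext => n; exact: eq_sum_telescope.
by apply: is_cvgD => //; exact: is_cvg_cst.
Qed.

End integral.

Lemma measurable_mem (d : measure_display) (T : measurableType d) (N : set T) :
  measurable N -> measurable_fun setT (fun x : T => x \in N).
Proof.
move=> mN; apply: (measurable_fun_bool true); rewrite setTI.
rewrite (_ : _ @^-1` _ = N)//; apply/seteqP; split => x /=; first by move=> /set_mem.
by move=> /mem_set ->.
Qed.

(** * Borel measurability on the manifold *)

Section borel.
Context {R : realType} {d : nat} {M : riemannian_manifold R d}.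

Lemma open_borel (A : set M) : open A -> measurable (A : set (borel M)).
Proof. by move=> oA; exact: sub_sigma_algebra. Qed.

Lemma open_continuous_borel (D : set M) (f : M -> R) : open D ->
  (forall x, D x -> {for x, continuous f}) -> measurable_fun (D : set (borel M)) (f : borel M -> R).
Proof.
move=> oD cf; apply: (measurability (@RGenOpens.G R)); first exact: RGenOpens.measurableE.
move=> _ [_ [a [b ->]] <-]; apply: open_borel.
rewrite openE => x [Dx fx]; have : nbhs x (D `&` (f @^-1` `]a, b[%classic)).
  apply: filterI; first exact: open_nbhs_nbhs.
  by apply: (cf x Dx); apply: open_nbhs_nbhs; split => //; exact: interval_open.
by [].
Qed.

Lemma continuous_borel (f : M -> R) : continuous f -> measurable_fun setT (f : borel M -> R).
Proof. by move=> cf; apply: open_continuous_borel => [|x _]; [exact: openT|exact: cf]. Qed.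

Lemma continuous_bounded (f : M -> R) : continuous f -> exists B : R, forall x, `|f x| <= B.
Proof.
move=> cf; have : compact (f @` [set: M]).
  by apply: continuous_compact; [exact: continuous_subspaceT|exact: manifold_compact].
move=> /compact_bounded [B [_ BP]]; exists (`|B| + 1) => x.
by apply: (BP (`|B| + 1)); [rewrite ltr_pwDr// ler_norm|exists x].
Qed.

(** The atlas may be uncountable; compactness reduces the matter to finitely many chart domains. *)
Lemma measurable_of_charts (f : M -> R) :
  (forall i, measurable_fun (chart_dom i : set (borel M)) (f : borel M -> R)) ->
  measurable_fun setT (f : borel M -> R).
Proof.
move=> mf; pose D (x : M) : set M := chart_dom (chart_at x).
have h (s : seq M) : measurable (\big[setU/set0]_(x <- s) D x : set (borel M)) /\
    measurable_fun (\big[setU/set0]_(x <- s) D x : set (borel M)) (f : borel M -> R).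
  elim: s => [|x s [IH1 IH2]]; first by rewrite big_nil; split => //; exact: measurable_fun_set0.
  have mD : measurable (D x : set (borel M)) by apply: open_borel; exact: chart_dom_open.
  rewrite big_cons; split; first exact: measurableU.
  by apply/measurable_funU => //; split => //; exact: mf.
have := @manifold_compact R d M; rewrite compact_cover => /(_ M setT D).
move=> [||F _ FP].
- by move=> x _; exact: chart_dom_open.
- by move=> x _; exists x => //; exact: chart_at_dom.
have -> : [set: borel M] = \big[setU/set0]_(x <- finmap.enum_fset F) D x.
  apply/seteqP; split => x // _; have [y /= yF Dy] := FP x I.
  by rewrite -bigcup_seq; exists y.
exact: (h (finmap.enum_fset F)).2.
Qed.

Lemma measurable_dotv (X Y : vfield M) : measurable_vfield X -> measurable_vfield Y ->
  measurable_fun setT (dotv X Y : borel M -> R).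
Proof.
move=> [vX mX] [vY mY]; apply: measurable_of_charts => i.
apply: (@eq_measurable_fun _ _ _ _ (chart_dom i : set (borel M))
  (fun x : borel M => \sum_a \sum_c X i x 0 c * metric i (chart i x) c a * Y i x 0 a)).
  by move=> x; rewrite inE => ix; rewrite (dotv_sum vX vY ix).
apply: measurable_sum => a; apply: measurable_sum => c.
apply: measurable_funM; last exact: mY.
apply: measurable_funM; first exact: mX.
apply: open_continuous_borel; first exact: chart_dom_open.
move=> x ix; apply: (@continuous_comp _ _ _ (chart i) (fun y => metric i y c a)).
  exact: chart_continuous.
by apply: (Ck_continuous (metric_smooth i 0 c a)); exact: chart_imgP.
Qed.

Lemma measurable_grad (f : M -> R) : smooth f -> measurable_vfield (grad f).
Proof.
move=> Cf; split; first exact/grad_vfield/Cf.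
move=> i a; apply: open_continuous_borel; first exact: chart_dom_open.
move=> x ix.
have c : {for x, continuous ((fun y => grad f i (param i y) 0 a) \o chart i)}.
  apply: continuous_comp; first exact: chart_continuous.
  by apply: (Ck_continuous (Ck_grad i a (Cf 1%N))); exact: chart_imgP.
rewrite /prop_for /continuous_at; have E : {near x, (fun y => grad f i (param i y) 0 a) \o chart i =1
    (fun z => grad f i z 0 a)}.
  have : nbhs x (chart_dom i) by apply: open_nbhs_nbhs; split => //; exact: chart_dom_open.
  by apply: filterS => z iz; rewrite /= chartK.
have h := @near_eq_cvg _ _ (nbhs x) (nbhs_filter x) _ _ E.
by apply: cvg_trans h _; move: c; rewrite /prop_for /continuous_at /= chartK.
Qed.

End borel.

Lemma fast_subsequence (R : realType) (dd : nat -> nat -> R) :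
  (forall e, 0 < e -> exists N, forall m n, (N <= m)%N -> (N <= n)%N -> dd m n < e) ->
  exists s : nat -> nat, [/\ forall m n, (m <= n)%N -> (s m <= s n)%N, forall n, (n <= s n)%N &
    forall n, dd (s n.+1) (s n) < 4^-1 ^+ n].
Proof.
move=> cd.
have p4 k : 0 < 4^-1 ^+ k :> R by rewrite exprn_gt0// invr_gt0.
have /choice [N NP] : forall k, exists N, forall m n, (N <= m)%N -> (N <= n)%N -> dd m n < 4^-1 ^+ k.
  by move=> k; exact: cd.
(* Summing the thresholds makes [s] monotone without asking it of [N]; the summand [k] gives
   [k <= s k]. *)
pose s k := (k + \sum_(0 <= j < k.+1) N j)%N.
have sS k : (s k <= s k.+1)%N.
  by rewrite /s [X in (_ <= _ + X)%N]big_nat_recr//= leq_add// leq_addr.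
exists s; split; [|by move=> n; rewrite leq_addr|].
- exact: (homo_leq leqnn leq_trans).
have sN k : (N k <= s k)%N by rewrite /s big_nat_recr//= addnA leq_addl.
by move=> n; apply: NP => //; apply: leq_trans (sS n).
Qed.

(** * Square-integrable functions and completeness *)

Section L2.
Context {R : realType} {d : nat} {M : riemannian_manifold R d}.
Variable P : probability (borel M) R.
Implicit Types f h : M -> R.

Lemma L2P f : L2 P f <-> measurable_fun setT (f : borel M -> R) /\
  P.-integrable [set: borel M] (EFin \o (fun x => f x ^+ 2)).
Proof.
split=> [Lf|[mf If]].
  split; last exact: Lfun2_integrable_sqr.
  by move: Lf; rewrite /L2/= inE => /andP[]; rewrite inE.
rewrite /L2 /= inE; apply/andP; split; rewrite inE//=.
rewrite /finite_norm unlock; apply: poweR_lty.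
have := integrable_lty measurableT If; apply: le_lt_trans.
rewrite le_eqVlt; apply/orP; left; apply/eqP; apply: eq_integral => x _.
by rewrite /= powR_mulrn// -normrX !ger0_norm ?sqr_ge0.
Qed.

Lemma L2_measurable f : L2 P f -> measurable_fun setT (f : borel M -> R).
Proof. by move=> /L2P[]. Qed.

Lemma L2_integrable f h : L2 P f -> L2 P h ->
  P.-integrable [set: borel M] (EFin \o (fun x => f x * h x)).
Proof. by move=> Lf Lh; apply/Lfun1_integrable; exact: Lfun2_mul_Lfun1. Qed.

Lemma L2_lin (a : R) f h : L2 P f -> L2 P h -> L2 P (fun x => a * f x + h x).
Proof.
move=> Lf Lh; apply/L2P; split.
  apply: measurable_funD; last exact: L2_measurable.
  by apply: measurable_funM => //; exact: L2_measurable.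
have i1 := integrableZl measurableT (a ^+ 2) (L2_integrable Lf Lf).
have i2 := integrableZl measurableT (2 * a) (L2_integrable Lf Lh).
have := integrableD measurableT (integrableD measurableT i1 i2) (L2_integrable Lh Lh).
apply: eq_integrable => // x _ /=; rewrite -!EFinM -!EFinD; congr EFin; ring.
Qed.

Lemma L2_0 : L2 P (fun=> 0).
Proof. by rewrite /L2/=; exact: (@Lfun_cst _ _ _ P 0 2). Qed.

Lemma L2_scale (a : R) f : L2 P f -> L2 P (fun x => a * f x).
Proof.
move=> Lf; have := L2_lin a Lf L2_0; congr (L2 P _).
by apply/funext => x; rewrite addr0.
Qed.

Lemma L2B f h : L2 P f -> L2 P h -> L2 P (f \- h).
Proof.
move=> Lf Lh; have := L2_lin (-1) Lh Lf; congr (L2 P _).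
by apply/funext => x; rewrite mulN1r addrC.
Qed.

Lemma L2_continuous f : continuous f -> L2 P f.
Proof.
move=> cf; apply/L2P; split; first exact: continuous_borel.
have [B BP] := continuous_bounded cf.
apply: measurable_bounded_integrable => //.
- by rewrite (le_lt_trans (probability_le1 P measurableT))// ltry.
- by apply: measurable_funX; exact: continuous_borel.
- exists (B ^+ 2); split; first exact: num_real.
  move=> z zB x _ /=; apply: le_trans (ltW zB).
  by rewrite normrX lerXn2r ?nnegrE// (le_trans _ (BP x)).
Qed.

Lemma ipE_fin f h : L2 P f -> L2 P h ->
  (ip P f h)%:E = (\int[P]_(x in [set: borel M]) (f x * h x)%:E)%E.
Proof. by move=> Lf Lh; rewrite fineK//; exact: integrable_fin_num (L2_integrable Lf Lh). Qed.

Lemma ipHC f h : ip P f h = ip P h f.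
Proof. by congr fine; apply: eq_integral => x _; rewrite mulrC. Qed.

Lemma ip_lin (a : R) f h (k : M -> R) : L2 P f -> L2 P h -> L2 P k ->
  ip P (fun x => a * f x + h x) k = a * ip P f k + ip P h k.
Proof.
move=> Lf Lh Lk; rewrite /ip -RintegralZl//; last exact: L2_integrable.
rewrite -RintegralD//; last 2 first.
- have := integrableZl measurableT a (L2_integrable Lf Lk).
  by apply: eq_integrable => // x _ /=; rewrite -EFinM.
- exact: L2_integrable.
by apply: eq_Rintegral => x _; rewrite mulrDl mulrA.
Qed.

Lemma ipH_ge0 f : 0 <= ip P f f.
Proof. by apply: Rintegral_ge0 => x _; rewrite -expr2 sqr_ge0. Qed.

Lemma normHE f : L2 P f -> normH P f = (Num.sqrt (ip P f f))%:E.
Proof.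
move=> Lf; rewrite /normH unlock.
have -> : (\int[P]_x (`|(EFin \o (f : borel M -> R)) x| `^ 2) = (ip P f f)%:E)%E.
  rewrite ipE_fin//; apply: eq_integral => x _.
  by rewrite /= powR_mulrn// -normrX ger0_norm ?sqr_ge0// expr2.
by rewrite poweR_EFin powR12_sqrt// ipH_ge0.
Qed.

Lemma ip_ae f f' h : L2 P f -> L2 P f' -> L2 P h -> aeeq P f f' -> ip P f h = ip P f' h.
Proof.
move=> Lf Lf' Lh ff'; congr fine; apply: ae_eq_integral => //.
- by apply/measurable_EFinP; apply: measurable_funM; exact: L2_measurable.
- by apply/measurable_EFinP; apply: measurable_funM; exact: L2_measurable.
- by move: ff'; apply: filterS => x fx _; rewrite fx.
Qed.

Lemma ip_eq0_ae f : L2 P f -> ip P f f = 0 -> aeeq P f (fun=> 0).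
Proof.
move=> Lf f0; have /L2P[mf If] := Lf.
have mf2 : measurable_fun [set: borel M] (EFin \o (fun x => f x ^+ 2)).
  by apply/measurable_EFinP; exact: measurable_funX.
have : (\int[P]_(x in [set: borel M]) `|((f x ^+ 2)%:E)| = 0)%E.
  rewrite -[RHS]/(0%:E) -f0 ipE_fin//; apply: eq_integral => x _.
  by rewrite /= ger0_norm ?sqr_ge0// expr2.
move=> /(ae_eq_integral_abs P measurableT mf2); apply: filterS => x /(_ I) /= [] /eqP.
by rewrite sqrf_eq0 => /eqP.
Qed.

Lemma L2_bound f (e : R) : measurable_fun setT (f : borel M -> R) ->
  (\int[P]_(x in [set: borel M]) (f x ^+ 2)%:E <= e%:E)%E -> L2 P f /\ ip P f f <= e.
Proof.
move=> mf fe.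
have Lf : L2 P f.
  apply/L2P; split => //; apply/integrableP; split.
    by apply/measurable_EFinP; exact: measurable_funX.
  apply: le_lt_trans (ltry e); apply: le_trans fe.
  rewrite le_eqVlt; apply/orP; left; apply/eqP; apply: eq_integral => x _.
  by rewrite /= ger0_norm ?sqr_ge0.
split => //; rewrite -lee_fin ipE_fin//; apply: le_trans fe.
Qed.

(** Riesz-Fischer, for functions instead of classes: a fast subsequence converges almost everywhere,
    and Fatou compares each [f_ n] with the limit. *)
Lemma L2_complete (f_ : nat -> M -> R) : (forall n, L2 P (f_ n)) ->
  (forall e, 0 < e -> exists N, forall m n, (N <= m)%N -> (N <= n)%N ->
     ip P (f_ m \- f_ n) (f_ m \- f_ n) < e) ->
  exists2 f, L2 P f & forall e, 0 < e -> exists N, forall n, (N <= n)%N ->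
     ip P (f_ n \- f) (f_ n \- f) < e.
Proof.
move=> Lf cf.
have mf n : measurable_fun setT (f_ n : borel M -> R) by exact: L2_measurable.
have [s [sm s_ge sf]] := fast_subsequence cf.
have IE m n : (\int[P]_(x in [set: borel M]) ((f_ m x - f_ n x) ^+ 2)%:E)%E
    = (ip P (f_ m \- f_ n) (f_ m \- f_ n))%:E.
  by rewrite ipE_fin; [apply: eq_integral => x _; rewrite expr2|exact: L2B|exact: L2B].
have mB m n : measurable_fun setT (fun x : borel M => f_ m x - f_ n x).
  by apply: measurable_funB.
have : {ae P, forall x, cvgn (series (fun n => `|f_ (s n.+1) x - f_ (s n) x|))}.
  apply: ae_summable.
  - by move=> n; apply: measurableT_comp => //; exact: mB.
  - by move=> n x; exact: normr_ge0.
  move=> n; apply: (@le_trans _ _ (ip P (f_ (s n.+1) \- f_ (s n)) (f_ (s n.+1) \- f_ (s n)))%:E).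
    by rewrite -IE le_eqVlt; apply/orP; left; apply/eqP; apply: eq_integral => x _; rewrite -normrX ger0_norm ?sqr_ge0.
  by rewrite lee_fin ltW.
move=> [N [mN PN NP]].
(* Zero on the null set, so that the sequence converges at every point and its limit is
   measurable. *)
pose g (k : nat) (x : borel M) := if x \in N then 0 else f_ (s k) x.
have mg (k : nat) : measurable_fun setT (g k).
  apply: (@measurable_fun_ifT _ _ (borel M) R _ _ (fun x : borel M => x \in N)).
  - exact: measurable_mem.
  - exact: measurable_cst.
  - exact: mf.
have cg x : cvgn (g ^~ x).
  have [xN|xN] := boolP (x \in N).
    by rewrite (_ : g ^~ x = cst 0); [exact: is_cvg_cst|apply/funext => k; rewrite /g xN].
  rewrite (_ : g ^~ x = fun k => f_ (s k) x); last by apply/funext => k; rewrite /g (negPf xN).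
  apply: (@cvg_of_summable_steps _ _ (fun n => `|f_ (s n.+1) x - f_ (s n) x|) 1) => //.
    by move=> n; rewrite mul1r.
  by apply: contrapT => h; move/negP: xN; apply; rewrite inE; exact: NP.
pose f (x : M) := limn (g ^~ x).
have mlim : measurable_fun setT (f : borel M -> R).
  by apply: (measurable_fun_cvg (h := g)) => // x _; exact: cg.
have bnd n (e : R) K : (forall k, (K <= k)%N -> ip P (f_ n \- f_ (s k)) (f_ n \- f_ (s k)) < e) ->
    (\int[P]_(x in [set: borel M]) ((f_ n x - f x) ^+ 2)%:E <= e%:E)%E.
  move=> KP; apply: (@fatou_bound _ _ _ P (fun k x => (f_ n x - f_ (s k) x) ^+ 2) _).
  - by move=> k; apply: measurable_funX; exact: mB.
  - by apply: measurable_funX; apply: measurable_funB.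
  - by move=> k x; exact: sqr_ge0.
  - by move=> x; exact: sqr_ge0.
  - exists N; split => // x h; apply: contrapT => xN; apply: h.
    have xN' : (x \in N) = false by apply/negP => /set_mem.
    rewrite /=; apply: (@continuous_cvg _ _ _ _ _ _ (fun y : R => y ^+ 2)); first exact: exprn_continuous.
    apply: cvgB; first exact: cvg_cst.
    have : g ^~ x @ \oo --> f x by exact: cg.
    by rewrite (_ : g ^~ x = fun k => f_ (s k) x)//; apply/funext => k; rewrite /g xN'.
  - by exists K => k Kk; rewrite IE lee_fin ltW// KP.
have LfB n (e : R) K : (forall k, (K <= k)%N -> ip P (f_ n \- f_ (s k)) (f_ n \- f_ (s k)) < e) ->
    L2 P (f_ n \- f) /\ ip P (f_ n \- f) (f_ n \- f) <= e.
  by move=> KP; apply: L2_bound; [apply: measurable_funB|exact: bnd KP].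
exists f.
  have [K KP] := cf 1 ltr01.
  have h : L2 P (f_ K \- f).
    apply: (LfB K 1 K _).1 => k Kk; apply: KP => //; exact: leq_trans (s_ge k).
  have := L2B (Lf K) h; congr (L2 P _); apply/funext => x /=; ring.
move=> e e0; have e2 : 0 < e / 2 by rewrite divr_gt0.
have [K KP] := cf (e / 2) e2; exists K => n Kn.
apply: le_lt_trans (_ : e / 2 < e); last by lra.
by apply: (LfB n _ K _).2 => k Kk; apply: KP => //; exact: leq_trans (s_ge k).
Qed.

End L2.

(** * Coordinates in the eigenbasis *)

(** Common source of the Cauchy-Schwarz inequalities below. The case c = 0 must be covered, as the
    form on functions is only semidefinite. *)
Lemma discriminant_le (R : rcfType) (a b c : R) : 0 <= a -> 0 <= c ->
  (forall t, 0 <= a + 2 * t * b + t ^+ 2 * c) -> `|b| <= Num.sqrt a * Num.sqrt c.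
Proof.
move=> a0 c0 h; rewrite -sqrtrM// -sqrtr_sqr; apply: ler_wsqrtr.
move: c0; rewrite le_eqVlt => /orP[/eqP c0|c0].
  rewrite -c0 mulr0; have [->|b0] := eqVneq b 0; first by rewrite expr0n.
  (* At this [t] the affine expression takes the value -1. *)
  have := h (- (a + 1) / (2 * b)); rewrite -c0 mulr0 addr0.
  have -> : 2 * (- (a + 1) / (2 * b)) * b = - (a + 1) by field.
  by rewrite opprD addrA subrr add0r oppr_ge0 ler10.
have := h (- b / c).
have -> : a + 2 * (- b / c) * b + (- b / c) ^+ 2 * c = (a * c - b ^+ 2) / c.
  by field; rewrite gt_eqF.
by rewrite pmulr_lge0 ?invr_gt0// subr_ge0.
Qed.

Lemma l2ip_fin (R : realType) (x y : l2 R) n : (forall k, (n <= k)%N -> x k = 0) ->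
  l2ip x y = \sum_(0 <= k < n) x k * y k.
Proof.
move=> xn; apply: l2ipE; apply: cvg_near_cst; exists n => // m /= nm.
rewrite seriesEnat /= (@big_cat_nat _ _ _ n)//= [X in _ + X]big_nat_cond.
rewrite [X in _ + X]big1 ?addr0// => i.
by rewrite andbT => /andP[/xn -> _]; rewrite mul0r.
Qed.

Section spectral.
Context {R : realType} {d : nat} {M : riemannian_manifold R d}.
Context {P : probability (borel M) R}.
Implicit Types f h : M -> R.
Local Notation L2 := (L2 P).
Local Notation ip := (ip P).
Local Notation nrm := (nrm (ip:=@l2ip R)).

Lemma ip_CS f h : L2 f -> L2 h -> `|ip f h| <= Num.sqrt (ip f f) * Num.sqrt (ip h h).
Proof.
move=> Lf Lh; apply: discriminant_le; [exact: ipH_ge0|exact: ipH_ge0|move=> t].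
have := ipH_ge0 P (fun x => t * h x + f x); rewrite ip_lin//; last exact: L2_lin.
have Lk : L2 (fun x => t * h x + f x) by exact: L2_lin.
rewrite [ip h _]ipHC [ip f _]ipHC !ip_lin// [ip h f]ipHC.
by congr (0 <= _); ring.
Qed.

(** Stated for an arbitrary filter because it serves both sequences and limits t -> 0+. *)
Lemma normH_cvg0 (I : Type) (F : set_system I) {FF : Filter F} (g : I -> M -> R) :
  (\forall i \near F, L2 (g i)) ->
  (normH P (g i) @[i --> F] --> 0%E) <->
  (forall e, 0 < e -> \forall i \near F, Num.sqrt (ip (g i) (g i)) < e).
Proof.
move=> Lg; split=> [|h].
  move=> /fine_cvgP[_ /cvgrPdist_lt h] e /h; apply: filterS2 Lg => i Lg /=.
  by rewrite sub0r normrN normHE//= ger0_norm ?sqrtr_ge0.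
apply/fine_cvgP; split; first by apply: filterS Lg => i Lg; rewrite normHE.
apply/cvgrPdist_lt => e /h; apply: filterS2 Lg => i Lg /=.
by rewrite sub0r normrN normHE//= ger0_norm ?sqrtr_ge0.
Qed.

Lemma L2_sum (a : nat -> R) (g : nat -> M -> R) n : (forall k, L2 (g k)) ->
  L2 (fun x => \sum_(0 <= k < n) a k * g k x).
Proof.
move=> Lg; elim: n => [|n IH].
  by rewrite (_ : (fun _ => _) = fun=> 0); [exact: L2_0|apply/funext => x; rewrite big_nil].
have := L2_lin (a n) (Lg n) IH; congr (L2 _).
by apply/funext => x; rewrite big_nat_recr//= addrC.
Qed.

Lemma ip_0l h : ip (fun=> 0) h = 0.
Proof. by rewrite /Defs.ip; under eq_Rintegral do rewrite mul0r; rewrite Rintegral_cst//= mul0r. Qed.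

Lemma ip_sum (a : nat -> R) (g : nat -> M -> R) h n : (forall k, L2 (g k)) -> L2 h ->
  ip (fun x => \sum_(0 <= k < n) a k * g k x) h = \sum_(0 <= k < n) a k * ip (g k) h.
Proof.
move=> Lg Lh; elim: n => [|n IH].
  rewrite big_nil (_ : (fun _ => _) = fun=> 0); first exact: ip_0l.
  by apply/funext => x; rewrite big_nil.
rewrite big_nat_recr//= -IH addrC -ip_lin//; last exact: L2_sum.
by congr (ip _ _); apply/funext => x; rewrite big_nat_recr//= addrC.
Qed.

Variables (phi : nat -> M -> R).
Hypothesis Lphi : forall k, L2 (phi k).
Hypothesis ophi : forall k l, ip (phi k) (phi l) = (k == l)%:R.
Hypothesis cphi : forall f, L2 f ->
     cvgH P (fun n x => \sum_(0 <= k < n) ip f (phi k) * phi k x) f.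

Lemma parseval f h : L2 f -> L2 h ->
  series (fun k => ip f (phi k) * ip h (phi k)) @ \oo --> ip f h.
Proof.
move=> Lf Lh; apply/cvgrPdist_lt => e e0.
have Ls n : L2 (fun x => \sum_(0 <= k < n) ip f (phi k) * phi k x) by exact: L2_sum.
have s1 : 0 < Num.sqrt (ip h h) + 1 by rewrite ltr_wpDl ?sqrtr_ge0.
have := cphi Lf; move/(@normH_cvg0 _ \oo _ (fun n => (fun x => \sum_(0 <= k < n) ip f (phi k) * phi k x) \- f)).
move=> /(_ (nearW _ (fun n => L2B (Ls n) Lf))) /(_ (e / (Num.sqrt (ip h h) + 1)) (divr_gt0 e0 s1)).
apply: filterS => n; rewrite seriesEnat /=.
under eq_bigr do rewrite [ip h _]ipHC.
rewrite -ip_sum// distrC -[_ - ip f h](_ : ip ((fun x => \sum_(0 <= k < n) ip f (phi k) * phi k x) \- f) h = _).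
  move=> sn; apply: le_lt_trans (ip_CS _ Lh) _; first exact: L2B.
  move: sn; rewrite ltr_pdivlMr//; apply: le_lt_trans.
  by rewrite ler_wpM2l ?sqrtr_ge0// lerDl.
rewrite -mulN1r addrC -ip_lin//.
by congr (ip _ _); apply/funext => x /=; rewrite mulN1r addrC.
Qed.

Lemma coord_sqsum f : L2 f -> sqsum (fun k => ip f (phi k)).
Proof.
move=> Lf; have := @parseval f f Lf Lf => /(cvgP _).
by rewrite /sqsum; under eq_fun do rewrite -expr2.
Qed.

(** The default value 0 outside [L2] makes [coords] total, so that it can be written for [B u] or
    [T t f] without a membership proof. *)
Lemma coords_ex f : exists a : l2 R, L2 f -> forall k, a k = ip f (phi k).
Proof.
have [Lf|] := pselect (L2 f); last by exists 0.
by exists (mkl2 (coord_sqsum Lf)).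
Qed.

Definition coords f : l2 R := sval (cid (coords_ex f)).

Lemma coordsE f k : L2 f -> coords f k = ip f (phi k).
Proof. by move=> Lf; rewrite /coords; case: cid => a /= /(_ Lf). Qed.

Lemma coords_ip f h : L2 f -> L2 h -> l2ip (coords f) (coords h) = ip f h.
Proof.
move=> Lf Lh; apply: l2ipE; have := parseval Lf Lh.
by rewrite (_ : (fun k => ip f (phi k) * ip h (phi k)) = (fun k => coords f k * coords h k))//;
  apply/funext => k; rewrite !coordsE.
Qed.

Lemma coords_lin a f h : L2 f -> L2 h ->
  coords (fun x => a * f x + h x) = a *: coords f + coords h.
Proof.
move=> Lf Lh; apply: l2P => k.
transitivity (a * coords f k + coords h k); last by [].
have E0 := coordsE k (L2_lin a Lf Lh).
have E1 := coordsE k Lf.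
have E2 := coordsE k Lh.
have E3 := ip_lin a Lf Lh (Lphi k).
apply: (eq_trans E0).
apply: (eq_trans E3).
by rewrite -E1 -E2.
Qed.

Lemma coordsB f h : L2 f -> L2 h -> coords (f \- h) = coords f - coords h.
Proof.
move=> Lf Lh; have E : (f \- h) = (fun x => -1 * h x + f x).
  by apply/funext => x /=; rewrite mulN1r addrC.
by rewrite E (coords_lin (-1) Lh Lf) scaleN1r addrC.
Qed.

Lemma nrm_coords f : L2 f -> nrm (coords f) = Num.sqrt (ip f f).
Proof. by move=> Lf; rewrite /nrm coords_ip. Qed.

Lemma coords_ae f h : L2 f -> L2 h -> aeeq P f h <-> coords f = coords h.
Proof.
move=> Lf Lh; split=> [fh|fh].
  by apply: l2P => k; rewrite !coordsE//; exact: ip_ae.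
have : ip (f \- h) (f \- h) = 0.
  by rewrite -coords_ip ?coordsB ?fh ?subrr ?(ip0l l2_hilbert)//; exact: L2B.
move=> /(ip_eq0_ae (L2B Lf Lh)); apply: filterS => x /= /eqP.
by rewrite subr_eq0 => /eqP.
Qed.

Lemma cvgH_coords (f_ : nat -> M -> R) f : (forall n, L2 (f_ n)) -> L2 f -> cvgH P f_ f <->
  (forall e, 0 < e -> exists N, forall n, (N <= n)%N -> nrm (coords (f_ n) - coords f) < e).
Proof.
move=> Lf_ Lf; have E n : nrm (coords (f_ n) - coords f) = Num.sqrt (ip (f_ n \- f) (f_ n \- f)).
  by rewrite -coordsB// nrm_coords//; exact: L2B.
rewrite /cvgH; have := @normH_cvg0 _ \oo _ (fun n => f_ n \- f).
move=> ->; last by apply: nearW => n; exact: L2B.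
split=> h e e0; have := h e e0.
  by move=> [N _ NP]; exists N => n /NP; rewrite E.
by move=> [N NP]; exists N => // n /NP; rewrite E.
Qed.

Lemma ipBB f h : L2 f -> L2 h ->
  ip (f \- h) (f \- h) = nrm (coords f - coords h) ^+ 2.
Proof.
move=> Lf Lh; have LB := L2B Lf Lh.
by rewrite -coordsB// (nrm_coords LB) sqr_sqrtr// ipH_ge0.
Qed.

(** The squared distance from [a] to the coordinates of a partial sum is the tail of the series of
    squares of [a]; hence the partial sums are Cauchy, and completeness provides the function. *)
Lemma of_coords_ex (a : l2 R) : exists2 f, L2 f & coords f = a.
Proof.
have LS n : L2 (fun x => \sum_(0 <= k < n) a k * phi k x) by exact: L2_sum.
set S := (fun n x => \sum_(0 <= k < n) a k * phi k x) in LS.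
have SE n k : coords (S n) k = (k < n)%N%:R * a k.
  rewrite (coordsE k (LS n)) (ip_sum a n Lphi (Lphi k)); under eq_bigr do rewrite ophi.
  have [kn|kn] := ltnP k n.
    rewrite (bigD1_seq k)/= ?mem_index_iota ?iota_uniq// eqxx mulr1 mul1r.
    by rewrite big1 ?addr0// => i /negPf ->; rewrite mulr0.
  rewrite mul0r big_nat_cond big1// => i; rewrite andbT => /andP[_ ik].
  by rewrite ltn_eqF ?mulr0// (leq_trans ik).
have nS n : nrm (coords (S n) - a) ^+ 2 = l2ip a a - \sum_(0 <= k < n) a k ^+ 2.
  rewrite (nrm_sqr l2_hilbert) (ipBl l2_hilbert) !(ipBr l2_hilbert).
  have z k : (n <= k)%N -> coords (S n) k = 0 by move=> nk; rewrite SE ltnNge nk mul0r.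
  have e y : l2ip (coords (S n)) y = \sum_(0 <= k < n) a k * y k.
    rewrite (l2ip_fin _ z) big_nat_cond [RHS]big_nat_cond; apply: eq_bigr => k.
    by rewrite andbT SE => /andP[_ ->]; rewrite mul1r.
  have [C _ _ _ _ _] := @l2_hilbert R; rewrite [l2ip a (coords _)]C !e.
  have -> : \sum_(0 <= k < n) a k * coords (S n) k = \sum_(0 <= k < n) a k ^+ 2.
    rewrite big_nat_cond [RHS]big_nat_cond; apply: eq_bigr => k.
    by rewrite andbT SE => /andP[_ ->]; rewrite mul1r expr2.
  have -> : \sum_(0 <= k < n) a k * a k = \sum_(0 <= k < n) a k ^+ 2.
    by apply: eq_bigr => k _; rewrite expr2.
  ring.
have Sa e : 0 < e -> exists N, forall n, (N <= n)%N -> nrm (coords (S n) - a) < e.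
  move=> e0; have [N NP] := l2_tail0 a (exprn_gt0 2 e0).
  by exists N => n /NP; rewrite -nS ltr_pXn2r// ?nnegrE ?nrm_ge0// ltW.
have [|f Lf Sf] := @L2_complete _ _ _ P S LS.
  move=> e e0; have se : 0 < Num.sqrt e by rewrite sqrtr_gt0.
  have [N NP] := Sa _ (divr_gt0 se (ltr0Sn _ 1)); exists N => m n Nm Nn.
  rewrite (ipBB (LS m) (LS n)) -[e]sqr_sqrtr ?ltW// ltr_pXn2r// ?nnegrE ?sqrtr_ge0//.
  apply: le_lt_trans (nrm_tri l2_hilbert a _ _) _; rewrite (nrmBC l2_hilbert a).
  by rewrite [ltRHS]splitr; apply: ltrD; exact: NP.
exists f => //; apply/eqP; rewrite -subr_eq0; apply/eqP/(nrm_lt0 l2_hilbert) => e e0.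
have e2 : 0 < e / 2 by rewrite divr_gt0.
have [N1 N1P] := Sa _ e2; have [N2 N2P] := Sf _ (exprn_gt0 2 e2).
have := N1P (maxn N1 N2) (leq_maxl _ _); have := N2P (maxn N1 N2) (leq_maxr _ _).
rewrite (ipBB (LS _) Lf) ltr_pXn2r ?nnegrE ?sqrtr_ge0 ?(ltW e2)// (nrmBC l2_hilbert).
move=> h1 h2; rewrite (splitr e).
exact: le_lt_trans (nrm_tri l2_hilbert (coords (S (maxn N1 N2))) (coords f) a) (ltrD h1 h2).
Qed.

Definition of_coords (a : l2 R) : M -> R := sval (cid2 (of_coords_ex a)).

Lemma of_coords_L2 a : L2 (of_coords a).
Proof. by rewrite /of_coords; case: cid2. Qed.

Lemma of_coordsK a : coords (of_coords a) = a.
Proof. by rewrite /of_coords; case: cid2. Qed.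

End spectral.

Lemma cvgn_sum_fin (R : realType) (I : finType) (F : I -> R ^nat) (l : I -> R) :
  (forall i, F i @ \oo --> l i) -> (fun n => \sum_i F i n) @ \oo --> \sum_i l i.
Proof.
move=> Fl; elim: (index_enum I) => [|i s IH].
  by rewrite big_nil; under eq_fun do rewrite big_nil; exact: cvg_cst.
by rewrite big_cons; under eq_fun do rewrite big_cons; apply: cvgD.
Qed.

(** * Pointwise inequalities for the Riemannian metric *)

Section metric.
Context {R : realType} {d : nat} {M : riemannian_manifold R d}.
Implicit Types X Y Z : vfield M.

Lemma dotv_lin a X Y Z x :
  dotv (fun i z => a *: X i z + Y i z) Z x = a * dotv X Z x + dotv Y Z x.
Proof. by rewrite /dotv !mulmxDl -!scalemxAl !mxE. Qed.

Lemma dotv_ge0 X x : 0 <= dotv X X x.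
Proof.
rewrite /dotv; set v := X _ x; have [->|v0] := eqVneq v 0; first by rewrite !mul0mx mxE.
by apply/ltW/metric_pos => //; exact: chart_at_dom.
Qed.

Lemma dotv_lin2 a X Y x :
  dotv (fun i z => a *: X i z + Y i z) (fun i z => a *: X i z + Y i z) x =
  a ^+ 2 * dotv X X x + 2 * a * dotv X Y x + dotv Y Y x.
Proof.
set Z := (fun i z => a *: X i z + Y i z).
rewrite /Z dotv_lin -/Z (dotvC X Z) (dotvC Y Z) /Z !dotv_lin (dotvC Y X); ring.
Qed.

Lemma dotv_CS X Y x : `|dotv X Y x| <= Num.sqrt (dotv X X x) * Num.sqrt (dotv Y Y x).
Proof.
apply: discriminant_le; [exact: dotv_ge0|exact: dotv_ge0|move=> t].
have := dotv_ge0 (fun i z => t *: Y i z + X i z) x; rewrite dotv_lin2 [dotv Y X x]dotvC.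
by congr (0 <= _); ring.
Qed.

Lemma dotv_AMGM X Y x : `|dotv X Y x| <= dotv X X x + dotv Y Y x.
Proof.
apply: le_trans (dotv_CS X Y x) _.
have := dotv_ge0 X x; have := dotv_ge0 Y x.
move: (dotv X X x) (dotv Y Y x) => u v v0 u0.
have := sqr_ge0 (Num.sqrt u - Num.sqrt v); rewrite sqrrB !sqr_sqrtr//.
by rewrite -mulr_natr; have := mulr_ge0 (sqrtr_ge0 u) (sqrtr_ge0 v); lra.
Qed.

Lemma dotv_sub X Y : (fun i z => X i z - Y i z) = (fun i z => -1 *: Y i z + X i z).
Proof. by apply/funext => i; apply/funext => z; rewrite scaleN1r addrC. Qed.

Lemma measurable_vfield_lin a X Y : measurable_vfield X -> measurable_vfield Y ->
  measurable_vfield (fun i z => a *: X i z + Y i z).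
Proof.
move=> [vX mX] [vY mY]; split.
  by move=> i j x ix jx; rewrite (vX i j x) ?(vY i j x)// mulmxDl scalemxAl.
move=> i k.
rewrite (_ : (fun x => _) = (fun x => a * X i x 0 k + Y i x 0 k)); last first.
  by apply/funext => x; rewrite !mxE.
apply: measurable_funD; last exact: mY.
by apply: measurable_funM; [exact: measurable_cst|exact: mX].
Qed.

Lemma measurable_vfieldB X Y : measurable_vfield X -> measurable_vfield Y ->
  measurable_vfield (fun i z => X i z - Y i z).
Proof. by move=> mX mY; rewrite dotv_sub; exact: measurable_vfield_lin. Qed.

(** The coordinate v_a is the g-product of [v] with row [a] of the inverse of [g], so [C] is the
    g-norm of that row. *)
Lemma metric_coord_le (g : 'M[R]_d) (a : 'I_d) : g^T = g ->
  (forall v : 'rV[R]_d, v != 0 -> 0 < (v *m g *m v^T) 0 0) ->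
  exists2 C : R, 0 <= C & forall v : 'rV[R]_d, `|v 0 a| <= C * Num.sqrt ((v *m g *m v^T) 0 0).
Proof.
move=> gT gpos.
have gu : g \in unitmx by rewrite unitmxE unitfE gt_eqF// posdef_det_gt0.
have g0 (v : 'rV[R]_d) : 0 <= (v *m g *m v^T) 0 0.
  by have [->|/gpos/ltW//] := eqVneq v 0; rewrite !mul0mx mxE.
pose w : 'rV[R]_d := delta_mx 0 a *m invmx g.
exists (Num.sqrt ((w *m g *m w^T) 0 0)); first exact: sqrtr_ge0.
move=> v; have -> : v 0 a = (v *m g *m w^T) 0 0.
  rewrite trmx_mul trmx_inv gT -mulmxA (mulmxA g) mulmxV// mul1mx trmx_delta.
  by rewrite -colE !mxE.
rewrite mulrC; apply: discriminant_le => // t.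
have := g0 (v + t *: w).
rewrite linearD/= linearZ/= !mulmxDl !mulmxDr -!scalemxAl -!scalemxAr.
have -> : (w *m g *m v^T) = (v *m g *m w^T).
  rewrite [LHS]mx11_scalar [RHS]mx11_scalar; congr (_%:M).
  have -> : (w *m g *m v^T) 0 0 = ((w *m g *m v^T)^T) 0 0 by rewrite [RHS]mxE.
  by rewrite !trmx_mul trmxK gT mulmxA.
rewrite !mxE; set A := (\sum_j _); set B := (\sum_j _); set D := (\sum_j _).
by congr (0 <= _); ring.
Qed.

End metric.

(** * Square-integrable vector fields and completeness *)

Section L2_vfield.
Context {R : realType} {d : nat} {M : riemannian_manifold R d}.
Variable P : probability (borel M) R.
Implicit Types X Y Z : vfield M.

Definition VL2 X := measurable_vfield X /\
  P.-integrable [set: borel M] (EFin \o (dotv X X : borel M -> R)).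

Definition ipV X Y := \int[P]_(x in [set: borel M]) dotv X Y x.

Lemma integrable_dotv X Y : VL2 X -> VL2 Y ->
  P.-integrable [set: borel M] (EFin \o (dotv X Y : borel M -> R)).
Proof.
move=> [mX iX] [mY iY].
apply: le_integrable (integrableD measurableT iX iY) => //.
  by apply/measurable_EFinP; exact: measurable_dotv.
move=> x _ /=; rewrite lee_fin (le_trans (dotv_AMGM _ _ _))//.
by rewrite ger0_norm// addr_ge0// dotv_ge0.
Qed.

Lemma VL2_lin a X Y : VL2 X -> VL2 Y -> VL2 (fun i z => a *: X i z + Y i z).
Proof.
move=> VX VY; split; first by apply: measurable_vfield_lin; [exact: VX.1|exact: VY.1].
have i1 := integrableZl measurableT (a ^+ 2) VX.2.
have i2 := integrableZl measurableT (2 * a) (integrable_dotv VX VY).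
have := integrableD measurableT (integrableD measurableT i1 i2) VY.2.
by apply: eq_integrable => // x _ /=; rewrite dotv_lin2.
Qed.

Lemma VL2B X Y : VL2 X -> VL2 Y -> VL2 (fun i z => X i z - Y i z).
Proof. by move=> VX VY; rewrite dotv_sub; exact: VL2_lin. Qed.

Lemma ipV_lin a X Y Z : VL2 X -> VL2 Y -> VL2 Z ->
  ipV (fun i z => a *: X i z + Y i z) Z = a * ipV X Z + ipV Y Z.
Proof.
move=> VX VY VZ; rewrite /ipV -RintegralZl//; last exact: integrable_dotv.
rewrite -RintegralD//; last 2 first.
- have := integrableZl measurableT a (integrable_dotv VX VZ).
  by apply: eq_integrable => // x _ /=; rewrite -EFinM.
- exact: integrable_dotv.
by apply: eq_Rintegral => x _; rewrite dotv_lin.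
Qed.

Lemma ipVC X Y : ipV X Y = ipV Y X.
Proof. by apply: eq_Rintegral => x _; rewrite dotvC. Qed.

Lemma ipVB X Y Z : VL2 X -> VL2 Y -> VL2 Z ->
  ipV (fun i z => X i z - Y i z) Z = ipV X Z - ipV Y Z.
Proof. by move=> VX VY VZ; rewrite dotv_sub ipV_lin// mulN1r addrC. Qed.

Lemma ipV_ge0 X : 0 <= ipV X X.
Proof. by apply: Rintegral_ge0 => x _; exact: dotv_ge0. Qed.

Lemma ipVE X Y : VL2 X -> VL2 Y ->
  (ipV X Y)%:E = (\int[P]_(x in [set: borel M]) (dotv X Y x)%:E)%E.
Proof. by move=> VX VY; rewrite fineK//; exact: integrable_fin_num (integrable_dotv VX VY). Qed.

Lemma ipV_CS X Y : VL2 X -> VL2 Y -> `|ipV X Y| <= Num.sqrt (ipV X X) * Num.sqrt (ipV Y Y).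
Proof.
move=> VX VY; apply: discriminant_le; [exact: ipV_ge0|exact: ipV_ge0|move=> t].
pose Z : vfield M := (fun i z => t *: Y i z + X i z).
have VZ : VL2 Z := VL2_lin t VY VX.
have := ipV_ge0 Z; rewrite [X in 0 <= X](ipV_lin t VY VX VZ) (ipVC Y Z) (ipVC X Z).
rewrite (ipV_lin t VY VX VY) (ipV_lin t VY VX VX) (ipVC Y X).
by congr (0 <= _); ring.
Qed.

Lemma VL2_grad f : smooth f -> VL2 (grad f).
Proof.
move=> Cf; split; first exact: measurable_grad.
have := L2_integrable (L2_continuous P (grad_dot_continuous Cf Cf)) (L2_continuous P (@cst_continuous _ _ (1 : R))).
by apply: eq_integrable => // x _ /=; rewrite mulr1.
Qed.

Lemma VL2_bound X (e : R) : measurable_vfield X ->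
  (\int[P]_(x in [set: borel M]) (dotv X X x)%:E <= e%:E)%E -> VL2 X /\ ipV X X <= e.
Proof.
move=> mX Xe; have VX : VL2 X.
  split => //; apply/integrableP; split.
    by apply/measurable_EFinP; exact: measurable_dotv.
  apply: le_lt_trans (ltry e); apply: le_trans Xe.
  rewrite le_eqVlt; apply/orP; left; apply/eqP; apply: eq_integral => x _.
  by rewrite /= ger0_norm ?dotv_ge0.
by split => //; rewrite -lee_fin ipVE.
Qed.

Lemma VL2_complete (X_ : nat -> vfield M) : (forall n, VL2 (X_ n)) ->
  (forall e, 0 < e -> exists N, forall m n, (N <= m)%N -> (N <= n)%N ->
     ipV (fun i z => X_ m i z - X_ n i z) (fun i z => X_ m i z - X_ n i z) < e) ->
  exists2 G, VL2 G & forall e, 0 < e -> exists N, forall n, (N <= n)%N ->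
     ipV (fun i z => X_ n i z - G i z) (fun i z => X_ n i z - G i z) < e.
Proof.
move=> VX cX.
have mX n : measurable_vfield (X_ n) by exact: (VX n).1.
have [s [sm s_ge sX]] := fast_subsequence cX.
pose dX m n : vfield M := fun i z => X_ m i z - X_ n i z.
have vdX m n : VL2 (dX m n) by exact: VL2B.
pose D (n : nat) (x : M) : R := Num.sqrt (dotv (dX (s n.+1) (s n)) (dX (s n.+1) (s n)) x).
have : {ae P, forall x, cvgn (series (D ^~ x))}.
  apply: ae_summable.
  - move=> n; apply: (measurableT_comp (f := @Num.sqrt R)).
      by apply: continuous_measurable_fun; exact: sqrt_continuous.
    by apply: measurable_dotv; exact: (vdX _ _).1.
  - by move=> n x; exact: sqrtr_ge0.
  move=> n; apply: (@le_trans _ _ (ipV (dX (s n.+1) (s n)) (dX (s n.+1) (s n)))%:E).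
    rewrite ipVE// le_eqVlt; apply/orP; left; apply/eqP; apply: eq_integral => x _.
    by rewrite sqr_sqrtr// dotv_ge0.
  by rewrite lee_fin ltW// sX.
move=> [N [mN PN NP]].
(* The value 0 on the null set is taken in every chart at once, which respects changes of
   coordinates: the limit satisfies [is_vfield] at every point. *)
pose g (i : chart_idx M) (a : 'I_d) (k : nat) (x : borel M) := if x \in N then 0 else X_ (s k) i x 0 a.
have gE i a k x : ~ N x -> g i a k x = X_ (s k) i x 0 a.
  by move=> xN; rewrite /g; case: ifP => // /set_mem.
have cg i a x : chart_dom i x -> cvgn (g i a ^~ x).
  move=> ix; have [xN|xN] := pselect (N x).
    rewrite (_ : g i a ^~ x = cst 0); first exact: is_cvg_cst.
    by apply/funext => k; rewrite /g mem_set.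
  (* The constant that bounds a coordinate by the pointwise norm depends on the point and the chart,
     which is harmless for convergence at that point. *)
  have hm := fun v => @metric_pos _ _ M i x v ix.
  have [C C0 CP] := @metric_coord_le _ _ _ a (Defs.metric_sym ix) hm.
  apply: (@cvg_of_summable_steps _ _ (D ^~ x) C) => //.
  - move=> n; rewrite !gE//; apply: le_trans (_ : `|dX (s n.+1) (s n) i x 0 a| <= _).
      by rewrite !mxE.
    apply: le_trans (CP _) _; rewrite /D (dotv_chart _ _ ix)//; exact: (vdX _ _).1.1.
  - by move=> n; exact: sqrtr_ge0.
  - by apply: contrapT => h; apply: xN; exact: NP.
pose G : vfield M := fun i x => \row_a limn (g i a ^~ x).
have cG i a x : chart_dom i x -> g i a ^~ x @ \oo --> G i x 0 a.
  by move=> ix; rewrite mxE; exact: cg.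
have mG : measurable_vfield G.
  split.
    move=> i j x ix jx; apply/rowP => a.
    have h : g j a ^~ x = (fun k => \sum_c g i c k x *
        jac (fun y => chart j (param i y)) (chart i x) c a).
      apply/funext => k; have [xN|xN] := pselect (N x).
        by rewrite /g mem_set// big1// => c _; rewrite mul0r.
      rewrite gE// ((mX (s k)).1 i j x)// mxE; apply: eq_bigr => c _.
      by rewrite gE.
    rewrite [LHS]mxE h mxE; apply/cvg_lim => //; apply: cvgn_sum_fin => c.
    by apply: cvgM; [exact: cG|exact: cvg_cst].
  move=> i a; rewrite (_ : (fun x : borel M => G i x 0 a) = (fun x => limn (g i a ^~ x))); last first.
    by apply/funext => x; rewrite mxE.
  apply: (@measurable_fun_cvg _ (borel M) R (chart_dom i : set (borel M)) (g i a)).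
    have mi : measurable (chart_dom i : set (borel M)) by apply: open_borel; exact: chart_dom_open.
    have mm : measurable_fun (chart_dom i : set (borel M)) (fun x : borel M => x \in N).
      by apply: (measurable_funS measurableT) => //; exact: measurable_mem.
    move=> k; apply: (@measurable_fun_if _ _ (borel M) R _ _ _ mi _ mm).
    - exact: measurable_cst.
    - apply: (measurable_funS mi); last exact: (mX (s k)).2.
      by apply: subIsetl.
  by move=> x ix; exact: cg.
have bnd n (e : R) K : (forall k, (K <= k)%N -> ipV (dX n (s k)) (dX n (s k)) < e) ->
    VL2 (fun i z => X_ n i z - G i z) /\
    ipV (fun i z => X_ n i z - G i z) (fun i z => X_ n i z - G i z) <= e.
  move=> KP; have mXG := measurable_vfieldB (mX n) mG.
  apply: VL2_bound => //.
  apply: (@fatou_bound _ _ _ P (fun k x => dotv (dX n (s k)) (dX n (s k)) x) _).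
  - by move=> k; apply: measurable_dotv; exact: (vdX _ _).1.
  - exact: measurable_dotv.
  - by move=> k x; exact: dotv_ge0.
  - by move=> x; exact: dotv_ge0.
  - exists N; split => // x h; apply: contrapT => xN; apply: h => /=.
    have ix := chart_at_dom x.
    rewrite (dotv_sum mXG.1 mXG.1 ix).
    rewrite (_ : (fun k => _) = (fun k => \sum_a \sum_c (X_ n (chart_at x) x 0 c - g (chart_at x) c k x) *
      metric (chart_at x) (chart (chart_at x) x) c a * (X_ n (chart_at x) x 0 a - g (chart_at x) a k x))); last first.
      apply/funext => k; rewrite (dotv_sum (vdX _ _).1.1 (vdX _ _).1.1 ix).
      by apply: eq_bigr => a _; apply: eq_bigr => c _; rewrite !gE// !mxE.
    apply: cvgn_sum_fin => a; apply: cvgn_sum_fin => c; apply: cvgM; last first.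
      by rewrite [X in _ --> X]mxE [X in _ + X]mxE; apply: cvgB; [exact: cvg_cst|exact: cG].
    apply: cvgM; last exact: cvg_cst.
    by rewrite [X in _ --> X]mxE [X in _ + X]mxE; apply: cvgB; [exact: cvg_cst|exact: cG].
  - by exists K => k Kk; rewrite -ipVE// lee_fin ltW// KP.
have VG : VL2 G.
  have [K KP] := cX 1 ltr01.
  have h : VL2 (fun i z => X_ K i z - G i z).
    apply: (bnd K 1 K _).1 => k Kk; apply: KP => //; exact: leq_trans (s_ge k).
  have := VL2B (VX K) h; congr VL2; apply/funext => i; apply/funext => z.
  by rewrite opprB addrC subrK.
exists G => // e e0; have e2 : 0 < e / 2 by rewrite divr_gt0.
have [K KP] := cX (e / 2) e2; exists K => n Kn.
apply: le_lt_trans (_ : e / 2 < e); last by lra.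
by apply: (bnd n _ K _).2 => k Kk; apply: KP => //; exact: leq_trans (s_ge k).
Qed.

End L2_vfield.

Lemma eq_l2ip (R : realType) (a b a' b' : l2 R) :
  (forall k, a k * b k = a' k * b' k) -> l2ip a b = l2ip a' b'.
Proof. by move=> ab; rewrite /l2ip; congr (limn (series _)); apply/funext. Qed.

(** * Energy and weak gradients *)

Section weight.
Context {R : realType} (lam : R ^nat).
Hypothesis lam_ge0 : forall k, 0 <= lam k.

(* Multiplication by [weight] is (1 - A)^(-1/2) in the eigenbasis of A. *)
Definition weight k : R := (Num.sqrt (1 + lam k))^-1.

Lemma weight_gt0 k : 0 < weight k.
Proof. by rewrite invr_gt0 sqrtr_gt0 ltr_wpDr. Qed.

Lemma weight_sqr k : weight k ^+ 2 * (1 + lam k) = 1.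
Proof.
have l0 : 0 < 1 + lam k by rewrite ltr_wpDr.
by rewrite exprVn sqr_sqrtr ?ltW// mulVf// gt_eqF.
Qed.

Lemma weight_le1 k : `|weight k| <= 1.
Proof.
have l0 : 0 < 1 + lam k by rewrite ltr_wpDr.
rewrite gtr0_norm ?weight_gt0// invf_le1 ?sqrtr_gt0//.
by rewrite -[leLHS]sqrtr1; apply: ler_wsqrtr; rewrite lerDl.
Qed.

End weight.

(** * H^1 coordinates, density of smooth functions and weak gradients *)

Section energy.
Context {R : realType} {d : nat} {M : riemannian_manifold R d}.
Context {P : probability (borel M) R} {U : M -> R} {lam : nat -> R} {phi : nat -> M -> R}.
Implicit Types f h u v : M -> R.
Local Notation L2 := (L2 P).
Local Notation ip := (ip P).
Local Notation ipV := (ipV P).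
Local Notation A0 := (A0 U).
Local Notation nrm := (nrm (ip:=@l2ip R)).
Hypothesis HU : Ck_fun 1 U.
Hypothesis lam_ge0 : forall k, 0 <= lam k.
Hypothesis lam0 : lam 0%N = 0.
Hypothesis Lphi : forall k, L2 (phi k).
Hypothesis ophi : forall k l, ip (phi k) (phi l) = (k == l)%:R.
Hypothesis cphi : forall f, L2 f ->
     cvgH P (fun n x => \sum_(0 <= k < n) ip f (phi k) * phi k x) f.
Hypothesis Aphi : forall k, Aop P U (phi k) (fun x => - lam k * phi k x).
Hypothesis phi0 : exists a : R, aeeq P (phi 0%N) (fun=> a).
Local Notation cm := (coords Lphi cphi).
Local Notation rc := (of_coords Lphi ophi cphi).
Local Notation J := (multiplier (weight_le1 lam_ge0)).
Local Notation HL := (@l2_hilbert R).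

Lemma JE (a : l2 R) k : J a k = weight lam k * a k. Proof. by []. Qed.

Lemma J_le (a : l2 R) : nrm (J a) <= nrm a. Proof. exact: multiplier_le. Qed.

Lemma J_inj (a b : l2 R) : J a = J b -> a = b.
Proof.
move=> ab; apply: l2P => k; apply: (@mulfI _ (weight lam k)).
  by rewrite gt_eqF// weight_gt0.
by rewrite -!JE ab.
Qed.

Lemma JB (a b : l2 R) : J (a - b) = J a - J b. Proof. exact: raddfB. Qed.

Lemma ip_scale a f h : L2 f -> L2 h -> ip (fun x => a * f x) h = a * ip f h.
Proof.
move=> Lf Lh; have := ip_lin a Lf (L2_0 P) Lh; rewrite ip_0l addr0 => <-.
by congr (ip _ _); apply/funext => x; rewrite addr0.
Qed.

Lemma smooth_L2 f : smooth f -> L2 f.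
Proof. by move=> Cf; apply: L2_continuous; exact: Ck_fun_continuous (Cf 0%N). Qed.

Lemma A0_L2 f : smooth f -> L2 (A0 f).
Proof. by move=> Cf; apply: L2_continuous; exact: A0_continuous. Qed.

(** The adjoint clause of the Friedrichs extension at the eigenvector [phi k], tested on [h]. *)
Lemma coords_A0 h k : smooth h -> cm (A0 h) k = - lam k * cm h k.
Proof.
move=> Ch; have Lh := smooth_L2 Ch; rewrite (coordsE _ _ k (A0_L2 Ch)) (coordsE _ _ k Lh).
have [_ _ E] := Aphi k.
by rewrite ipHC E// ip_scale// ipHC.
Qed.

Lemma integral_A0 h : smooth h -> ip (fun=> 1) (A0 h) = 0.
Proof.
move=> Ch; have [a pa] := phi0; have L1 : L2 (fun=> 1) by exact: L2_continuous (@cst_continuous _ _ _).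
have La : L2 (fun=> a) by exact: L2_continuous (@cst_continuous _ _ _).
have E (g : M -> R) : L2 g -> ip (phi 0%N) g = a * ip (fun=> 1) g.
  move=> Lg; rewrite (ip_ae (Lphi _) La Lg pa) -ip_scale//; congr (ip _ _).
  by apply/funext => x; rewrite mulr1.
have a0 : a != 0.
  apply/eqP => a0; have := ophi 0%N 0%N; rewrite E// a0 mul0r => /eqP.
  by rewrite eq_sym oner_eq0.
apply: (mulfI a0); rewrite -E; last exact: A0_L2.
have [_ _ ->//] := Aphi 0%N; rewrite ip_scale//; last exact: smooth_L2.
by rewrite lam0 oppr0 mul0r mulr0.
Qed.

Lemma A0_sym f h : smooth f -> smooth h -> ip f (A0 h) = ip h (A0 f).
Proof.
move=> Cf Ch; rewrite -!(coords_ip Lphi cphi); [|exact: smooth_L2|exact: A0_L2|exact: smooth_L2|exact: A0_L2].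
apply: eq_l2ip => k; apply: (eq_trans (congr1 (fun z => cm f k * z) (coords_A0 k Ch))).
apply: (eq_trans _ (congr1 (fun z => cm h k * z) (esym (coords_A0 k Cf)))).
by move: (cm f k) (cm h k) => p q; rewrite mulrCA [RHS]mulrCA (mulrC p).
Qed.

Lemma energyE f h : smooth f -> smooth h -> ipV (grad f) (grad h) = - ip f (A0 h).
Proof.
move=> Cf Ch; have := integral_A0 (smoothM Cf Ch).
have Lf := smooth_L2 Cf; have Lh := smooth_L2 Ch.
have i1 := L2_integrable Lf (A0_L2 Ch); have i2 := L2_integrable Lh (A0_L2 Cf).
have i3 := integrable_dotv (VL2_grad P Cf) (VL2_grad P Ch).
have i4 : P.-integrable [set: borel M] (EFin \o (fun x : borel M => 2 * dotv (grad f) (grad h) x)).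
  by have := integrableZl measurableT 2 i3; apply: eq_integrable.
have i5 : P.-integrable [set: borel M] (EFin \o (fun x : borel M => f x * A0 h x + h x * A0 f x)).
  by have := integrableD measurableT i1 i2; apply: eq_integrable.
have -> : ip (fun=> 1) (A0 (f \* h)) = ip f (A0 h) + ip h (A0 f) + 2 * ipV (grad f) (grad h).
  have e1 := RintegralZl 2 measurableT i3; have e2 := RintegralD measurableT i1 i2.
  have e3 := RintegralD measurableT i5 i4.
  apply: (eq_trans _ (eq_trans e3 (congr2 +%R e2 e1))).
  by apply: eq_Rintegral => x _; rewrite mul1r A0M.
by rewrite (A0_sym Ch Cf); lra.
Qed.

(** The product of [f] with f - A f is the convergent series of (1 + lam_k) f_k^2, which is the
    squared norm of the required [a]. *)
Lemma smooth_J f : smooth f -> exists a, cm f = J a.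
Proof.
move=> Cf; have sq : sqsum (fun k => Num.sqrt (1 + lam k) * cm f k).
  have E : (fun k => cm f k * (cm f - cm (A0 f)) k) = (fun k => (Num.sqrt (1 + lam k) * cm f k) ^+ 2).
    apply/funext => k; rewrite l2B (coords_A0 _ Cf) exprMn sqr_sqrtr; last by rewrite ler_wpDr.
    ring.
  by have := l2ip_cvg (cm f) (cm f - cm (A0 f)); rewrite E => /cvgP.
exists (mkl2 sq); apply: l2P => k; rewrite JE /= /weight mulKf// gt_eqF// sqrtr_gt0.
by rewrite ltr_wpDr.
Qed.

(** As weight^2 (1 + lam) = 1, the product of [a] and [b] is <f, (1 - A) h>, the full H^1 product;
    subtracting the product of [H] leaves the energy. *)
Lemma energy_J f h a b : smooth f -> smooth h -> cm f = J a -> cm h = J b ->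
  ipV (grad f) (grad h) = l2ip a b - l2ip (J a) (J b).
Proof.
move=> Cf Ch fa hb; rewrite energyE// -fa -hb.
rewrite -(coords_ip Lphi cphi); [|exact: smooth_L2|exact: A0_L2].
have -> : l2ip a b - l2ip (cm f) (cm h) = l2ip (cm f) (- cm (A0 h)).
  have -> : l2ip a b = l2ip (cm f) (cm h - cm (A0 h)).
    apply: eq_l2ip => k.
    rewrite l2B coords_A0// fa hb !JE.
    transitivity (weight lam k ^+ 2 * (1 + lam k) * (a k * b k)); last by ring.
    by rewrite weight_sqr// mul1r.
  by rewrite (ipBr HL) (ipNr HL) addrC addKr.
by rewrite (ipNr HL).
Qed.

Definition smooth_range : set (l2 R) := [set a | exists2 f, smooth f & cm f = J a].

Lemma smooth_range_subspace : lin_subspace smooth_range.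
Proof.
have C0 f : smooth f -> smooth (fun x => 0 * f x) by exact: smoothZ.
split.
  (* A smooth function is borrowed from the approximations of [phi 0]; multiplied by 0 it represents
     the origin. *)
  have [[_ [f_ [Cf_ _ _]]] _ _] := Aphi 0%N; pose f := f_ 0%N; have Cf : smooth f := Cf_ 0%N.
  exists (fun x => 0 * f x); first exact: C0.
  apply: l2P => k; rewrite (coordsE _ _ k (smooth_L2 (C0 f Cf))).
  rewrite ip_scale//; last exact: smooth_L2.
  by rewrite mul0r JE l20 mulr0.
move=> c a b [f Cf fa] [h Ch hb]; exists (fun x => c * f x + h x).
  exact: smoothD (smoothZ c Cf) Ch.
by rewrite (coords_lin _ _ c (smooth_L2 Cf) (smooth_L2 Ch)) fa hb linearP.
Qed.

Lemma smoothB_J f h a b : smooth f -> smooth h -> cm f = J a -> cm h = J b ->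
  cm (f \- h) = J (a - b).
Proof.
by move=> Cf Ch fa hb; rewrite (coordsB _ _ (smooth_L2 Cf) (smooth_L2 Ch)) fa hb JB.
Qed.

(** The squared distance between H^1 coordinates is the energy of the difference plus its squared
    norm in [H], so they converge; their limit is identified through its image under [J], which is
    the limit in [H]. *)
Lemma energy_cauchy (f_ : nat -> M -> R) u : (forall n, smooth (f_ n)) -> L2 u -> cvgH P f_ u ->
  (forall e, 0 < e -> exists N, forall m n, (N <= m)%N -> (N <= n)%N ->
     ipV (grad (f_ m \- f_ n)) (grad (f_ m \- f_ n)) < e) ->
  exists (a_ : nat -> l2 R) (a : l2 R), [/\ forall n, cm (f_ n) = J (a_ n), cm u = J a &
    forall e, 0 < e -> exists N, forall n, (N <= n)%N -> nrm (a_ n - a) < e].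
Proof.
move=> Cf Lu fu cE; have /choice [a_ fa] := fun n => smooth_J (Cf n).
have Lf n := smooth_L2 (Cf n).
have E m n : l2ip (a_ m - a_ n) (a_ m - a_ n) =
    ipV (grad (f_ m \- f_ n)) (grad (f_ m \- f_ n)) + nrm (cm (f_ m) - cm (f_ n)) ^+ 2.
  have CB := smoothB (Cf m) (Cf n); have fB := smoothB_J (Cf m) (Cf n) (fa m) (fa n).
  by rewrite (energy_J CB CB fB fB) -(nrm_sqr HL (J _)) JB !fa subrK.
have fu' := (cvgH_coords Lphi cphi Lf Lu).1 fu.
have [_ _ _ _ _ HC] := HL.
have [a aP] : exists a, forall e, 0 < e -> exists N, forall n, (N <= n)%N ->
    l2ip (a_ n - a) (a_ n - a) < e.
  apply: HC => e e0; have e2 : 0 < e / 2 by rewrite divr_gt0.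
  have se : 0 < Num.sqrt (e / 2) / 2 by rewrite divr_gt0// sqrtr_gt0.
  have [N1 N1P] := cE _ e2; have [N2 N2P] := fu' _ se.
  exists (maxn N1 N2) => m n; rewrite !geq_max => /andP[m1 m2] /andP[n1 n2].
  rewrite E; have := N1P m n m1 n1.
  suff : nrm (cm (f_ m) - cm (f_ n)) ^+ 2 < e / 2 by lra.
  rewrite -[ltRHS]sqr_sqrtr ?(ltW e2)// ltr_pXn2r ?nnegrE ?nrm_ge0 ?sqrtr_ge0//.
  rewrite [ltRHS]splitr; apply: le_lt_trans (nrm_tri HL (cm u) (cm (f_ m)) (cm (f_ n))) _.
  by apply: ltrD (N2P m m2) _; rewrite (nrmBC HL) N2P.
have aP' e : 0 < e -> exists N, forall n, (N <= n)%N -> nrm (a_ n - a) < e.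
  move=> e0; have [N NP] := aP _ (exprn_gt0 2 e0).
  by exists N => n /NP; rewrite (nrm_lt HL).
exists a_, a; split => //; apply: (scvg_uniq HL) fu' _ => e /aP'[N NP].
by exists N => n /NP; apply: le_lt_trans; rewrite fa -JB; exact: J_le.
Qed.

(** An eigenvector [phi k] is in the Friedrichs form domain, so its H^1 coordinates, a multiple of
    the k-th unit vector, are a limit of those of smooth functions. A vector orthogonal to
    [smooth_range] thus has all coordinates zero. *)
Lemma smooth_range_dense a : in_closure (ip:=@l2ip R) smooth_range a.
Proof.
have [p Sp ap] := projection HL a smooth_range_subspace.
suff -> : a = p by [].
apply/eqP; rewrite -subr_eq0; apply/eqP; move: (a - p) ap => y yS.
apply: l2P => k; rewrite l20.
have [[Lk [f_ [Cf fk fE]]] _ _] := Aphi k.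
have [|a_ [b [fa kb ab]]] := energy_cauchy Cf Lk fk.
  move=> e /fE[N NP]; exists N => m n Nm Nn; have CB := smoothB (Cf m) (Cf n).
  by rewrite energyE// ipHC NP.
have Sb : in_closure (ip:=@l2ip R) smooth_range b.
  move=> e /ab[N NP]; exists (a_ N); first by exists (f_ N).
  by rewrite (nrmBC HL) NP.
have := closure_orth HL Sb yS.
have bk j : b j = (k == j)%:R / weight lam k.
  apply: (@mulfI _ (weight lam j)); first by rewrite gt_eqF// weight_gt0.
  rewrite -JE -kb (coordsE _ _ j (Lphi k)) ophi; case: eqP => [->|_]; last by rewrite mul0r mulr0.
  by rewrite mul1r mulfV// gt_eqF// weight_gt0.
have [C _ _ _ _ _] := HL; rewrite C (@l2ip_fin _ _ _ k.+1); last first.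
  by move=> j kj; rewrite bk ltn_eqF ?mul0r.
rewrite big_nat_recr//= big_nat_cond big1 => [|j]; last first.
  by rewrite andbT => /andP[_ jk]; rewrite bk gtn_eqF ?mul0r.
rewrite add0r bk eqxx mul1r => /eqP; rewrite mulf_eq0 invr_eq0 gt_eqF ?weight_gt0//=.
by move=> /eqP.
Qed.

(** The quadratic form of -A in H^1 coordinates. *)
Definition energy_form (a b : l2 R) : R := l2ip a b - l2ip (J a) (J b).

Lemma energy_formC a b : energy_form a b = energy_form b a.
Proof. by have [C _ _ _ _ _] := HL; rewrite /energy_form C (C (J a)). Qed.

Lemma energy_formBl a b c : energy_form (a - b) c = energy_form a c - energy_form b c.
Proof. rewrite /energy_form JB !(ipBl HL); ring. Qed.

Lemma energy_form_le a b : `|energy_form a b| <= 2 * (nrm a * nrm b).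
Proof.
apply: le_trans (ler_normB _ _) _; rewrite mulrDl mul1r; apply: lerD.
  exact: normr_ip_le HL _ _.
apply: le_trans (normr_ip_le HL _ _) _; apply: ler_pM => //; rewrite ?nrm_ge0//; exact: J_le.
Qed.

Lemma energy_form_diag_le a : energy_form a a <= nrm a ^+ 2.
Proof. by rewrite (nrm_sqr HL) /energy_form gerBl -(nrm_sqr HL) sqr_ge0. Qed.

Lemma ipV_gradB f h : smooth f -> smooth h ->
  ipV (fun i z => grad f i z - grad h i z) (fun i z => grad f i z - grad h i z) =
  ipV (grad (f \- h)) (grad (f \- h)).
Proof.
move=> Cf Ch; apply: eq_Rintegral => x _; rewrite /dotv.
by rewrite (gradB Cf Ch (chart_at_dom x)).
Qed.

Lemma ipVB_le (X Y : vfield M) : VL2 P X -> VL2 P Y ->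
  ipV (fun i z => X i z - Y i z) (fun i z => X i z - Y i z) <= 2 * ipV X X + 2 * ipV Y Y.
Proof.
move=> VX VY; have E c : ipV (fun i z => c *: Y i z + X i z) (fun i z => c *: Y i z + X i z) =
    c ^+ 2 * ipV Y Y + 2 * c * ipV Y X + ipV X X.
  have VZ := VL2_lin c VY VX.
  rewrite (ipV_lin c VY VX VZ) (ipVC P Y) (ipVC P X).
  rewrite (ipV_lin c VY VX VY) (ipV_lin c VY VX VX) (ipVC P X Y); ring.
rewrite dotv_sub E; have := ipV_ge0 P (fun i z => 1 *: Y i z + X i z); rewrite E.
by move: (ipV Y Y) (ipV Y X) (ipV X X) => p q r; lra.
Qed.

(** [is_weak_grad] only provides a limit in the extended reals: for large n its finiteness makes
    grad f_n - G square-integrable, hence [G] as well. A single approximant controls the H^1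
    coordinates and the gradient together. *)
Lemma weak_grad_approx u G a e : L2 u -> is_weak_grad P u G -> cm u = J a -> 0 < e ->
  VL2 P G /\ exists h b, [/\ smooth h, cm h = J b, nrm (b - a) < e &
    Num.sqrt (ipV (fun i z => grad h i z - G i z) (fun i z => grad h i z - G i z)) < e].
Proof.
move=> Lu [mG [f_ [Cf fu fG]]] ua e0.
pose X n : vfield M := fun i z => grad (f_ n) i z - G i z.
have fX r : 0 < r -> exists N, forall n, (N <= n)%N -> VL2 P (X n) /\ ipV (X n) (X n) < r.
  move=> r0; move/fine_cvgP: fG => [ff /cvgrPdist_lt /(_ r r0) fr].
  have [N _ NP] : \forall n \near \oo, VL2 P (X n) /\ ipV (X n) (X n) < r.
    apply: filterS2 ff fr => n nf nr.
    have mX : measurable_vfield (X n) by apply: measurable_vfieldB => //; exact: measurable_grad.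
    have bX : (\int[P]_(x in [set: borel M]) (dotv (X n) (X n) x)%:E <= (ipV (X n) (X n))%:E)%E.
      by rewrite fineK.
    have [VX _] := VL2_bound mX bX.
    by split => //; move: nr; rewrite sub0r normrN ger0_norm//; exact: ipV_ge0.
  by exists N => n Nn; exact: NP.
have VG : VL2 P G.
  have [N NP] := fX 1 ltr01; have [VX _] := NP N (leqnn N).
  have := VL2B (VL2_grad P (Cf N)) VX; congr (VL2 P _).
  by apply/funext => i; apply/funext => z; rewrite /X opprB addrC subrK.
split => //.
have [|a_ [a' [fa ua' aP]]] := energy_cauchy Cf Lu fu.
  (* A quarter each, since [ipVB_le] doubles both squared norms. *)
  move=> r r0; have [N NP] := fX (r / 4) (divr_gt0 r0 (ltr0Sn _ 3)).
  exists N => m n Nm Nn; rewrite -ipV_gradB//.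
  have [Vm hm] := NP m Nm; have [Vn hn] := NP n Nn.
  have -> : (fun i z => grad (f_ m) i z - grad (f_ n) i z) = (fun i z => X m i z - X n i z).
    by apply/funext => i; apply/funext => z; rewrite /X opprB addrA subrK.
  apply: le_lt_trans (ipVB_le Vm Vn) _; move: hm hn.
  by move: (ipV (X m) (X m)) (ipV (X n) (X n)) => p q; lra.
have aa : a' = a by apply: J_inj; rewrite -ua'.
have [N1 N1P] := aP e e0; have [N2 N2P] := fX _ (exprn_gt0 2 e0).
exists (f_ (maxn N1 N2)), (a_ (maxn N1 N2)); split => //.
  by rewrite -aa N1P// leq_maxl.
have [_] := N2P (maxn N1 N2) (leq_maxr _ _).
by move=> h; rewrite -(gtr0_norm e0) -sqrtr_sqr ltr_sqrt// exprn_gt0.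
Qed.

(** Density in the left argument only: one side is continuous for the distance of gradients, the
    other for that of H^1 coordinates. [ipV_weak] uses it once per argument. *)
Lemma ipV_weak_left u G a (Y : vfield M) b : L2 u -> is_weak_grad P u G -> cm u = J a -> VL2 P Y ->
  (forall h c, smooth h -> cm h = J c -> ipV (grad h) Y = energy_form c b) -> ipV G Y = energy_form a b.
Proof.
move=> Lu uG ua VY YP; apply/eqP; rewrite -subr_eq0 -normr_le0.
pose K : R := Num.sqrt (ipV Y Y) + 2 * nrm b.
have K0 : 0 <= K by rewrite addr_ge0 ?sqrtr_ge0// mulr_ge0 ?nrm_ge0.
have h e : 0 < e -> `|ipV G Y - energy_form a b| <= e * K.
  move=> e0; have [VG [h [c [Ch hc ca hG]]]] := weak_grad_approx Lu uG ua e0.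
  have Vh := VL2_grad P Ch; have VhG := VL2B Vh VG.
  have -> : ipV G Y - energy_form a b = energy_form (c - a) b - ipV (fun i z => grad h i z - G i z) Y.
    rewrite energy_formBl (ipVB Vh VG VY) -(YP h c Ch hc).
    by move: (ipV G Y) (energy_form a b) (ipV (grad h) Y) => p q r; ring.
  apply: le_trans (ler_normB _ _) _; rewrite addrC /K mulrDr; apply: lerD.
    by apply: le_trans (ipV_CS VhG VY) _; rewrite ler_wpM2r ?sqrtr_ge0// ltW.
  apply: le_trans (energy_form_le _ _) _; rewrite mulrCA ler_wpM2r ?mulr_ge0 ?nrm_ge0//.
  exact: ltW.
apply/ler_addgt0Pr => e e0; rewrite add0r.
have K1 : 0 < K + 1 by rewrite ltr_wpDl.
apply: le_trans (h (e / (K + 1)) (divr_gt0 e0 K1)) _.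
rewrite mulrAC ler_pdivrMr// ler_wpM2l ?(ltW e0)// lerDl//.
Qed.

(** Valid for any weak gradients, whatever sequences define them; the choice made by [xget] in
    [weak_grad] is therefore harmless. *)
Lemma ipV_weak u v Gu Gv a b : L2 u -> L2 v -> is_weak_grad P u Gu -> is_weak_grad P v Gv ->
  cm u = J a -> cm v = J b -> ipV Gu Gv = energy_form a b.
Proof.
move=> Lu Lv uG vG ua vb.
have [VGv _] := weak_grad_approx Lv vG vb ltr01.
apply: (ipV_weak_left Lu uG ua VGv) => h c Ch hc.
rewrite ipVC energy_formC; apply: (ipV_weak_left Lv vG vb (VL2_grad P Ch)) => h' c' Ch' hc'.
exact: energy_J.
Qed.

Lemma smooth_approx u a : L2 u -> cm u = J a -> exists f_ : nat -> M -> R,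
  [/\ forall n, smooth (f_ n), cvgH P f_ u &
   forall e, 0 < e -> exists N, forall m n, (N <= m)%N -> (N <= n)%N ->
     ipV (grad (f_ m \- f_ n)) (grad (f_ m \- f_ n)) < e].
Proof.
move=> Lu ua.
have [b_ bS ab] := scvg_approx HL (smooth_range_dense a).
have /choice [f_ fP] : forall n, exists f, smooth f /\ cm f = J (b_ n).
  by move=> n; have [f Cf fb] := bS n; exists f.
have Cf n : smooth (f_ n) := (fP n).1; have fb n : cm (f_ n) = J (b_ n) := (fP n).2.
have Lf n : L2 (f_ n) := smooth_L2 (Cf n).
exists f_; split => //.
  apply/(cvgH_coords Lphi cphi Lf Lu) => e /ab[N NP]; exists N => n /NP.
  by apply: le_lt_trans; rewrite fb ua -JB; exact: J_le.
move=> e e0; have e2 : 0 < Num.sqrt e / 2 by rewrite divr_gt0// sqrtr_gt0.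
have [N NP] := ab _ e2; exists N => m n Nm Nn.
have fB := smoothB_J (Cf m) (Cf n) (fb m) (fb n); have CB := smoothB (Cf m) (Cf n).
rewrite (energy_J CB CB fB fB).
apply: le_lt_trans (energy_form_diag_le _) _; rewrite -[ltRHS]sqr_sqrtr ?(ltW e0)//.
rewrite ltr_pXn2r ?nnegrE ?nrm_ge0 ?sqrtr_ge0// [ltRHS]splitr.
apply: le_lt_trans (nrm_tri HL a _ _) _; apply: ltrD; first exact: NP.
by rewrite (nrmBC HL) NP.
Qed.

(** Completeness of the vector fields provides the limit; it ensures that [weak_grad] is a genuine
    gradient and not the default field 0. *)
Lemma weak_grad_ex u a : L2 u -> cm u = J a -> exists G, is_weak_grad P u G.
Proof.
move=> Lu ua; have [f_ [Cf fu cE]] := smooth_approx Lu ua.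
have [|G VG GP] := VL2_complete (fun n => VL2_grad P (Cf n)).
  move=> e /cE[N NP]; exists N => m n Nm Nn.
  by rewrite (ipV_gradB (Cf m) (Cf n)) NP.
exists G; split; first exact: VG.1.
exists f_; split => //.
have VX n := VL2B (VL2_grad P (Cf n)) VG.
apply/fine_cvgP; split; first by apply: nearW => n; rewrite -ipVE.
apply/cvgrPdist_lt => e /GP[N NP]; exists N => // n /NP h.
by rewrite /= -ipVE//= sub0r normrN ger0_norm// ipV_ge0.
Qed.

Lemma ip1E u v a b : L2 u -> L2 v -> cm u = J a -> cm v = J b ->
  ip1 P u v = l2ip a b - l2ip (J a) (J b).
Proof.
move=> Lu Lv ua vb; apply: (ipV_weak Lu Lv _ _ ua vb).
  have [G uG] := weak_grad_ex Lu ua; exact: (@xgetPex _ (fun _ _ => 0) [set G | is_weak_grad P u G]) (ex_intro _ G uG).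
have [G vG] := weak_grad_ex Lv vb; exact: (@xgetPex _ (fun _ _ => 0) [set G | is_weak_grad P v G]) (ex_intro _ G vG).
Qed.

Lemma Hm1P u : Hm P lam phi 1 u <-> L2 u /\ exists a, cm u = J a.
Proof.
have E (Lu : L2 u) : (fun k => ip u (phi k) ^+ 2 * lam k ^+ 1) = (fun k => cm u k ^+ 2 * lam k).
  by apply/funext => k; rewrite (coordsE _ _ k Lu).
split=> [[Lu]|[Lu [a ua]]].
  rewrite E// => h; split => //.
  have sq : sqsum (fun k => Num.sqrt (1 + lam k) * cm u k).
    rewrite /sqsum (_ : (fun k => _) = (fun k => cm u k ^+ 2 + cm u k ^+ 2 * lam k)).
      exact: is_cvg_seriesD (l2_sqsum (cm u)) h.
    apply/funext => k; rewrite exprMn sqr_sqrtr; last by rewrite ler_wpDr.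
    by move: (cm u k) => p; ring.
  exists (mkl2 sq); apply: l2P => k; rewrite JE /= /weight mulKf// gt_eqF// sqrtr_gt0.
  by rewrite ltr_wpDr.
split => //; rewrite E//; apply: (series_le_cvg _ _ _ (l2_sqsum a)) => k.
- by rewrite mulr_ge0 ?sqr_ge0.
- exact: sqr_ge0.
rewrite ua JE exprMn mulrAC -[leRHS]mul1r -(weight_sqr lam_ge0 k) ler_wpM2r ?sqr_ge0//.
by rewrite ler_wpM2l ?sqr_ge0// lerDr.
Qed.

Lemma Hm2_JJ z : Hm P lam phi 2 (rc (J (J z))).
Proof.
have Lu := of_coords_L2 Lphi ophi cphi (J (J z)).
split => //; apply: (series_le_cvg _ _ _ (l2_sqsum z)) => k.
- by rewrite mulr_ge0 ?sqr_ge0 ?exprn_ge0.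
- exact: sqr_ge0.
rewrite -(coordsE Lphi cphi k Lu) of_coordsK !JE mulrA -expr2 exprMn mulrAC -[leRHS]mul1r.
rewrite ler_wpM2r ?sqr_ge0// -exprMn -[leRHS](@expr1n R 2) lerXn2r ?nnegrE//.
  by rewrite mulr_ge0 ?sqr_ge0.
by rewrite -(weight_sqr lam_ge0 k) ler_wpM2l ?sqr_ge0// lerDr.
Qed.

(** J^2 is the resolvent of A at 1. Membership in the form domain comes from smooth approximation in
    energy, the adjoint relation from a computation in coordinates. *)
Lemma Aop_JJ z : Aop P U (rc (J (J z))) (rc (J (J z) - z)).
Proof.
have Lu := of_coords_L2 Lphi ophi cphi (J (J z)).
have Lw := of_coords_L2 Lphi ophi cphi (J (J z) - z).
split => //.
  have ua : cm (rc (J (J z))) = J (J z) by exact: of_coordsK.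
  have [f_ [Cf fu cE]] := smooth_approx Lu ua.
  split => //; exists f_; split => // e /cE[N NP]; exists N => m n Nm Nn.
  have CB := smoothB (Cf m) (Cf n).
  by rewrite ipHC -(energyE CB CB) NP.
move=> h Ch; have Lh := smooth_L2 Ch.
rewrite -(coords_ip Lphi cphi Lu (A0_L2 Ch)) -(coords_ip Lphi cphi Lw Lh) !of_coordsK.
apply: eq_l2ip => k; rewrite (coords_A0 k Ch) l2B !JE.
have := weight_sqr lam_ge0 k; move: (cm h k) (z k) (weight lam k) (lam k) => p q w l wl.
have -> : w * (w * q) - q = w * (w * q) - w ^+ 2 * (1 + l) * q by rewrite wl mul1r.
ring.
Qed.

End energy.

(** * Transfer to l2 *)

Lemma near_right0 (R : realType) (A : R -> Prop) : (\forall t \near 0^'+, A t) <->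
  exists2 e : R, 0 < e & forall h, 0 < h -> h < e -> A h.
Proof.
split=> [|[e e0 eQ]].
  move=> /nbhs_ballP [e /= e0 eQ]; exists e => // h h0 he.
  by apply: eQ => //; rewrite /ball/= sub0r normrN gtr0_norm.
apply/nbhs_ballP; exists e => //= h; rewrite /ball/= sub0r normrN => he h0.
by apply: eQ => //; rewrite -(gtr0_norm h0).
Qed.

Section transfer.
Context {R : realType} {d : nat} {M : riemannian_manifold R d}.
Context {P : probability (borel M) R} {phi : nat -> M -> R}.
Implicit Types f h u v : M -> R.
Local Notation L2 := (L2 P).
Local Notation ip := (ip P).
Local Notation nrm := (nrm (ip:=@l2ip R)).
Local Notation HL := (@l2_hilbert R).
Hypothesis Lphi : forall k, L2 (phi k).
Hypothesis ophi : forall k l, ip (phi k) (phi l) = (k == l)%:R.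
Hypothesis cphi : forall f, L2 f ->
     cvgH P (fun n x => \sum_(0 <= k < n) ip f (phi k) * phi k x) f.
Local Notation cm := (coords Lphi cphi).
Local Notation rc := (of_coords Lphi ophi cphi).

Lemma normH_coords f : L2 f -> normH P f = (nrm (cm f))%:E.
Proof. by move=> Lf; rewrite normHE// nrm_coords. Qed.

Lemma closureH_coords (D : set (M -> R)) (D' : set (l2 R)) :
  (forall f, D f <-> L2 f /\ D' (cm f)) ->
  forall f, closureH P D f <-> L2 f /\ in_closure (ip:=@l2ip R) D' (cm f).
Proof.
move=> DP f; split=> [[Lf [f_ [Df ff]]]|[Lf fD]]; split => //.
  have Lf_ n : L2 (f_ n) := ((DP _).1 (Df n)).1.
  move=> e /((cvgH_coords Lphi cphi Lf_ Lf).1 ff)[N NP]; exists (cm (f_ N)).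
    exact: ((DP _).1 (Df N)).2.
  by rewrite (nrmBC HL) NP.
have [a_ Da aP] := scvg_approx HL fD.
have Lr n : L2 (rc (a_ n)) := of_coords_L2 _ _ _ _.
exists (fun n => rc (a_ n)); split; first by move=> n; apply/DP; rewrite of_coordsK.
apply/(cvgH_coords Lphi cphi Lr Lf) => e /aP[N NP].
by exists N => n /NP; rewrite of_coordsK.
Qed.

Variables (K : set (M -> R)) (K' : set (l2 R)).
Hypothesis KP : forall f, K f <-> L2 f /\ K' (cm f).
Hypothesis K'S : lin_subspace K'.
Variable T : R -> (M -> R) -> M -> R.
Hypothesis TS : contraction_semigroup P K T.
Definition sgl2 t a := cm (T t (rc a)).

Lemma KL2 f : K f -> L2 f. Proof. by move=> /KP[]. Qed.

Lemma Krc a : K' a -> K (rc a).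
Proof. by move=> Ka; apply/KP; rewrite of_coordsK; split => //; exact: of_coords_L2. Qed.

Lemma TK t f : 0 <= t -> K f -> K (T t f).
Proof. by have [h _] := TS; exact: h. Qed.

Lemma K_lin a f h : K f -> K h -> K (fun x => a * f x + h x).
Proof.
move=> /KP[Lf Kf] /KP[Lh Kh]; apply/KP; split; first exact: L2_lin.
by rewrite (coords_lin _ _ a Lf Lh); apply: K'S.2.
Qed.

Lemma coords_T_lin t a f h : 0 <= t -> K f -> K h ->
  cm (T t (fun x => a * f x + h x)) = a *: cm (T t f) + cm (T t h).
Proof.
move=> t0 Kf Kh; have [_ [TL _]] := TS.
have LTf := KL2 (TK t0 Kf); have LTh := KL2 (TK t0 Kh).
rewrite -(coords_lin _ _ a LTf LTh).
apply/(coords_ae Lphi cphi (KL2 (TK t0 (K_lin a Kf Kh))) (L2_lin a LTf LTh)).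
exact: TL.
Qed.

Lemma coords_T_le t f : 0 <= t -> K f -> nrm (cm (T t f)) <= nrm (cm f).
Proof.
move=> t0 Kf; have [_ [_ [TC _]]] := TS; have := TC t f t0 Kf.
by rewrite (normH_coords (KL2 Kf)) (normH_coords (KL2 (TK t0 Kf))) lee_fin.
Qed.

(** [T t] acts on functions, so its compatibility with almost everywhere equality needs proof: by
    linearity and contractivity the images of two representatives differ by a vector of norm 0. *)
Lemma coords_T_eq t f h : 0 <= t -> K f -> K h -> cm f = cm h -> cm (T t f) = cm (T t h).
Proof.
move=> t0 Kf Kh fh; have := coords_T_le t0 (K_lin (-1) Kf Kh).
rewrite (coords_T_lin (-1) t0 Kf Kh) (coords_lin _ _ (-1) (KL2 Kf) (KL2 Kh)) fh !scaleN1r.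
rewrite addNr (nrm0 HL) => h0; apply/esym/eqP; rewrite -subr_eq0 addrC; apply/eqP/(nrm_eq0 HL).
by apply/eqP; rewrite eq_le h0 nrm_ge0.
Qed.

Lemma sgl2_coords t f : 0 <= t -> K f -> sgl2 t (cm f) = cm (T t f).
Proof.
move=> t0 Kf; apply: coords_T_eq => //; last by rewrite of_coordsK.
by apply: Krc; have /KP[] := Kf.
Qed.

Lemma sgl2_gen u w : K u -> K w -> gen (ip:=@l2ip R) sgl2 (cm u) (cm w) <->
  normH P (fun x => t^-1 * (T t u x - u x) - w x) @[t --> 0^'+] --> 0%E.
Proof.
move=> Ku Kw; have Lu := KL2 Ku; have Lw := KL2 Kw.
have E t : 0 < t -> (fun x => t^-1 * (T t u x - u x) - w x) =
    (fun x => t^-1 * (T t u \- u) x + (fun x => -1 * w x) x).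
  by move=> t0; apply/funext => x; rewrite mulN1r.
have LN : L2 (fun x => -1 * w x) by exact: L2_scale.
have cN : cm (fun x => -1 * w x) = - cm w.
  have -> : (fun x => -1 * w x) = (fun x => -1 * w x + 0) by apply/funext => x; rewrite addr0.
  rewrite (coords_lin _ _ (-1) Lw (L2_0 P)) scaleN1r (_ : cm (fun=> 0) = 0) ?addr0//.
  by apply: l2P => k; rewrite (coordsE _ _ k (L2_0 P)) ip_0l.
have LT t : 0 < t -> L2 (fun x => t^-1 * (T t u x - u x) - w x).
  move=> t0; rewrite E//; apply: L2_lin => //; apply: L2B => //; exact: KL2 (TK (ltW t0) Ku).
have nE t : 0 < t -> Num.sqrt (ip (fun x => t^-1 * (T t u x - u x) - w x)
    (fun x => t^-1 * (T t u x - u x) - w x)) = nrm (t^-1 *: (sgl2 t (cm u) - cm u) - cm w).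
  move=> t0; rewrite -(nrm_coords Lphi cphi (LT t t0)); congr nrm.
  have LTu := KL2 (TK (ltW t0) Ku).
  rewrite (E t t0) (coords_lin _ _ _ (L2B LTu Lu) LN) cN (coordsB _ _ LTu Lu).
  by rewrite (sgl2_coords (ltW t0) Ku).
have nL : \forall t \near 0^'+, L2 (fun x => t^-1 * (T t u x - u x) - w x).
  by apply/near_right0; exists 1 => // t t0 _; exact: LT.
have -> : (normH P (fun x => t^-1 * (T t u x - u x) - w x) @[t --> 0^'+] --> 0%E) <-> _ :=
  normH_cvg0 nL.
split=> h e e0.
  have [r r0 rP] := h e e0; apply/near_right0; exists r => // t t0 tr.
  by rewrite nE//; exact: rP.
have [r r0 rP] := (near_right0 _).1 (h e e0); exists r => // t t0 tr.
by rewrite -nE//; exact: rP.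
Qed.

Lemma sgl2_semigroup : semigroup (ip:=@l2ip R) K' sgl2.
Proof.
have [_ [_ [_ [T0 [TD Tc]]]]] := TS.
split.
- by move=> t a t0 /Krc Ka; have /KP[] := TK t0 Ka.
- move=> t c a b t0 Ka Kb; have Kra := Krc Ka; have Krb := Krc Kb.
  rewrite -(coords_T_lin c t0 Kra Krb) -(sgl2_coords t0 (K_lin c Kra Krb)).
  by rewrite (coords_lin _ _ c (of_coords_L2 _ _ _ _) (of_coords_L2 _ _ _ _)) !of_coordsK.
- by move=> t a t0 /Krc Ka; have := coords_T_le t0 Ka; rewrite of_coordsK.
- move=> s t a s0 t0 /Krc Ka; have Kt := TK t0 Ka.
  rewrite [sgl2 t a]/sgl2 (sgl2_coords s0 Kt).
  apply/(coords_ae Lphi cphi (KL2 (TK (addr_ge0 s0 t0) Ka)) (KL2 (TK s0 Kt))).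
  exact: TD.
split=> [a /Krc Ka|a /Krc Ka e e0].
  have := T0 _ Ka; move/(coords_ae Lphi cphi (KL2 (TK (lexx 0) Ka)) (KL2 Ka)).
  by rewrite of_coordsK.
have nL : \forall t \near 0^'+, L2 (T t (rc a) \- rc a).
  apply/near_right0; exists 1 => // t t0 _.
  by apply: L2B (KL2 _) (KL2 Ka); exact: TK (ltW t0) Ka.
have [r r0 rP] := (near_right0 _).1 ((normH_cvg0 nL).1 (Tc _ Ka) e e0).
exists r => // t t0 tr; have := rP t t0 tr.
have LT := KL2 (TK (ltW t0) Ka).
by rewrite -(nrm_coords Lphi cphi (L2B LT (KL2 Ka))) (coordsB _ _ LT (KL2 Ka)) of_coordsK.
Qed.

End transfer.

(** * The operator [B] in H^1 coordinates *)

Section transport.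
Context {R : realType} {d : nat} {M : riemannian_manifold R d}.
Context {P : probability (borel M) R} {U : M -> R} {lam : nat -> R} {phi : nat -> M -> R}.
Implicit Types f h u v : M -> R.
Local Notation L2 := (L2 P).
Local Notation ip := (ip P).
Local Notation nrm := (nrm (ip:=@l2ip R)).
Local Notation scvg := (scvg (ip:=@l2ip R)).
Hypothesis HU : Ck_fun 1 U.
Hypothesis lam_ge0 : forall k, 0 <= lam k.
Hypothesis lam0 : lam 0%N = 0.
Hypothesis Lphi : forall k, L2 (phi k).
Hypothesis ophi : forall k l, ip (phi k) (phi l) = (k == l)%:R.
Hypothesis cphi : forall f, L2 f ->
     cvgH P (fun n x => \sum_(0 <= k < n) ip f (phi k) * phi k x) f.
Hypothesis Aphi : forall k, Aop P U (phi k) (fun x => - lam k * phi k x).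
Hypothesis phi0 : exists a : R, aeeq P (phi 0%N) (fun=> a).
Local Notation cm := (coords Lphi cphi).
Local Notation rc := (of_coords Lphi ophi cphi).
Local Notation J := (multiplier (weight_le1 lam_ge0)).
Local Notation HL := (@l2_hilbert R).
Local Notation H1 := (Hm P lam phi 1).
Local Notation H2 := (Hm P lam phi 2).
Variables (b : vfield M) (B : (M -> R) -> M -> R).
Hypothesis HB : transport_extension P b H1 B.

Lemma rcL a : L2 (rc a). Proof. exact: of_coords_L2. Qed.

Lemma H1J u a : L2 u -> cm u = J a -> H1 u.
Proof. by move=> Lu ua; apply/(Hm1P lam_ge0 Lphi cphi); split => //; exists a. Qed.

Lemma H1rc a : H1 (rc (J a)).
Proof. by apply: (@H1J _ a); [exact: rcL|rewrite of_coordsK]. Qed.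

Lemma J_lin c (x y : l2 R) : J (c *: x + y) = c *: J x + J y.
Proof. exact: linearP. Qed.

Definition BJ a : l2 R := cm (B (rc (J a))).

Lemma B_L2 u : H1 u -> L2 (B u). Proof. by have [h _ _] := HB; exact: h. Qed.

Lemma B_scvg (u_ : nat -> M -> R) u (a_ : nat -> l2 R) a :
  (forall n, L2 (u_ n)) -> L2 u -> (forall n, cm (u_ n) = J (a_ n)) -> cm u = J a ->
  scvg a_ a -> scvg (fun n => cm (B (u_ n))) (cm (B u)).
Proof.
move=> Lu_ Lu ua_ ua aa; have [_ _ Bc] := HB.
have Hu_ n : H1 (u_ n) by apply: H1J (Lu_ n) (ua_ n).
have Hu : H1 u by apply: H1J Lu ua.
apply: (cvgH_coords Lphi cphi (fun n => B_L2 (Hu_ n)) (B_L2 Hu)).1; apply: Bc => //.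
have E n : ip1 P (u_ n \- u) (u_ n \- u) + ip (u_ n \- u) (u_ n \- u) = nrm (a_ n - a) ^+ 2.
  have LB := L2B (Lu_ n) Lu.
  have cB : cm (u_ n \- u) = J (a_ n - a) by rewrite (coordsB _ _ (Lu_ n) Lu) ua_ ua JB.
  rewrite (ip1E HU lam0 ophi Aphi phi0 LB LB cB cB) -(coords_ip Lphi cphi LB LB) cB.
  by rewrite subrK (nrm_sqr HL).
rewrite /cvgH1; under eq_fun do rewrite E.
apply/cvgrPdist_lt => e e0; have se : 0 < Num.sqrt e by rewrite sqrtr_gt0.
have [N NP] := aa _ se; exists N => // n /NP h.
rewrite sub0r normrN ger0_norm ?sqr_ge0// -[ltRHS]sqr_sqrtr ?(ltW e0)//.
by rewrite ltr_pXn2r ?nnegrE ?nrm_ge0 ?sqrtr_ge0.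
Qed.

Lemma BJ_scvg (a_ : nat -> l2 R) a : scvg a_ a -> scvg (fun n => BJ (a_ n)) (BJ a).
Proof.
move=> aa; apply: (B_scvg (a_ := a_) (a := a)) => //.
- by move=> n; exact: rcL.
- exact: rcL.
- by move=> n; rewrite of_coordsK.
- by rewrite of_coordsK.
Qed.

Lemma scvg_cst (a : l2 R) : scvg (fun=> a) a.
Proof. by move=> e e0; exists 0%N => n _; rewrite subrr (nrm0 HL). Qed.

(** Continuity of [B] along a constant sequence, with a possibly different representative as its
    limit, shows that [B] respects almost everywhere equality. *)
Lemma B_BJ u a : L2 u -> cm u = J a -> cm (B u) = BJ a.
Proof.
move=> Lu ua; apply: (scvg_uniq HL) (scvg_cst _) _.
apply: (B_scvg (a_ := fun=> a) (a := a)) => //.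
- exact: rcL.
- by rewrite of_coordsK.
- exact: scvg_cst.
Qed.

(** A vector [y] orthogonal to the range is orthogonal to J (J y), which means that J y has norm
    0. *)
Lemma J_dense a : in_closure (ip:=@l2ip R) (range J) a.
Proof.
have SJ : lin_subspace (range J).
  split; first by exists 0 => //; exact: raddf0.
  by move=> c x y [z _ <-] [z' _ <-]; exists (c *: z + z') => //; rewrite linearP.
have [p Sp ap] := projection HL a SJ.
suff -> : a = p by [].
apply/eqP; rewrite -subr_eq0; apply/eqP; move: (a - p) ap => y yS.
apply: (@J_inj _ _ lam_ge0); rewrite raddf0; apply: (nrm_eq0 HL).
have := yS (J (J y)) (ex_intro2 _ _ (J y) I erefl); rewrite -multiplier_sym.
by rewrite -(nrm_sqr HL) => /eqP; rewrite sqrf_eq0 => /eqP.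
Qed.

Lemma ker_in_coords (C : l2 R -> l2 R) : (forall a, C a = J (BJ a)) ->
  forall u, ker_in P H1 B u <-> L2 u /\ exists2 a, C a = 0 & cm u = J a.
Proof.
move=> CE u; have L0 := L2_0 P.
have c0 : cm (fun=> 0) = 0 by apply: l2P => k; rewrite (coordsE _ _ k L0) ip_0l.
split=> [[Hu Bu]|[Lu [a Ca ua]]].
  have [Lu [a ua]] := (Hm1P lam_ge0 Lphi cphi u).1 Hu; split => //; exists a => //.
  rewrite CE -(B_BJ Lu ua) (_ : cm (B u) = 0) ?raddf0//.
  by rewrite -c0; apply/(coords_ae Lphi cphi (B_L2 Hu) L0).
have Hu := H1J Lu ua; split => //.
apply/(coords_ae Lphi cphi (B_L2 Hu) L0); rewrite c0 (B_BJ Lu ua).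
by apply: (@J_inj _ _ lam_ge0); rewrite -CE Ca raddf0.
Qed.

Variable T : R -> R -> (M -> R) -> M -> R.
Hypothesis HT : forall c : R, contraction_semigroup P L2 (T c) /\
  generated_by P L2 (T c) (perturbed P H2 (Aop P U) B c).
Local Notation TL c := (sgl2 Lphi ophi cphi (T c)).

Lemma L2T f : L2 f <-> L2 f /\ [set: l2 R] (cm f). Proof. by split=> [|[]]. Qed.

Lemma subspaceT : lin_subspace [set: l2 R]. Proof. by []. Qed.

Lemma TL_semigroup c : semigroup (ip:=@l2ip R) setT (TL c).
Proof. exact: (sgl2_semigroup ophi L2T subspaceT (HT c).1). Qed.

Lemma TL_gen c z : gen (ip:=@l2ip R) (TL c) (J (J z)) (J (J z) - z + c *: BJ (J z)).
Proof.
pose u := rc (J (J z)); have Lu : L2 u by exact: rcL.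
pose a := rc (J (J z) - z); have La : L2 a by exact: rcL.
pose w := fun x => c * B u x + a x.
have LBu : L2 (B u) by apply: B_L2; exact: H1rc.
have Lw : L2 w by exact: L2_lin.
have cu : cm u = J (J z) by rewrite of_coordsK.
have cw : cm w = J (J z) - z + c *: BJ (J z).
  by rewrite (coords_lin _ _ c LBu La) of_coordsK addrC.
rewrite -cw -cu.
apply/(sgl2_gen ophi L2T subspaceT (HT c).1 Lu Lw).
apply/((HT c).2 u w Lu Lw); split; first exact: Hm2_JJ.
exists a; split; first exact: Aop_JJ.
by apply: aeW => x; rewrite /w addrC.
Qed.

(** The generator at parameter 1 is linear and single-valued, and its part coming from A is
    explicitly linear on the range of J^2; the remaining part must be linear too. *)
Lemma BJJ_linear c z z' : BJ (J (c *: z + z')) = c *: BJ (J z) + BJ (J z').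
Proof.
have := gen_lin HL (TL_semigroup 1) c (TL_gen 1 z) (TL_gen 1 z').
rewrite -!J_lin => /(gen_uniq HL)/(_ (TL_gen 1 (c *: z + z'))).
rewrite !scale1r scalerDr scalerBr addrACA => /esym.
have -> : c *: J (J z) - c *: z + (J (J z') - z') = J (J (c *: z + z')) - (c *: z + z').
  by rewrite !J_lin opprD addrACA.
by move/addrI.
Qed.

Lemma BJ_linear c x y : BJ (c *: x + y) = c *: BJ x + BJ y.
Proof.
have [x_ xJ xx] := scvg_approx HL (J_dense x); have [y_ yJ yy] := scvg_approx HL (J_dense y).
apply: (scvg_uniq HL) (BJ_scvg (scvg_lin HL c xx yy)) _.
rewrite (_ : (fun n => _) = (fun n => c *: BJ (x_ n) + BJ (y_ n))).
  by apply: (scvg_lin HL); exact: BJ_scvg.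
apply/funext => n; have [z _ <-] := xJ n; have [z' _ <-] := yJ n.
by rewrite -J_lin BJJ_linear.
Qed.

Lemma BJ0 : BJ 0 = 0.
Proof. by have := BJ_linear (-1) 0 0; rewrite scaleN1r oppr0 addr0 scaleN1r addNr. Qed.

Lemma BJZ c x : BJ (c *: x) = c *: BJ x.
Proof. by have := BJ_linear c x 0; rewrite !addr0 BJ0 addr0. Qed.

(** Sequential continuity at 0 suffices: were there no bound, the vectors [y n], of norm 1/(n+1),
    would tend to 0 with images of norm above 1. *)
Lemma BJ_bounded : exists2 k : R, 0 <= k & forall a, nrm (BJ a) <= k * nrm a.
Proof.
apply: contrapT => H.
have /choice [a_ aP] : forall n, exists a, n.+1%:R * nrm a < nrm (BJ a).
  move=> n; apply: contrapT => h; apply: H; exists n.+1%:R => // a.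
  by rewrite leNgt; apply/negP => ha; apply: h; exists a.
have na n : 0 < nrm (a_ n).
  rewrite lt_neqAle nrm_ge0 andbT; apply/eqP => /esym /(nrm_eq0 HL) a0.
  by have := aP n; rewrite a0 BJ0 !(nrm0 HL) mulr0 ltxx.
pose y n := (n.+1%:R * nrm (a_ n))^-1 *: a_ n.
have p n : 0 < n.+1%:R * nrm (a_ n) by rewrite mulr_gt0.
have y0 : scvg y 0.
  move=> e e0; have [N _ NP] := near_infty_natSinv_lt (PosNum e0); exists N => n /NP /=.
  rewrite subr0 /y (nrmZ HL) gtr0_norm ?invr_gt0// invfM -mulrA mulVf ?mulr1//.
  by rewrite gt_eqF.
have [N NP] := BJ_scvg y0 ltr01; have := NP N (leqnn N).
rewrite BJ0 subr0 /y BJZ (nrmZ HL) gtr0_norm ?invr_gt0// mulrC ltr_pdivrMr// mul1r => h.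
by have := lt_trans h (aP N); rewrite ltxx.
Qed.

Lemma BJ_diag z : l2ip (BJ (J z)) (J (J z)) = 0.
Proof.
have h c : l2ip (J (J z) - z) (J (J z)) + c * l2ip (BJ (J z)) (J (J z)) <= 0.
  have [_ D Z _ _ _] := HL.
  by have := gen_dissipative HL (TL_semigroup c) (TL_gen c z); rewrite D Z.
apply/eqP/negPn/negP => q0; move: h; move: (l2ip _ _) (l2ip _ _) q0 => q p q0 h.
(* At this parameter the affine expression, supposedly nonpositive, equals 1. *)
by have := h ((1 - q) / p); rewrite divfK// addrC subrK ler10.
Qed.

Lemma generator_transport : exists (C : {linear l2 R -> l2 R}) (k : R),
  [/\ forall a, C a = J (BJ a), forall a, nrm (C a) <= k * nrm a &
   forall x y, l2ip (C x) y = - l2ip x (C y)].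
Proof.
pose C0 a := J (BJ a).
have C0lin : linear C0 by move=> c x y; rewrite /C0 BJ_linear J_lin.
pose C : {linear l2 R -> l2 R} := HB.pack C0 (GRing.isLinear.Build R (l2 R) (l2 R) _ C0 C0lin).
have CE a : C a = J (BJ a) by [].
have [k k0 kP] := BJ_bounded.
have Cb a : nrm (C a) <= k * nrm a by rewrite CE; apply: le_trans (kP a); exact: J_le.
have [S D Z _ _ _] := HL.
have CJ z : l2ip (C (J z)) (J z) = 0 by rewrite CE multiplier_sym BJ_diag.
have Cxx x : l2ip (C x) x = 0.
  apply/eqP; rewrite -normr_le0; apply/ler_addgt0Pr => e e0; rewrite add0r.
  (* Extension from the dense range of [J]: for [y] there, <C x, x> = <C (x - y), x> + <C y, x - y>,
     and [K] bounds both terms relative to the distance from [x] to [y], once that distance is at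
     most 1. *)
  pose K := k * nrm x + (k * (nrm x + 1)).
  have K0 : 0 <= K by rewrite addr_ge0 ?mulr_ge0 ?addr_ge0 ?nrm_ge0.
  have K1 : 0 < K + 1 by rewrite ltr_wpDl.
  pose r := Num.min 1 (e / (K + 1)).
  have r0 : 0 < r by rewrite lt_min ltr01 divr_gt0.
  have [_ [z _ <-] xz] := J_dense x r0; set y := J z in xz *.
  have ny : nrm y <= nrm x + 1.
    rewrite -[y](subKr x); apply: le_trans (nrmD HL _ _) _; rewrite (nrmN HL) lerD2l.
    by apply: ltW; apply: lt_le_trans xz _; rewrite ge_min lexx.
  have -> : l2ip (C x) x = l2ip (C (x - y)) x + l2ip (C y) (x - y).
    by rewrite raddfB (ipBl HL) (ipBr HL) [l2ip (C y) y]CJ subr0 subrK.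
  apply: le_trans (_ : r * K <= _); last first.
    apply: le_trans (_ : e / (K + 1) * K <= _); first by rewrite ler_wpM2r// ge_min lexx orbT.
    by rewrite mulrAC ler_pdivrMr// ler_wpM2l ?(ltW e0)// lerDl.
  apply: le_trans (ler_normD _ _) _; rewrite mulrDr; apply: lerD.
    apply: le_trans (normr_ip_le HL _ _) _; rewrite mulrA ler_wpM2r ?nrm_ge0//.
    by apply: le_trans (Cb _) _; rewrite mulrC ler_wpM2r// ltW.
  apply: le_trans (normr_ip_le HL _ _) _; rewrite mulrC; apply: ler_pM; rewrite ?nrm_ge0 ?(ltW xz)//.
  by apply: le_trans (Cb _) _; rewrite ler_wpM2l.
exists C, k; split => // x y.
(* Polarization of <C x, x> = 0. *)
have := Cxx (x + y); rewrite raddfD D !(ipDr HL) !Cxx add0r addr0 => /eqP.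
by rewrite addr_eq0 => /eqP ->; rewrite S.
Qed.

End transport.

Theorem theorem6 (R : realType) (d : nat) (M : riemannian_manifold R d)
  (vol : {measure set (borel M) -> \bar R})
  (Hvol : riemannian_volume vol)
  (U : M -> R) (HU : Ck_fun 1 U)
  (P : probability (borel M) R)
  (HP : forall E : set (borel M), measurable E ->
     P E = (\int[vol]_(x in E) (expR (- U x))%:E)%E)
  (lam : nat -> R) (phi : nat -> M -> R)
  (Hspec : discrete_spectrum P (Aop P U) lam phi)
  (b : vfield M) (Hb : C1_vfield b)
  (Hdiv : forall x, divv (fun i z => expR (- U z) *: b i z) x = 0)
  (Hdom : Hm P lam phi 1 `<=` dom_transport P b)
  (B : (M -> R) -> M -> R)
  (HB : transport_extension P b (Hm P lam phi 1) B)
  (T : R -> R -> (M -> R) -> M -> R)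
  (HT : forall c : R,
     contraction_semigroup P (L2 P) (T c) /\
     generated_by P (L2 P) (T c)
       (perturbed P (Hm P lam phi 2) (Aop P U) B c))
  (Tstar : R -> (M -> R) -> M -> R)
  (HTstar :
     let D := ker_in P (Hm P lam phi 1) B in
     let K := closureH P D in
     contraction_semigroup P K Tstar /\
     symmetric_semigroup P K Tstar /\
     generated_by P K Tstar (form_operator P K D (ip1 P))) :
  forall (t : R) (psi : M -> R), 0 <= t ->
    closureH P (ker_in P (Hm P lam phi 1) B) psi ->
    forall eps : R, 0 < eps -> exists C : R, forall c : R, C < `|c| ->
      (normH P (T c t psi \- Tstar t psi)%R < eps%:E)%E.
Proof.
have [[lam0 _] lamS _ [Aphi ophi cphi] phi0] := Hspec.
have lam_ge0 k : 0 <= lam k by elim: k => [|k IH]; [rewrite lam0|exact: le_trans IH (lamS k)].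
have Lphi k : L2 P (phi k) by have [[]] := Aphi k.
pose cm := coords Lphi cphi; pose rc := of_coords Lphi ophi cphi.
pose J : {linear l2 R -> l2 R} := multiplier (weight_le1 lam_ge0).
have HL := @l2_hilbert R.
have [C [k [CE Cb Ca]]] := generator_transport HU lam_ge0 lam0 Lphi ophi cphi Aphi phi0 HB HT.
have Jinj x : J x = 0 -> x = 0.
  by move=> Jx; apply: (@J_inj _ _ lam_ge0); rewrite [RHS](raddf0 J).
pose D := ker_in P (Hm P lam phi 1) B; pose K := closureH P D.
have DP f : D f <-> L2 P f /\ kerdom (J:=J) (C:=C) (cm f).
  have h := ker_in_coords HU lam0 Aphi phi0 HB CE f.
  exact: h.
have KP f : K f <-> L2 P f /\ in_closure (ip:=@l2ip R) (kerdom (J:=J) (C:=C)) (cm f).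
  exact: (closureH_coords ophi DP f).
have KS := subspace_closure HL (@kerdom_subspace _ _ J C).
have [TsS [_ Tsgen]] := HTstar.
move=> t psi t0 Kpsi e e0.
(* [ip1E] turns the form equation, tested on all of [D], into the same equation tested on all [J k]
   with [C k = 0]. *)
have Sgen u w : in_closure (ip:=@l2ip R) (kerdom (J:=J) (C:=C)) u -> in_closure (ip:=@l2ip R) (kerdom (J:=J) (C:=C)) w ->
    gen (ip:=@l2ip R) (sgl2 Lphi ophi cphi Tstar) u w <->
    exists2 a, C a = 0 & u = J a /\ forall k, C k = 0 -> l2ip a k - l2ip (J a) (J k) = - l2ip w (J k).
  move=> Ku Kw; have Kru := Krc ophi KP Ku; have Krw := Krc ophi KP Kw.
  have Lu : L2 P (rc u) := of_coords_L2 _ _ _ _; have Lw : L2 P (rc w) := of_coords_L2 _ _ _ _.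
  have gE := sgl2_gen ophi KP KS TsS Kru Krw; rewrite !of_coordsK in gE.
  rewrite gE -(Tsgen _ _ Kru Krw); split=> [[Du _ E]|[a Ca0 [ua E]]].
    have [_ [a Ca0 ua]] := (DP _).1 Du; rewrite /cm of_coordsK in ua; exists a => //; split=> // x Cx.
    have Lx : L2 P (rc (J x)) := of_coords_L2 _ _ _ _.
    have cx : coords Lphi cphi (rc (J x)) = J x by rewrite of_coordsK.
    have cu : coords Lphi cphi (rc u) = J a by rewrite of_coordsK.
    rewrite -(ip1E HU lam0 ophi Aphi phi0 Lu Lx cu cx) E; last first.
      by apply/DP; split => //; exists x.
    by rewrite -(coords_ip Lphi cphi Lw Lx) cx of_coordsK.
  have cu : coords Lphi cphi (rc u) = J a by rewrite of_coordsK.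
  split=> //; first by apply/DP; split => //; exists a.
  move=> v /DP[Lv [x Cx vx]].
  rewrite (ip1E HU lam0 ophi Aphi phi0 Lu Lv cu vx) E//.
  have vx' : coords Lphi cphi v = J x := vx.
  by rewrite -(coords_ip Lphi cphi Lw Lv) of_coordsK vx'.
have Tgen c y x : y - c *: C y = J x ->
    gen (ip:=@l2ip R) (sgl2 Lphi ophi cphi (T c)) (J y) (J y - x).
  (* The equation y - c C y = J x with C = J B J reads y = J z for this [z], so [J y] has the form J
     (J z) to which [TL_gen] applies. *)
  move=> yx; pose By := BJ lam_ge0 Lphi ophi cphi B y; pose z := c *: By + x.
  have yz : J z = y.
    have CyE : J By = C y by rewrite CE.
    by rewrite /z linearP CyE -yx addrC subrK.
  have := TL_gen HU lam_ge0 lam0 Lphi ophi cphi Aphi phi0 HB HT c z.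
  rewrite -/J (yz : multiplier (weight_le1 lam_ge0) z = y) -/By.
  by rewrite /z opprD addrA addrAC subrK.
have Kc : in_closure (ip:=@l2ip R) (kerdom (J:=J) (C:=C)) (cm psi) := ((KP _).1 Kpsi).2.
have [N NP] := trotter_kato HL (multiplier_sym _) (multiplier_le _) Jinj
  Cb Ca (TL_semigroup Lphi ophi cphi HT) Tgen (sgl2_semigroup ophi KP KS TsS) Sgen t0 Kc e0.
exists N => c /NP.
have LT f : L2 P f -> L2 P (T c t f) by exact: (HT c).1.1.
have Lpsi := ((KP _).1 Kpsi).1.
have LTs : L2 P (Tstar t psi) by have /KP[] := TsS.1 t psi t0 Kpsi.
rewrite (sgl2_coords ophi (L2T Lphi cphi) (@subspaceT R) (HT c).1 t0 Lpsi) (sgl2_coords ophi KP KS TsS t0 Kpsi).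
rewrite -(coordsB _ _ (LT _ Lpsi) LTs) (normH_coords Lphi cphi (L2B (LT _ Lpsi) LTs)).
by rewrite lte_fin.
Qed.
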